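(* Let $0<\epsilon<1$, let $n$ be the number of vertices of $G=(V,E)$ and $\theta=10^{-10}\frac{\epsilon^{1/4}}{n^{5/2}}$. There exists an algorithm which, given two hardcore models $(G,\lambda^\mu),(G,\lambda^\nu)$ on $G$ with Gibbs distributions $\mu,\nu$ and $\epsilon$, if both satisfy the uniqueness condition and $d_{\mathrm{par}}(\mu,\nu)<\theta$, returns a random number $\hat d$ in time $\tilde O\left(\frac{n^7}{\epsilon^2}+\frac{n^{6.5}}{\epsilon^{9/4}}\right)$ such that $(1-\epsilon)d_{TV}(\mu,\nu)\le\hat d\le(1+\epsilon)d_{TV}(\mu,\nu)$ with probability at least $2/3$.
   Context: Hardcore model $(G,\lambda)$, $\lambda\in\mathbb{R}_{\ge0}^V$: weight on $\sigma\in\{-1,+1\}^V$ is $\prod_{v:\sigma_v=+1}\lambda_v$ if $\{v:\sigma_v=+1\}$ is independent in $G$, else $0$; Gibbs distribution is the normalized weight. Uniqueness condition: $\lambda_v\le(1-\eta)\lambda_c(\Delta)$ for all $v$ for a constant $\eta\in(0,1)$, with $\Delta\ge3$ the maximum degree and $\lambda_c(\Delta)=\frac{(\Delta-1)^{\Delta-1}}{(\Delta-2)^\Delta}$. $d_{\mathrm{par}}(\mu,\nu)=\max_{v\in V}|\lambda^\mu_v-\lambda^\nu_v|$. $\tilde O$ hides constants depending on $\eta$ and polylogarithmic factors in $n/\epsilon$. *)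

(* Defs.v *)
From HB Require Import structures.
From mathcomp Require Import all_boot all_order all_algebra.
From mathcomp Require Import all_classical all_reals all_analysis.
Set Implicit Arguments. Unset Strict Implicit. Unset Printing Implicit Defensive.
Import Order.TTheory GRing.Theory Num.Theory.
Local Open Scope ring_scope.

(* A configuration sigma : {ffun 'I_n -> bool}, true encodes +1.      *)
Section Hardcore.
Variables (R : realType) (n : nat) (e : rel 'I_n).

Definition simple_graph : Prop :=
  (forall u v, e u v = e v u) /\ (forall v, e v v = false).

Definition degree (v : 'I_n) : nat := #|[set u | e v u]|.
Definition max_degree : nat := (\max_(v < n) degree v)%N.

Definition lambda_c (D : nat) : R :=
  (D.-1)%:R ^+ D.-1 / (D.-2)%:R ^+ D.

Definition indep (sigma : {ffun 'I_n -> bool}) : bool :=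
  [forall u, forall v, (sigma u && sigma v) ==> ~~ e u v].

Definition hc_weight (lam : 'I_n -> R) (sigma : {ffun 'I_n -> bool}) : R :=
  if indep sigma then \prod_(v < n | sigma v) lam v else 0.

Definition hc_Z (lam : 'I_n -> R) : R :=
  \sum_(sigma : {ffun 'I_n -> bool}) hc_weight lam sigma.

Definition gibbs (lam : 'I_n -> R) (sigma : {ffun 'I_n -> bool}) : R :=
  hc_weight lam sigma / hc_Z lam.

Definition dTV (lamm laml : 'I_n -> R) : R :=
  2^-1 * \sum_(sigma : {ffun 'I_n -> bool}) `|gibbs lamm sigma - gibbs laml sigma|.

Definition uniqueness (eta : R) (lam : 'I_n -> R) : Prop :=
  forall v, lam v <= (1 - eta) * lambda_c max_degree.

(* parameter distance d_par < theta, written out (max over v) *)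
Definition dpar_lt (lamm laml : 'I_n -> R) (theta : R) : Prop :=
  forall v, `|lamm v - laml v| < theta.

End Hardcore.

(* Machine model: a randomized RAM with unit-cost natural-number      *)
(* registers (indirect addressing, add/sub, fair coin flips) and      *)
(* unit-cost exact real registers (BSS-style: + - * /, integer        *)
(* constants, nat->real conversion, comparisons for branching).       *)
Inductive instr : Type :=
| NConst (d c : nat)
| NAdd (d a b : nat)
| NSub (d a b : nat)
| NLoad (d a : nat)
| NStore (a s : nat)
| RConst (d : nat) (z : int)
| RAdd (d a b : nat) | RSub (d a b : nat)
| RMul (d a b : nat) | RDiv (d a b : nat)
| RLoad (d a : nat)
| RStore (a s : nat)
| OfNat (d a : nat)
| JLeN (a b t : nat)
| JLtR (a b t : nat)
| Jmp (t : nat)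
| Coin (d : nat)
| Halt.

Record mstate (R : realType) := MState {
  pc : nat; nreg : nat -> nat; rreg : nat -> R; used : nat }.

Section Machine.
Variables (R : realType) (prog : seq instr) (bits : nat -> bool).

Definition upd {T} (f : nat -> T) (i : nat) (x : T) : nat -> T :=
  fun j => if j == i then x else f j.

Definition halted (s : mstate R) : bool :=
  match nth Halt prog (pc s) with Halt => true | _ => false end.

Definition step (s : mstate R) : mstate R :=
  let N := nreg s in let X := rreg s in let p := pc s in let u := used s in
  match nth Halt prog p with
  | NConst d c => MState (p.+1) (upd N d c) X u
  | NAdd d a b => MState (p.+1) (upd N d (N a + N b)%N) X u
  | NSub d a b => MState (p.+1) (upd N d (N a - N b)%N) X u
  | NLoad d a => MState (p.+1) (upd N d (N (N a))) X u
  | NStore a s' => MState (p.+1) (upd N (N a) (N s')) X u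
  | RConst d z => MState (p.+1) N (upd X d (z%:~R)) u
  | RAdd d a b => MState (p.+1) N (upd X d (X a + X b)) u
  | RSub d a b => MState (p.+1) N (upd X d (X a - X b)) u
  | RMul d a b => MState (p.+1) N (upd X d (X a * X b)) u
  | RDiv d a b => MState (p.+1) N (upd X d (X a / X b)) u
  | RLoad d a => MState (p.+1) N (upd X d (X (N a))) u
  | RStore a s' => MState (p.+1) N (upd X (N a) (X s')) u
  | OfNat d a => MState (p.+1) N (upd X d ((N a)%:R)) u
  | JLeN a b t => MState (if (N a <= N b)%N then t else p.+1) N X u
  | JLtR a b t => MState (if X a < X b then t else p.+1) N X u
  | Jmp t => MState t N X u
  | Coin d => MState (p.+1) (upd N d (nat_of_bool (bits u))) X (u.+1)
  | Halt => s
  end.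

Fixpoint run (fuel : nat) (s : mstate R) : option (mstate R) :=
  if halted s then Some s else
  match fuel with 0 => None | f.+1 => run f (step s) end.

End Machine.

(* Input encoding of (G, lambda^mu, lambda^nu, eps):
   N[0] = n, N[1 + u*n + v] = [uv in E]; X[v] = lambda^mu_v,
   X[n+v] = lambda^nu_v, X[2n] = eps; all other registers 0.
   Output: X[0] at halting. *)
Definition init_state (R : realType) (n : nat) (e : rel 'I_n)
  (lamm laml : 'I_n -> R) (eps : R) : mstate R :=
  MState 0
    (fun i => if i == 0%N then n else
       nat_of_bool [exists u : 'I_n, exists v : 'I_n,
                      (i.-1 == u * n + v)%N && e u v])
    (fun i => if [pick v : 'I_n | val v == i] is Some v then lamm v else
       if [pick v : 'I_n | (n + val v)%N == i] is Some v then laml v else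
       if i == (n + n)%N then eps else 0)
    0.

Definition output_within (R : realType) (prog : seq instr) (T : nat)
  (bits : nat -> bool) (s0 : mstate R) : option R :=
  omap (fun s => rreg s 0) (run prog bits T s0).

Definition bits_of (T : nat) (b : {ffun 'I_T -> bool}) : nat -> bool :=
  fun i => if (i < T)%N =P true is ReflectT h then b (Ordinal h) else false.

(* Main.v *)
(** Under the uniqueness condition the total influence of a vertex is bounded.
    Deleting the neighbours of [v] one at a time expresses the marginal of [v]
    through marginals in smaller vertex sets, without any self-avoiding walk
    tree, and weighting the influence of [w] by the square root of its marginal
    makes uniqueness a contraction.  Scaling the field by [t] makes the bound
    [1 + C t].  Let [g t] be the expected variance of [f X] given the random
    subset of [X] that keeps each vertex with probability [1 - t].  Spectral
    independence gives [t g' <= (1 + C t) g], so that [g t / t * exp (- C t)] is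
    nonincreasing, and comparing [t = 1] with [t -> 0] is a Poincare inequality
    with constant [exp C].  Hence the Glauber dynamics mixes in polynomial time.

    The algorithm runs Glauber dynamics for a field slightly above both given
    fields, whose acceptance probabilities are dyadic, so that fair coins simulate
    it exactly.  Reweighting the samples gives a self-normalised estimate of the
    total variation distance.  Polynomially many samples give a relative error
    [eps]: the distance is at least a constant times the largest difference of the
    parameters, and the second moment of the estimated quantity is at most a
    polynomial times the square of that difference. *)

Require Import Defs.
From HB Require Import structures.
From mathcomp Require Import all_boot all_order all_algebra.
From mathcomp Require Import ring lra zify.
From mathcomp Require Import reals sequences exp.
From mathcomp Require boolp topology normedtype derive realfun.
Set Implicit Arguments. Unset Strict Implicit. Unset Printing Implicit Defensive.
Import Order.TTheory GRing.Theory Num.Theory.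
Local Open Scope ring_scope.

(** * Hardcore marginals and influences *)

(** The distance may be arbitrarily small, even 0, so an additive error anywhere would swamp it.
    Hence the sampler has to be correct up to a factor [1 +- eps / 20] at every single
    configuration, and everything averaged over the samples is controlled relative to its own mean
    or to the distance. The sampled field is the larger of the two given ones rounded up to a
    fraction [k / (M - k)], where [M = 2 ^ B] is of order [n]. It is positive even where both fields
    vanish, the reweighting factors lie in [0, 1], and the rounding is fine enough to stay below
    [(1 - eta / 2) * lambda_c] and to keep its partition function within a factor 3 of both given
    ones. Influences are bounded on every vertex subset, because pinning occupied vertices leaves a
    model on a smaller subset. With [E = 2 ^ L] of order [1 / eps], there are [M ^ 2 * E ^ 2]
    samples of [M ^ 3 * (B + L)] steps, each step costing order [n]: about [n ^ 6 / eps ^ 2] up to a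
    logarithm, within the first term of the time bound. *)

Lemma sum_split_mem (R : nmodType) (V : finType) (v : V) (F : {set V} -> R) :
  \sum_(S : {set V}) F S = \sum_(S : {set V} | v \notin S) (F S + F (v |: S)).
Proof.
rewrite (bigID (fun S : {set V} => v \notin S)) /= big_split /=; congr (_ + _).
rewrite (reindex_onto (fun S => v |: S) (fun S => S :\ v)) /=; last first.
  by move=> S; rewrite negbK => /setD1K.
apply: eq_bigl => S; rewrite negbK setU11 /=.
apply/idP/idP => [/eqP <-|vS]; first by rewrite setD11.
by rewrite setU1K.
Qed.

Lemma sum_split_mem_cond (R : nmodType) (V : finType) (v : V) (Q : pred {set V})
    (F : {set V} -> R) :
  \sum_(S : {set V} | Q S) F S = \sum_(S : {set V} | (v \notin S) && Q S) F S
                     + \sum_(S : {set V} | (v \notin S) && Q (v |: S)) F (v |: S).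
Proof.
rewrite big_mkcond (sum_split_mem v) big_split /=.
by rewrite [in RHS]big_mkcondr [X in _ = _ + X]big_mkcondr.
Qed.

Section Graph.
Variables (R : rcfType) (V : finType) (e : rel V).
Hypothesis esym : forall u v, e u v = e v u.
Hypothesis eirr : forall v, e v v = false.

Definition stable (S : {set V}) : bool :=
  [forall u in S, forall v in S, ~~ e u v].
Definition nbr (v : V) : {set V} := [set u | e v u].
Definition cl (v : V) : {set V} := v |: nbr v.

Lemma stable0 : stable set0.
Proof. by apply/forall_inP => u; rewrite inE. Qed.

Lemma stableP (S : {set V}) :
  reflect {in S &, forall u v, ~~ e u v} (stable S).
Proof.
apply: (iffP forall_inP) => [H u v uS vS|H u uS].
  by move/forall_inP: (H u uS); apply.
by apply/forall_inP => v vS; apply: H.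
Qed.

Lemma stableU1 (v : V) (S : {set V}) :
  stable (v |: S) = [disjoint S & nbr v] && stable S.
Proof.
apply/stableP/andP => [H|[dS /stableP H] x y].
  split; last by apply/stableP => x y xS yS; apply: H; rewrite inE ?xS ?yS orbT.
  apply/pred0P => x /=; apply/negP => /andP[xS].
  by rewrite inE => evx; have := H v x; rewrite !in_setU1 eqxx xS orbT evx => /(_ isT isT).
rewrite !in_setU1 => /predU1P[->|xS] /predU1P[->|yS]; last exact: H.
- by rewrite eirr.
- by apply/negP => evy; move: (disjointFr dS yS); rewrite inE evy.
- by rewrite esym; apply/negP => evy; move: (disjointFr dS xS); rewrite inE evy.
Qed.

Lemma stable_sub (S S' : {set V}) : S \subset S' -> stable S' -> stable S.
Proof.
by move=> /subsetP sS /stableP H; apply/stableP => x y /sS ? /sS ?; apply: H.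
Qed.

Section Field.
Variable lam : V -> R.
Hypothesis lam_ge0 : forall v, 0 <= lam v.

Definition wt (S : {set V}) : R :=
  if stable S then \prod_(v in S) lam v else 0.
Definition Zs (U : {set V}) : R := \sum_(S : {set V} | S \subset U) wt S.
(** This is the model on the graph induced on [U]: an occupied [v] forces its neighbours to be
    vacant, which leaves [U :\: cl v]. The value 0 outside [U] lets influences be summed over all of
    [V]. *)
Definition Pr (U : {set V}) (v : V) : R :=
  if v \in U then lam v * Zs (U :\: cl v) / Zs U else 0.

Lemma wt_ge0 S : 0 <= wt S.
Proof. by rewrite /wt; case: ifP => // _; apply: prodr_ge0. Qed.

Lemma wt0 : wt set0 = 1.
Proof. by rewrite /wt stable0 big_set0. Qed.

Lemma wtU1 v (S : {set V}) : v \notin S ->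
  wt (v |: S) = if [disjoint S & nbr v] then lam v * wt S else 0.
Proof.
move=> vS; rewrite /wt stableU1; case: [disjoint _ & _] => //=.
by case: ifP => _; [rewrite big_setU1 | rewrite mulr0].
Qed.

Lemma Zs_ge1 U : 1 <= Zs U.
Proof.
rewrite /Zs (bigD1 set0) ?sub0set //= wt0 lerDl.
by apply: sumr_ge0 => S _; apply: wt_ge0.
Qed.

Lemma Zs_gt0 U : 0 < Zs U.
Proof. exact: lt_le_trans (Zs_ge1 U). Qed.

Lemma Zs_neq0 U : Zs U != 0.
Proof. by rewrite gt_eqF ?Zs_gt0. Qed.

Lemma Zs_rec (U : {set V}) v : v \in U -> Zs U = Zs (U :\ v) + lam v * Zs (U :\: cl v).
Proof.
move=> vU; rewrite /Zs (sum_split_mem_cond v); congr (_ + _).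
  by apply: eq_bigl => S; rewrite subsetD1 andbC.
rewrite mulr_sumr [RHS](eq_bigl (fun S : {set V} =>
    [&& v \notin S, S \subset U & [disjoint S & nbr v]])); last first.
  move=> S; rewrite subsetD /cl disjoints_subset setCU subsetI.
  rewrite -!disjoints_subset disjoint_sym disjoints1.
  by case: (v \in S); rewrite /= ?andbF.
rewrite [RHS](eq_bigl (fun S : {set V} =>
    ((v \notin S) && (v |: S \subset U)) && [disjoint S & nbr v])); last first.
  by move=> S; rewrite subUset sub1set vU /= andbA.
rewrite [RHS]big_mkcondr /=; apply: eq_bigr => S /andP[vS _].
exact: wtU1.
Qed.

Lemma Pr_ge0 U v : 0 <= Pr U v.
Proof.
rewrite /Pr; case: ifP => // _.
by rewrite divr_ge0 ?mulr_ge0 // ltW ?Zs_gt0.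
Qed.

Lemma Pr_notin (U : {set V}) v : v \notin U -> Pr U v = 0.
Proof. by rewrite /Pr => /negbTE ->. Qed.

Lemma Zs_PrD1 U v : Zs (U :\ v) = Zs U * (1 - Pr U v).
Proof.
rewrite /Pr; case: ifP => [vU|/negbT vU]; last first.
  by rewrite subr0 mulr1 (setDidPl _) // disjoint_sym disjoints1.
have Z0 := Zs_neq0 U; rewrite mulrBr mulr1 mulrC divfK // {1}(Zs_rec vU).
by rewrite addrK.
Qed.

Lemma Pr_lt1 U v : Pr U v < 1.
Proof.
rewrite -subr_gt0 -(pmulr_rgt0 _ (Zs_gt0 U)) -Zs_PrD1; exact: Zs_gt0.
Qed.

Lemma Zs_le (U U' : {set V}) : U \subset U' -> Zs U <= Zs U'.
Proof.
move=> sU; rewrite /Zs [leRHS](bigID (fun S : {set V} => S \subset U)) /=.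
rewrite (eq_bigl (fun S : {set V} => (S \subset U') && (S \subset U))); last first.
  by move=> S; apply/idP/andP => [sS|[]//]; rewrite (subset_trans sS).
by rewrite lerDl sumr_ge0 // => S _; apply: wt_ge0.
Qed.

Lemma Pr_le_lam U v : Pr U v <= lam v.
Proof.
rewrite /Pr; case: ifP => // _; rewrite -mulrA ler_piMr //.
rewrite ler_pdivrMr ?Zs_gt0 // mul1r; apply: Zs_le; exact: subsetDl.
Qed.

(* The marginal of [u] given that [w] is occupied, minus the one given that it
   is vacant. *)
Definition Inf (W : {set V}) (w u : V) : R :=
  if u == w then 1 else Pr (W :\: cl w) u - Pr (W :\ w) u.

(** Law of total probability: given that [w] is occupied or vacant, what remains is the model on
    [W :\: cl w] or on [W :\ w]. If [u] and [w] are adjacent the first term is 0; otherwise [Zs_rec]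
    at [w] inside [W :\: cl u] gives both terms. *)
Lemma Pr_total (W : {set V}) w u : w \in W -> u != w ->
  Pr W u = Pr W w * Pr (W :\: cl w) u + (1 - Pr W w) * Pr (W :\ w) u.
Proof.
move=> wW uw; case uW : (u \in W); last first.
  by rewrite !(@Pr_notin _ u) ?inE ?uW ?andbF // !mulr0 addr0.
have Z0 := Zs_neq0.
have -> : 1 - Pr W w = Zs (W :\ w) / Zs W by rewrite Zs_PrD1 mulrC mulKf.
have e2 : Zs (W :\ w) / Zs W * Pr (W :\ w) u
    = lam u * Zs (W :\: cl u :\ w) / Zs W.
  rewrite /Pr !inE uw uW /= setDDl [_ :|: cl u]setUC -setDDl.
  by field; rewrite !Z0.
have e1 : Pr W w * Pr (W :\: cl w) u = if e w u then 0 else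
    lam u * (lam w * Zs (W :\: cl u :\: cl w)) / Zs W.
  rewrite {2}/Pr !inE uW (negbTE uw) /= andbT; case: (e w u) => /=; first by rewrite mulr0.
  rewrite /Pr wW setDDl [_ :|: cl u]setUC -setDDl.
  by field; rewrite !Z0.
rewrite {}e1 {}e2 {1}/Pr uW.
have [euw|euw] := boolP (e w u).
  rewrite add0r; congr (_ * Zs _ / _); apply/setP => x; rewrite !inE.
  by have [->|] := eqVneq x w => //=; rewrite esym euw orbT.
have wUu : w \in W :\: cl u by rewrite !inE negb_or eq_sym uw esym euw wW.
by rewrite (Zs_rec wUu) -mulrDl; congr (_ / _); rewrite mulrDr addrC.
Qed.

(** This makes deletions telescope: removing [w] moves the marginal of [u] by the influence of [w]
    times the marginal of [w]. The convention [Inf W w w = 1] makes it hold for [u = w] as well. *)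
Lemma Pr_D1_diff (W : {set V}) w u : w \in W -> Pr W u - Pr (W :\ w) u = Pr W w * Inf W w u.
Proof.
move=> wW; rewrite /Inf; have [->|uw] := eqVneq u w.
  by rewrite (@Pr_notin (W :\ w)) ?setD11 // subr0 mulr1.
rewrite (Pr_total wW uw); ring.
Qed.

Definition infl (W : {set V}) (w : V) : R := \sum_u `|Inf W w u|.

(** Each entry is a marginal in what is left after the earlier deletions, so the product of the
    [1 - x] is, by the chain rule, the probability that all of [s] is vacant; see [Zs_peel]. *)
Fixpoint peel (W : {set V}) (s : seq V) : seq R :=
  if s is w :: s' then Pr W w :: peel (W :\ w) s' else [::].

Lemma size_peel W s : size (peel W s) = size s.
Proof. by elim: s W => //= w s IH W; rewrite IH. Qed.

Lemma peel_bounds W (s : seq V) (x : R) : x \in peel W s -> 0 <= x <= 1.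
Proof.
elim: s W => //= w s IH W; rewrite inE => /predU1P[->|/IH //].
by rewrite Pr_ge0 ltW ?Pr_lt1.
Qed.

Lemma peel_le W (s : seq V) (L x : R) : (forall v, lam v <= L) -> x \in peel W s -> x <= L.
Proof.
move=> HL; elim: s W => //= w s IH W; rewrite inE => /predU1P[->|/IH //].
exact: le_trans (Pr_le_lam _ _) _.
Qed.

Lemma Zs_peel W s : Zs (W :\: [set x in s]) = Zs W * \prod_(x <- peel W s) (1 - x).
Proof.
elim: s W => [|w s IH] W /=.
  by rewrite big_nil mulr1 set_nil setD0.
rewrite big_cons mulrA -Zs_PrD1 -IH setDDl; congr (Zs (_ :\: _)).
by apply/setP => x; rewrite !inE.
Qed.

(** Deleting [w] costs [Pr W w * infl W w], that is [Num.sqrt (Pr W w)] times the weighted influence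
    bounded by [c]. The predicate [Q] records for which pairs that bound is available, so the lemma
    serves both the induction and the final bound. *)
Lemma peel_telescope (W : {set V}) (s : seq V) c (Q : {set V} -> V -> Prop) :
  (forall (W' : {set V}) w, w \in W' -> Q W' w -> Num.sqrt (Pr W' w) * infl W' w <= c) ->
  uniq s -> {subset s <= W} ->
  (forall (W' : {set V}) w, W' \subset W -> w \in s -> Q W' w) ->
  \sum_u `|Pr W u - Pr (W :\: [set x in s]) u|
    <= c * \sum_(x <- peel W s) Num.sqrt x.
Proof.
move=> Hc; elim: s W => [|w s IH] W /=.
  move=> _ _ _; rewrite big_nil mulr0 big1 // => u _.
  by rewrite set_nil setD0 subrr normr0.
move=> /andP[ws us] sW HQ; rewrite big_cons mulrDr.
have wW : w \in W by apply: sW; rewrite inE eqxx.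
have -> : W :\: [set x in w :: s] = (W :\ w) :\: [set x in s].
  by rewrite setDDl; congr (_ :\: _); apply/setP => x; rewrite !inE.
have H2 : \sum_u `|Pr (W :\ w) u - Pr (W :\ w :\: [set x in s]) u|
    <= c * \sum_(x <- peel (W :\ w) s) Num.sqrt x.
  apply: IH => // [x xs|W' w' sW' ws'].
    rewrite !inE; apply/andP; split; last by apply: sW; rewrite inE xs orbT.
    by apply: contraNneq ws => <-.
  by apply: HQ; rewrite ?inE ?ws' ?orbT // (subset_trans sW') ?subsetDl.
apply: le_trans (lerD _ H2); last first.
  have := Hc _ _ wW (HQ _ _ (subxx _) (mem_head _ _)).
  move=> /(ler_wpM2r (sqrtr_ge0 (Pr W w))); apply: le_trans.
  by rewrite mulrAC -expr2 sqr_sqrtr ?Pr_ge0.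
rewrite /infl mulr_sumr -big_split /=; apply: ler_sum => u _.
rewrite -[X in X * _]ger0_norm ?Pr_ge0 // -normrM -Pr_D1_diff //.
apply: le_trans (ler_normD _ _); rewrite le_eqVlt; apply/orP; left; apply/eqP.
by congr `| _ |; rewrite addrA subrK.
Qed.

(** Occupying [v] differs from vacating it only by deleting its neighbours too, so the influence of
    [v] reduces to a deletion sequence in [U :\ v]. *)
Lemma infl_nbr (U : {set V}) (v : V) (s := enum (nbr v :&: U)) : v \in U ->
  infl U v = 1 + \sum_u `|Pr (U :\ v) u - Pr (U :\ v :\: [set x in s]) u|.
Proof.
move=> vU; rewrite /infl (bigD1 v) //= /Inf eqxx normr1 [in RHS](bigD1 v) //=.
rewrite !(@Pr_notin _ v) ?inE ?eqxx ?andbF // subrr normr0 add0r; congr (_ + _).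
apply: eq_bigr => u /negbTE ->; rewrite distrC; congr `|_ - Pr _ _|.
apply/setP => x; rewrite !inE mem_enum !inE.
by case: (x == v); case: (e v x); case: (x \in U).
Qed.

(** The recursion known from trees, valid on any graph because the neighbours are conditioned one
    after the other: [x] is the odds of [v] being occupied. *)
Lemma Pr_peel (U : {set V}) (v : V) (s := enum (nbr v :&: U))
    (x := lam v * \prod_(h <- peel (U :\ v) s) (1 - h)) : v \in U ->
  Pr U v = x / (1 + x).
Proof.
move=> vU; have e1 : U :\: cl v = U :\ v :\: [set y in s].
  apply/setP => y; rewrite !inE mem_enum !inE.
  by case: (y == v); case: (e v y); case: (y \in U).
have ZU : Zs U = Zs (U :\ v) * (1 + x).
  by rewrite (Zs_rec vU) e1 Zs_peel /x; ring.
have x0 : 1 + x != 0.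
  by have := Zs_neq0 U; rewrite ZU mulf_eq0 negb_or => /andP[].
rewrite /Pr vU ZU e1 Zs_peel; have Z0 := Zs_neq0 (U :\ v).
by rewrite mulrCA -/x -mulf_div divff // mul1r.
Qed.

Section Bound.
Variables (d : nat) (L rho : R).
Hypothesis lamL : forall v, lam v <= L.
Hypothesis rho01 : 0 <= rho < 1.
Hypothesis contr : forall (h : seq R) (l : R),
  (size h <= d)%N -> (forall x, x \in h -> 0 <= x <= 1) -> 0 <= l <= L ->
  let x := l * \prod_(y <- h) (1 - y) in
  Num.sqrt (x / (1 + x)) * \sum_(y <- h) Num.sqrt y <= rho.
Hypothesis degd : forall v, (#|nbr v| <= d.+1)%N.

Let kap := (1 - rho)^-1.

(* Every peeled vertex has at most [d] neighbours left, as its neighbour [v] is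
   already removed. *)
Lemma sqrt_Pr_infl (N : nat) (U : {set V}) (v : V) :
  (#|U| < N)%N -> v \in U -> (#|nbr v :&: U| <= d)%N ->
  Num.sqrt (Pr U v) * infl U v <= Num.sqrt L * kap.
Proof.
have r1 : 1 - rho != 0 by rewrite gt_eqF //; move: rho01; lra.
have kap0 : 0 <= kap by rewrite invr_ge0; move: rho01; lra.
(* [kap] is the fixed point of [c -> 1 + rho * c], which is what one level of the recursion does to
   the bound. *)
have kapE : 1 + rho * kap = kap by rewrite /kap; field.
elim: N U v => // N IH U v; rewrite ltnS => cU vU dv.
set s := enum (nbr v :&: U).
have ssub x : x \in s -> (x \in U :\ v) && e v x.
  rewrite mem_enum !inE => /andP[evx ->]; rewrite evx !andbT.
  by apply: contraTneq evx => ->; rewrite eirr.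
have tele := @peel_telescope (U :\ v) s (Num.sqrt L * kap)
  (fun W w => (#|W| < N)%N /\ (#|nbr w :&: W| <= d)%N).
rewrite infl_nbr // -/s.
have {}tele : \sum_u `|Pr (U :\ v) u - Pr (U :\ v :\: [set x in s]) u|
   <= Num.sqrt L * kap * \sum_(x <- peel (U :\ v) s) Num.sqrt x.
  apply: tele => [W' w wW' [c1 c2]| |x /ssub /andP[]//|W' w sW ws]; first exact: IH.
    exact: enum_uniq.
  split.
    apply: leq_trans cU; rewrite (cardsD1 v U) vU add1n ltnS; exact: subset_leq_card.
  have /andP[_ evw] := ssub _ ws.
  rewrite -ltnS; apply: leq_trans (degd w).
  have -> : #|nbr w| = #|v |: (nbr w :\ v)| by rewrite setD1K // inE esym.
  rewrite cardsU1 setD11 add1n ltnS; apply: subset_leq_card.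
  apply/subsetP => x; rewrite !inE => /andP[-> xW]; rewrite andbT.
  by have := subsetP sW _ xW; rewrite !inE => /andP[].
have P0 := sqrtr_ge0 (Pr U v).
apply: le_trans (ler_wpM2l P0 (lerD (lexx 1) tele)) _.
have szs : (size (peel (U :\ v) s) <= d)%N.
  by rewrite size_peel /s -cardE.
have := contr szs (@peel_bounds (U :\ v) s) (_ : 0 <= lam v <= L).
rewrite lam_ge0 lamL => /(_ isT) /=; rewrite -Pr_peel // => Hc.
have sL : Num.sqrt (Pr U v) <= Num.sqrt L.
  by rewrite ler_wsqrtr // (le_trans (Pr_le_lam _ _)).
(* The influence of [v] on itself contributes at most [Num.sqrt L], and the deletions contribute at
   most [rho] times the inductive bound. *)
rewrite mulrDr mulr1 mulrCA.
have := ler_wpM2l (mulr_ge0 (sqrtr_ge0 L) kap0) Hc => H1.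
apply: le_trans (lerD sL H1) _.
rewrite -[X in _ <= _ * X]kapE mulrDr mulr1; lra.
Qed.

(** The starting vertex can have [d.+1] neighbours, one more than the contraction admits, so this
    last level is estimated crudely. The bound is linear in [L]; this yields the form [1 + C * t]
    when the field is scaled by [t]. *)
Theorem infl_bound (U : {set V}) (v : V) : v \in U ->
  infl U v <= 1 + d.+1%:R * L * kap.
Proof.
move=> vU; set s := enum (nbr v :&: U).
have kap0 : 0 <= kap by rewrite invr_ge0; move: rho01; lra.
have L0 : 0 <= L by apply: le_trans (lamL v).
have ssub x : x \in s -> (x \in U :\ v) && e v x.
  rewrite mem_enum !inE => /andP[evx ->]; rewrite evx !andbT.
  by apply: contraTneq evx => ->; rewrite eirr.
rewrite infl_nbr // -/s lerD2l.
have tele := @peel_telescope (U :\ v) s (Num.sqrt L * kap)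
  (fun W w => (#|nbr w :&: W| <= d)%N).
apply: (le_trans (tele _ _ _ _)) => [W' w wW' c2| |x /ssub /andP[]//|W' w sW ws|].
- exact: (@sqrt_Pr_infl #|W'|.+1).
- exact: enum_uniq.
- have /andP[_ evw] := ssub _ ws.
  rewrite -ltnS; apply: leq_trans (degd w).
  have -> : #|nbr w| = #|v |: (nbr w :\ v)| by rewrite setD1K // inE esym.
  rewrite cardsU1 setD11 add1n ltnS; apply: subset_leq_card.
  apply/subsetP => x; rewrite !inE => /andP[-> xW]; rewrite andbT.
  by have := subsetP sW _ xW; rewrite !inE => /andP[].
- have : \sum_(x <- peel (U :\ v) s) Num.sqrt x <= d.+1%:R * Num.sqrt L.
    apply: (@le_trans _ _ (\sum_(x <- peel (U :\ v) s) Num.sqrt L)).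
      rewrite big_seq [leRHS]big_seq; apply: ler_sum => x xs.
      by rewrite ler_wsqrtr // (peel_le lamL xs).
    rewrite big_const_seq count_predT iter_addr_0 size_peel -[leLHS]mulr_natl.
    apply: ler_wpM2r; first exact: sqrtr_ge0.
    rewrite ler_nat /s -cardE; apply: leq_trans (degd v).
    by apply: subset_leq_card; apply: subsetIl.
  move=> /(ler_wpM2l (mulr_ge0 (sqrtr_ge0 L) kap0)) /le_trans; apply.
  rewrite (_ : _ * (_ * Num.sqrt L) = Num.sqrt L ^+ 2 * d.+1%:R * kap); last by ring.
  rewrite sqr_sqrtr //; lra.
Qed.
End Bound.
End Field.
End Graph.

(** * Contraction below the critical fugacity *)

Lemma sqr_sum_le (R : realFieldType) (I : eqType) (r : seq I) (F : I -> R) (d : nat) :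
  (size r <= d)%N -> (\sum_(i <- r) F i) ^+ 2 <= d%:R * \sum_(i <- r) F i ^+ 2.
Proof.
move=> szr; set s := \sum_(i <- r) F i; set S := \sum_(i <- r) F i ^+ 2.
case: d szr => [|d] szr.
  by move: szr; rewrite leqn0 size_eq0 => /eqP rE; rewrite /s /S rE !big_nil expr0n mul0r.
have D0 : 0 < d.+1%:R :> R by rewrite ltr0n.
have szD : (size r)%:R <= d.+1%:R :> R by rewrite ler_nat.
set D := d.+1%:R in D0 szD *; clearbody D.
have [t tE] : exists t, t = s / D by exists (s / D).
have : 0 <= \sum_(i <- r) (t - F i) ^+ 2 by apply: sumr_ge0 => i _; apply: sqr_ge0.
have -> : \sum_(i <- r) (t - F i) ^+ 2 = (size r)%:R * t ^+ 2 - 2 * t * s + S.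
  rewrite /s /S; clear; elim: r t => [|i r IH] t.
    by rewrite !big_nil /=; ring.
  by rewrite !big_cons IH /= -(natr1 (size r)); ring.
have : (size r)%:R * t ^+ 2 <= D * t ^+ 2.
  by rewrite ler_wpM2r ?sqr_ge0.
have -> : 2 * t * s = 2 * (D * t ^+ 2) by rewrite tE; field; rewrite gt_eqF.
move=> h1 h2; have h3 : D * t ^+ 2 <= S by lra.
have := ler_wpM2l (ltW D0) h3; suff -> : D * (D * t ^+ 2) = s ^+ 2 by [].
by rewrite tE; field; rewrite gt_eqF.
Qed.

Lemma AGM_pow (R : realFieldType) (d : nat) (a b : R) : 0 <= a -> 0 <= b ->
  a ^+ d * b <= ((d%:R * a + b) / d.+1%:R) ^+ d.+1.
Proof.
move=> a0 b0.
pose E (i : 'I_d.+1) := if i == ord_max then b else a.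
have nm (i : 'I_d) : E (widen_ord (leqnSn d) i) = a.
  by rewrite /E -val_eqE /= ltn_eqF.
have := @leif_AGM R _ (mem 'I_d.+1) E; rewrite card_ord !big_ord_recr /=.
rewrite (eq_bigr (fun=> a)) // [X in X + _](eq_bigr (fun=> a)) //.
rewrite prodr_const sumr_const card_ord -[a *+ d]mulr_natl /E eqxx.
by case=> // i _; case: ifP.
Qed.

Lemma bernoulli_pow (R : realFieldType) (m : nat) (y : R) : 0 <= y <= 1 ->
  1 - m%:R * y <= (1 - y) ^+ m.
Proof.
move=> /andP[y0 y1]; elim: m => [|m IH]; first by rewrite expr0; lra.
rewrite exprS; have h : 0 <= 1 - y by lra.
have := ler_wpM2l h IH; apply: le_trans.
have : 0 <= m%:R * y ^+ 2 by rewrite mulr_ge0 ?sqr_ge0.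
rewrite -(natr1 m); lra.
Qed.

(** Bernoulli's inequality for [(1 - y) ^+ m], multiplied by [(1 + y) ^+ m], bounds the latter from
    above without exponentials. *)
Lemma pow1D_le (R : realFieldType) (m : nat) (y : R) : 0 <= y <= 1 ->
  (1 + y) ^+ m * (1 - m%:R * y) <= 1.
Proof.
move=> y01; have := bernoulli_pow m y01; case/andP: y01 => y0 y1.
have h : 0 <= (1 + y) ^+ m by rewrite exprn_ge0 //; lra.
move=> /(ler_wpM2l h) /le_trans; apply; rewrite -exprMn.
rewrite exprn_ile1 //; first by rewrite mulr_ge0; lra.
have := sqr_ge0 y; lra.
Qed.

Section Contraction.
Variables (R : rcfType) (d : nat) (eta : R).
Hypothesis d2 : (2 <= d)%N.
Hypothesis eta01 : 0 < eta < 1.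
(* This is [lambda_c (d + 1)]. *)
Let lc : R := d%:R ^+ d / d.-1%:R ^+ d.+1.

(** With [x = l * (1 - z) ^+ d] this is [x / (1 + x) * d ^ 2 * z <= 1 - eta / 2] with the
    denominator cleared. The extremal [z] need not be computed: the arithmetic-geometric inequality
    for [d] copies of [(1 - z) / d] and one of [z - c] has a sum free of [z]. *)
Lemma lc_bound (l z : R) : 0 <= l <= (1 - eta) * lc -> 0 <= z <= 1 ->
  l * (1 - z) ^+ d * (d%:R ^+ 2 * z - (1 - eta / 2)) <= 1 - eta / 2.
Proof.
move=> /andP[l0 ll] /andP[z0 z1].
have [D DE] : exists D : R, d%:R = D by exists d%:R.
rewrite DE; set r := 1 - eta / 2.
have D2 : 2 <= D by rewrite -DE ler_nat.
have dSE : d.+1%:R = D + 1 :> R by rewrite -natr1 DE.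
have r0 : 0 < r by rewrite /r; move: eta01; lra.
have l1z : 0 <= l * (1 - z) ^+ d by rewrite mulr_ge0 // exprn_ge0 //; lra.
have [zr|rz] := lerP (D ^+ 2 * z) r.
  apply: le_trans (ltW r0); rewrite mulr_ge0_le0 //; lra.
(* [c] makes the last factor [D ^+ 2 * (z - c)]. For [r = 1] the mean [(1 - c) / (D + 1)] would be
   exactly the [(D - 1) / D ^+ 2] that cancels the critical fugacity; [y] is the relative excess
   caused by [r < 1]. The remaining [(1 - eta) * (1 + y) ^+ d.+1] is at most [r ^+ 2 / r]. *)
pose c := r / D ^+ 2; pose y := (eta / 2) / (D ^+ 2 - 1).
have D1 : (d.-1)%:R = D - 1 :> R.
  by rewrite -DE -[in RHS](prednK (ltnW d2)) -natr1 addrK.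
have h1 k : D ^+ k != 0 by rewrite expf_neq0 // gt_eqF //; lra.
have h2 : D - 1 != 0 by rewrite gt_eqF //; lra.
have h3 : D + 1 != 0 by rewrite gt_eqF //; lra.
have h4 : D != 0 by rewrite gt_eqF //; lra.
have h5 : D ^+ 2 - 1 != 0.
  by rewrite (_ : D ^+ 2 - 1 = (D - 1) * (D + 1)) ?mulf_neq0 //; ring.
have D21 : 0 < D ^+ 2 - 1 by nra.
have zc : 0 <= z - c.
  by rewrite subr_ge0 /c ler_pdivrMr; [rewrite mulrC ltW | rewrite exprn_gt0 //; lra].
have y01 : 0 <= y <= 1.
  rewrite /y; apply/andP; split.
    by apply: divr_ge0; [move: eta01; lra | exact: ltW].
  rewrite ler_pdivrMr // mul1r; have : 3 <= D ^+ 2 - 1 by nra.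
  move: eta01; lra.
have a0 : 0 <= (1 - z) / D by apply: divr_ge0; lra.
have := AGM_pow d a0 zc.
have -> : d%:R * ((1 - z) / D) + (z - c) = 1 - c.
  by rewrite DE; field.
have -> : (1 - c) / d.+1%:R = (D - 1) / D ^+ 2 * (1 + y).
  by rewrite dSE /y /c /r; field; rewrite h3 h4 h5.
move=> amgm.
have DD : 0 < D ^+ 2 by rewrite exprn_gt0; lra.
have -> : l * (1 - z) ^+ d * (D ^+ 2 * z - r)
    = l * (D ^+ d * D ^+ 2) * (((1 - z) / D) ^+ d * (z - c)).
  have -> : D ^+ 2 * z - r = D ^+ 2 * (z - c) by rewrite /c; field.
  by rewrite expr_div_n; field; rewrite h1.
have Dd0 : 0 <= D ^+ d * D ^+ 2 by rewrite mulr_ge0 ?exprn_ge0 //; lra.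
apply: le_trans (ler_wpM2l (mulr_ge0 l0 Dd0) amgm) _.
have P0 : 0 <= D ^+ d * D ^+ 2 * ((D - 1) / D ^+ 2 * (1 + y)) ^+ d.+1.
  rewrite mulr_ge0 // exprn_ge0 // mulr_ge0 ?divr_ge0 ?ltW //; move: y01; lra.
rewrite -mulrA; apply: le_trans (ler_wpM2r P0 ll) _.
have -> : (1 - eta) * lc * (D ^+ d * D ^+ 2 * ((D - 1) / D ^+ 2 * (1 + y)) ^+ d.+1)
   = (1 - eta) * (1 + y) ^+ d.+1.
  rewrite /lc D1 DE exprMn expr_div_n -exprM mulnC muln2 -addnn addnS addSn !exprS exprD.
  have h6 : (D - 1) ^+ d != 0 by rewrite expf_neq0.
  by field; rewrite h1 h2 h4 h6.
have := pow1D_le d.+1 y01.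
have dy : d.+1%:R * y <= eta / 2.
  have -> : d.+1%:R * y = (eta / 2) / (D - 1).
    by rewrite dSE /y; field; rewrite h2 h5.
  by rewrite ler_pdivrMr; [move: eta01; nra | lra].
have yp : 0 <= (1 + y) ^+ d.+1 by rewrite exprn_ge0 //; move: y01; lra.
move: yp dy; set p := (1 + y) ^+ d.+1; set q := _ * y => yp dy H.
have H2 : p * r <= 1.
  by apply: le_trans H; apply: ler_wpM2l => //; rewrite /r; lra.
have e2 : 1 - eta <= r ^+ 2 by rewrite /r; have := sqr_ge0 (eta / 2); lra.
apply: le_trans (ler_wpM2r yp e2) _.
by rewrite expr2 -mulrA [r * p]mulrC; rewrite ler_piMr // ltW.
Qed.

(** Both factors are extremal when all entries of [h] are equal: Cauchy-Schwarz bounds the sum of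
    square roots, and the arithmetic-geometric inequality bounds the product, by expressions in the
    mean [z] alone. As [x / (1 + x)] increases with [x], [lc_bound] then applies. *)
Lemma contraction (h : seq R) (l : R) :
  (size h <= d)%N -> (forall x, x \in h -> 0 <= x <= 1) ->
  0 <= l <= (1 - eta) * lc ->
  let x := l * \prod_(y <- h) (1 - y) in
  Num.sqrt (x / (1 + x)) * \sum_(y <- h) Num.sqrt y <= Num.sqrt (1 - eta / 2).
Proof.
move=> szh h01 lle /=; set x := l * _; have /andP[l0 _] := lle.
have D2 : 2 <= d%:R :> R by rewrite ler_nat.
have D0 : 0 < d%:R :> R by lra.
pose S := \sum_(y <- h) y; pose z := S / d%:R.
have S0 : 0 <= S by rewrite /S big_seq sumr_ge0 // => y /h01 /andP[].
have Sd : S <= d%:R.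
  rewrite /S big_seq; apply: (@le_trans _ _ (\sum_(y <- h | y \in h) 1)).
    by apply: ler_sum => y /h01 /andP[].
  by rewrite -big_seq big_const_seq count_predT iter_addr_0 ler_nat.
have z01 : 0 <= z <= 1 by rewrite divr_ge0 ?(ltW D0) //= ler_pdivrMr // mul1r.
have prod0 : 0 <= \prod_(y <- h) (1 - y).
  by rewrite big_seq prodr_ge0 // => y /h01 /andP[_ ?]; rewrite subr_ge0.
have x0 : 0 <= x by rewrite mulr_ge0.
have cauchy : (\sum_(y <- h) Num.sqrt y) ^+ 2 <= d%:R * S.
  have := sqr_sum_le Num.sqrt szh; congr (_ <= _ * _).
  by apply: eq_big_seq => y /h01 /andP[? _]; rewrite sqr_sqrtr.
have amgm : \prod_(y <- h) (1 - y) <= (1 - z) ^+ d.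
  have pad : {in h, forall y, 0 <= 1 - y} by move=> y /h01 /andP[_ ?]; rewrite subr_ge0.
  (* Padding with zeros to length exactly [d] changes neither the sum nor the product, since the new
     factors are [1 - 0]. *)
  have hE : h ++ nseq (d - size h) 0 = [seq nth 0 h i | i <- iota 0 d].
    apply: (@eq_from_nth _ 0); rewrite size_cat size_nseq ?size_map ?size_iota ?subnKC //.
    move=> i id; rewrite (nth_map 0%N) ?size_iota // nth_iota // add0n nth_cat.
    by case: ltnP => // ?; rewrite nth_nseq if_same nth_default.
  have := @leif_AGM R _ (mem 'I_d) (fun i => 1 - nth 0 h i) => /(_ _).
  have -> : (\prod_(i in 'I_d) (1 - nth 0 h i)) = \prod_(y <- h) (1 - y).
    transitivity (\prod_(y <- h ++ nseq (d - size h) 0) (1 - y)).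
      by rewrite hE big_map -[in RHS](subn0 d) big_mkord.
    rewrite big_cat /= [X in _ * X]big1_seq ?mulr1 // => y.
    by rewrite mem_nseq => /andP[_ /andP[_ /eqP->]]; rewrite subr0.
  have -> : (\sum_(i in 'I_d) (1 - nth 0 h i)) = d%:R - S.
    rewrite big_split /= sumr_const card_ord sumrN; congr (_ - _).
    transitivity (\sum_(y <- h ++ nseq (d - size h) 0) y).
      by rewrite hE big_map -[in RHS](subn0 d) big_mkord.
    rewrite big_cat /= [X in _ + X]big1_seq ?addr0 // => y.
    by rewrite mem_nseq => /andP[_ /andP[_ /eqP->]].
  rewrite card_ord => H; have [|+ _] := H.
    move=> i _; have [ih|hi] := ltnP i (size h); first by apply/pad/mem_nth.
    by rewrite nth_default // subr0.
  by rewrite mulrBl divff ?gt_eqF.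
rewrite -[X in _ * X]ger0_norm; last by rewrite sumr_ge0 // => y _; apply: sqrtr_ge0.
rewrite -sqrtr_sqr.
rewrite -sqrtrM; last by rewrite divr_ge0 //; lra.
apply: ler_wsqrtr.
have p1 : 0 < 1 + x by lra.
apply: (@le_trans _ _ (x / (1 + x) * (d%:R ^+ 2 * z))).
  rewrite ler_wpM2l ?divr_ge0 //; first lra.
  apply: le_trans cauchy _; rewrite /z le_eqVlt; apply/orP; left; apply/eqP.
  by field; rewrite gt_eqF.
rewrite mulrAC ler_pdivrMr //.
set r := 1 - eta / 2.
have r0 : 0 <= r by rewrite /r; move: eta01; lra.
suff : x * (d%:R ^+ 2 * z - r) <= r by lra.
have [zr|rz] := lerP (d%:R ^+ 2 * z) r.
  by apply: le_trans r0; rewrite mulr_ge0_le0 //; lra.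
apply: le_trans (lc_bound lle z01); rewrite -/r ler_wpM2r //; first lra.
by rewrite ler_wpM2l.
Qed.
End Contraction.

(** * Spectral independence *)

Lemma sum_memU1 (R : nmodType) (V : finType) (v : V) (F : {set V} -> R) :
  \sum_(S : {set V} | v \in S) F S = \sum_(S : {set V} | v \notin S) F (v |: S).
Proof.
rewrite (reindex_onto (fun S => v |: S) (fun S => S :\ v)) /=; last first.
  by move=> S /setD1K.
apply: eq_bigl => S; rewrite setU11 /=.
apply/idP/idP => [/eqP <-|vS]; first by rewrite setD11.
by rewrite setU1K.
Qed.

(** These are the probabilities of the random subset of [X] that keeps each element with probability
    [1 - t]. The distributed product runs over all of [V], with elements outside [X] absent for
    certain. *)
Lemma sum_subset_pow (R : comPzRingType) (V : finType) (X : {set V}) (t : R) :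
  \sum_(S : {set V} | S \subset X) (1 - t) ^+ #|S| * t ^+ #|X :\: S| = 1.
Proof.
have := @bigA_distr _ _ 1 *%R +%R V
  (fun i : V => if i \in X then 1 - t else 0 : R) (fun i => if i \in X then t else 1).
rewrite big1; last by move=> i _; case: ifP => _ /=; rewrite ?subrK ?add0r.
move=> E; rewrite [RHS]E big_mkcond /=; apply: eq_bigr => S _; case: ifPn => [sS|nS].
  rewrite (bigID (mem S)) /=; congr (_ * _).
    rewrite -prodr_const; apply: eq_bigr => i iS.
    by rewrite iS (subsetP sS _ iS).
  rewrite -prodr_const big_mkcond [RHS]big_mkcond /=; apply: eq_bigr => i _.
  by rewrite in_setD; case: (i \in S); case: (i \in X).
case/subsetPn: nS => i iS /negbTE iX.
by rewrite (bigD1 i) //= iS iX mul0r.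
Qed.

Section SpectralIndependence.
Variables (R : realFieldType) (Om I : finType) (a : Om -> R) (X : I -> pred Om).
Hypothesis a0 : forall w, 0 <= a w.
Variable f : Om -> R.
Let A := \sum_w a w.
Let Ai i := \sum_(w | X i w) a w.
Let Aij i j := \sum_(w | X i w && X j w) a w.
Let m := (\sum_w a w * f w) / A.
Let Bi i := \sum_(w | X i w) a w * f w.
Variable K : R.
Hypothesis K0 : 0 < K.
Hypothesis rowK : forall i, \sum_j `|Aij i j - Ai i * Ai j / A| <= K * Ai i.

(** Duality: let [Y] be the linear combination of the indicators of the [X i] with coefficients the
    deviations [b i] of the conditional means. Its covariance with [f] is the left side [Q], and the
    row bound makes its variance at most [K * Q]. Expanding the nonnegative mean of
    [(K * (f - m) - (Y - y)) ^+ 2] gives [Q <= K * Var f]. All sums are unnormalised. *)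
Lemma spectral_independence :
  \sum_i Ai i * (Bi i / Ai i - m) ^+ 2 <= K * \sum_w a w * (f w - m) ^+ 2.
Proof.
have [A0|A0] := eqVneq A 0.
  have az w : a w = 0 by apply/eqP; move/eqP: A0; rewrite psumr_eq0 // => /allP; apply; rewrite mem_index_enum.
  rewrite !big1 ?mulr0 // => [w _|i _]; first by rewrite az mul0r.
  by rewrite /Ai big1 ?mul0r // => w _; rewrite az.
have A_gt0 : 0 < A by rewrite lt0r A0 sumr_ge0.
have Ai0 i : 0 <= Ai i by apply: sumr_ge0.
pose c i := \sum_(w | X i w) a w * (f w - m).
pose b i := c i / Ai i.
(* For an event of weight 0 the division makes [b i] equal to 0, and [c i] vanishes as well, so the
   product form always holds. *)
have cE i : c i = b i * Ai i.
  rewrite /b; have [Az|Az] := eqVneq (Ai i) 0; last by rewrite divfK.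
  rewrite Az mulr0 /c big1 // => w Xw; suff -> : a w = 0 by rewrite mul0r.
  apply/eqP; move/eqP: Az; rewrite psumr_eq0 // => /allP /(_ w).
  by rewrite mem_index_enum Xw => /(_ isT).
pose Q := \sum_i b i * c i.
pose Y w := \sum_i b i * (X i w)%:R.
pose y := (\sum_w a w * Y w) / A.
have aY : \sum_w a w * Y w = \sum_i b i * Ai i.
  rewrite /Y; under eq_bigr do rewrite mulr_sumr.
  rewrite exchange_big /=; apply: eq_bigr => i _.
  rewrite /Ai mulr_sumr big_mkcond [RHS]big_mkcond /=.
  by apply: eq_bigr => w _; case: (X i w) => /=; rewrite ?mulr1 ?mulr0 // mulrC.
have lhsE : \sum_i Ai i * (Bi i / Ai i - m) ^+ 2 = Q.
  apply: eq_bigr => i _; rewrite cE; have [Az|Az] := eqVneq (Ai i) 0.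
    by rewrite Az mul0r !mulr0.
  rewrite (_ : Bi i / Ai i - m = b i); first by ring.
  rewrite /b; apply: (canRL (mulfK Az)); rewrite mulrBl divfK // /c /Bi /Ai mulr_sumr -sumrB.
  by apply: eq_bigr => w _; rewrite mulrBr [m * _]mulrC.
have cross : \sum_w a w * (f w - m) * (Y w - y) = Q.
  have z : \sum_w a w * (f w - m) = 0.
    under eq_bigr do rewrite mulrBr.
    by rewrite sumrB -mulr_suml -/A /m mulrC divfK // subrr.
  under eq_bigr do rewrite mulrBr.
  rewrite sumrB -mulr_suml z mul0r subr0 /Y /Q.
  under eq_bigr do rewrite mulr_sumr.
  rewrite exchange_big /=; apply: eq_bigr => i _.
  rewrite /c mulr_sumr big_mkcond [RHS]big_mkcond /=.
  by apply: eq_bigr => w _; case: (X i w) => /=; rewrite ?mulr1 ?mulr0 // mulrC.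
have varY : \sum_w a w * (Y w - y) ^+ 2 <= K * Q.
  have e1 : \sum_w a w * (Y w - y) ^+ 2
      = \sum_i \sum_j b i * b j * (Aij i j - Ai i * Ai j / A).
    have e2 : \sum_w a w * Y w ^+ 2 = \sum_i \sum_j b i * b j * Aij i j.
      have : forall w, a w * Y w ^+ 2
          = \sum_i \sum_j b i * b j * (a w * (X i w && X j w)%:R).
        move=> w; rewrite expr2 /Y mulr_suml mulr_sumr; apply: eq_bigr => i _.
        rewrite mulr_sumr mulr_sumr; apply: eq_bigr => j _.
        by case: (X i w); case: (X j w) => /=; ring.
      move=> h; under eq_bigr do rewrite h.
      rewrite exchange_big /=; apply: eq_bigr => i _.
      rewrite exchange_big /=; apply: eq_bigr => j _.
      rewrite -mulr_sumr /Aij; congr (_ * _); rewrite [RHS]big_mkcond /=.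
      by apply: eq_bigr => w _; case: ifP; rewrite ?mulr1 ?mulr0.
    transitivity (\sum_w a w * Y w ^+ 2 - (\sum_i b i * Ai i) ^+ 2 / A).
      have h w : a w * (Y w - y) ^+ 2 = a w * Y w ^+ 2 - 2 * y * (a w * Y w) + y ^+ 2 * a w.
        by ring.
      under eq_bigr do rewrite h.
      rewrite big_split sumrB /= -!mulr_sumr -/A aY /y aY; field.
      by rewrite A0.
    rewrite e2 expr2 mulr_suml mulr_suml -sumrB; apply: eq_bigr => i _.
    rewrite mulr_sumr mulr_suml -sumrB; apply: eq_bigr => j _; ring.
  rewrite e1.
  have symC i j : Aij i j - Ai i * Ai j / A = Aij j i - Ai j * Ai i / A.
    by rewrite [Ai i * _]mulrC /Aij; congr (_ - _); apply: eq_bigl => w; rewrite andbC.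
  (* Schur test: [2 * |b i * b j| <= b i ^ 2 + b j ^ 2], and by symmetry both halves are controlled
     by row sums. *)
  apply: (@le_trans _ _ (\sum_i \sum_j
     (b i ^+ 2 / 2 * `|Aij i j - Ai i * Ai j / A|
      + b j ^+ 2 / 2 * `|Aij i j - Ai i * Ai j / A|))).
    apply: ler_sum => i _; apply: ler_sum => j _.
    apply: (le_trans (ler_norm _)); rewrite normrM -mulrDl ler_wpM2r //.
    rewrite normrM; have := sqr_ge0 (`|b i| - `|b j|).
    rewrite sqrrB !real_normK ?num_real //; lra.
  under eq_bigr do rewrite big_split /=.
  rewrite big_split /= [X in _ + X]exchange_big /=.
  rewrite [X in _ + X](_ : _ = \sum_i \sum_j b i ^+ 2 / 2 * `|Aij i j - Ai i * Ai j / A|);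
    last by apply: eq_bigr => i _; apply: eq_bigr => j _; rewrite symC.
  rewrite -big_split /= /Q mulr_sumr; apply: ler_sum => i _.
  rewrite -mulr_sumr cE.
  have := ler_wpM2l (sqr_ge0 (b i)) (rowK i).
  set s := \sum_j _; lra.
rewrite lhsE.
have : 0 <= \sum_w a w * (K * (f w - m) - (Y w - y)) ^+ 2.
  by apply: sumr_ge0 => w _; rewrite mulr_ge0 ?sqr_ge0.
have -> : \sum_w a w * (K * (f w - m) - (Y w - y)) ^+ 2
   = K ^+ 2 * (\sum_w a w * (f w - m) ^+ 2)
     - 2 * K * (\sum_w a w * (f w - m) * (Y w - y)) + \sum_w a w * (Y w - y) ^+ 2.
  rewrite !mulr_sumr -sumrB -big_split /=; apply: eq_bigr => w _; ring.
rewrite cross; move: varY; set v1 := \sum_w _; set v2 := \sum_w _ => h1 h2.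
have : 0 <= K * (K * v2 - Q) by lra.
by rewrite pmulr_rge0 // subr_ge0.
Qed.
End SpectralIndependence.

(** * Models pinned at a set of occupied vertices *)

Section Pinned.
Variables (R : rcfType) (V : finType) (e : rel V).
Hypothesis esym : forall u v, e u v = e v u.
Hypothesis eirr : forall v, e v v = false.
Variable lam : V -> R.
Hypothesis lam_ge0 : forall v, 0 <= lam v.

Local Notation wt := (wt e lam).
Local Notation Zs := (Zs e lam).
Local Notation Pr := (Pr e lam).
Local Notation infl := (infl e lam).

(** The vertices whose state is still open once [S] is occupied. By [upE], conditioning on
    containing [S] leaves the ordinary model on [free S], so the influence bounds on vertex subsets
    cover all pinnings. *)
Definition free (S : {set V}) : {set V} := [set x | x \notin S & [disjoint S & nbr e x]].
Definition up (S : {set V}) : R := \sum_(X : {set V} | S \subset X) wt X.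

Lemma free0 : free set0 = setT.
Proof. by apply/setP => x; rewrite !inE /= disjoints_subset sub0set. Qed.

Lemma freeU1 u S : free (u |: S) = free S :\: cl e u.
Proof.
apply/setP => x; rewrite !inE !negb_or disjoints_subset subUset sub1set -disjoints_subset !inE (esym x u).
by case: (x == u); case: (x \in S); case: (e u x) => //=; rewrite ?andbF.
Qed.

Lemma stableU (S Y : {set V}) : [disjoint Y & S] ->
  stable e (S :|: Y) = [&& stable e S, stable e Y & Y \subset free S].
Proof.
move=> dYS; apply/idP/and3P => [st|[/stableP sS /stableP sY /subsetP sF]].
  split; [exact: stable_sub (subsetUl _ _) st|exact: stable_sub (subsetUr _ _) st|].
  apply/subsetP => y yY; rewrite !inE (disjointFr dYS yY) /=.
  apply/pred0P => x /=; apply/negP => /andP[xS]; rewrite inE; apply/negP.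
  by move/stableP: st; apply; rewrite inE ?xS ?yY ?orbT.
have cross x y : x \in S -> y \in Y -> ~~ e y x.
  move=> xS /sF; rewrite inE => /andP[_ d]; apply/negP => exy.
  by move: (disjointFr d xS); rewrite inE exy.
apply/stableP => x y; rewrite !inE => /orP[xS|xY] /orP[yS|yY].
- exact: sS.
- by rewrite esym; apply: cross.
- exact: cross.
- exact: sY.
Qed.

Lemma upE S : up S = wt S * Zs (free S).
Proof.
rewrite /up (reindex_onto (fun Y => S :|: Y) (fun X => X :\: S)) /=; last first.
  move=> X sX; apply/setP => x; rewrite !inE; case: (boolP (x \in S)) => //= xS.
  by rewrite (subsetP sX).
rewrite /(Zs _) mulr_sumr.
rewrite (eq_bigl (fun Y : {set V} => [disjoint Y & S])); last first.
  move=> Y; rewrite subsetUl /= setDUl setDv set0U.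
  by apply/eqP/idP => [<-|/setDidPl//]; rewrite disjoint_sym -setI_eq0 setIDA setDIl setDv set0I.
rewrite [RHS](eq_bigl (fun Y : {set V} => [disjoint Y & S] && (Y \subset free S))); last first.
  move=> Y; apply/idP/andP => [sY|[]//]; split => //.
  apply/pred0P => x /=; apply/negP => /andP[/(subsetP sY)]; rewrite inE.
  by case/andP => /negbTE ->.
rewrite [RHS]big_mkcondr; apply: eq_bigr => Y dYS.
rewrite !/(wt _) stableU //; case: (stable e S) => /=; last by rewrite mul0r if_same.
case: (stable e Y) => /=; last by rewrite mulr0 if_same.
case: ifP => // _; rewrite -bigU /=; last by rewrite disjoint_sym.
by apply: eq_bigl => x; rewrite !inE.
Qed.

Lemma upU1 u (S : {set V}) : u \notin S -> up (u |: S) = up S * Pr (free S) u.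
Proof.
move=> uS; rewrite !upE freeU1 wtU1 // /(Pr _ _) inE uS /=.
case: ifP => _; last by rewrite mul0r mulr0.
have := Zs_neq0 e lam_ge0 (free S); set z := Zs (free S); set z' := Zs _ => z0.
by field.
Qed.

Lemma up_ge0 S : 0 <= up S.
Proof. by apply: sumr_ge0 => X _; apply: wt_ge0. Qed.

Variable f : {set V} -> R.
Definition upf (S : {set V}) : R := \sum_(X : {set V} | S \subset X) wt X * f X.

(** In the model that contains [S], let [p] be the marginal of [u]. For [v] different from [u] the
    covariance of [u] and [v] is [p * (1 - p) * Inf W u v] with [W = free S], so the total influence
    is exactly the row bound that spectral independence asks for. *)
Lemma pinned_spectral (K : R) (S : {set V}) (m := upf S / up S) : 0 < K ->
  (forall (W : {set V}) w, w \in W -> infl W w <= K) ->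
  \sum_(v | v \notin S) up (v |: S) * (upf (v |: S) / up (v |: S) - m) ^+ 2
  <= K * \sum_(X : {set V} | S \subset X) wt X * (f X - m) ^+ 2.
Proof.
move=> K0 HK.
pose a (X : {set V}) := if S \subset X then wt X else 0.

have a0 X : 0 <= a X by rewrite /a; case: ifP => // _; apply: wt_ge0.
have aE (g : {set V} -> R) (Q : pred {set V}) :
    \sum_(X | Q X) a X * g X = \sum_(X : {set V} | (S \subset X) && Q X) wt X * g X.
  rewrite big_mkcond [RHS]big_mkcond; apply: eq_bigr => X _ /=; rewrite /a.
  by case: (S \subset X); case: (Q X); rewrite //= mul0r.
have aE1 (Q : pred {set V}) : \sum_(X | Q X) a X = \sum_(X : {set V} | (S \subset X) && Q X) wt X.
  by rewrite big_mkcond [RHS]big_mkcond; apply: eq_bigr => X _; rewrite /a; case: (S \subset X); case: (Q X).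
(* Vertices of [S] are given the empty event; they drop out of all sums while the index type stays
   [V]. *)
have := @spectral_independence R _ V a (fun v X => (v \notin S) && (v \in X)) a0 f K K0.
have eA : \sum_X a X = up S by rewrite aE1; apply: eq_bigl => X; rewrite andbT.
have eAi v : v \notin S -> \sum_(X : {set V} | (v \notin S) && (v \in X)) a X = up (v |: S).
  by move=> vS; rewrite aE1; apply: eq_bigl => X; rewrite vS subUset sub1set andbC.
have eAi0 v : v \in S -> \sum_(X : {set V} | (v \notin S) && (v \in X)) a X = 0.
  by move=> vS; rewrite big_pred0 // => X; rewrite vS.
have eB : \sum_X a X * f X = upf S by rewrite aE; apply: eq_bigl => X; rewrite andbT.
have eBi v : v \notin S ->
    \sum_(X : {set V} | (v \notin S) && (v \in X)) a X * f X = upf (v |: S).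
  by move=> vS; rewrite aE; apply: eq_bigl => X; rewrite vS subUset sub1set andbC.
have eV : \sum_X a X * (f X - m) ^+ 2
    = \sum_(X : {set V} | S \subset X) wt X * (f X - m) ^+ 2.
  by rewrite aE; apply: eq_bigl => X; rewrite andbT.
rewrite eA eB -/m eV.
set rhs := K * _ => H.
rewrite big_mkcond /=; apply: le_trans (H _).
  rewrite le_eqVlt; apply/orP; left; apply/eqP; apply: eq_bigr => v _.
  case/orP: (orbN (v \in S)) => vS; first by rewrite eAi0 // mul0r vS.
  by rewrite eAi // eBi // vS.
move=> u {H rhs}.
case/orP: (orbN (u \in S)) => uS.
  rewrite big1 ?eAi0 ?mulr0 // => v _; rewrite mul0r mul0r subr0.
  by rewrite big_pred0 ?normr0 // => X; rewrite uS.
rewrite eAi // upU1 //; set W := free S; set p := Pr W u.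
have p0 : 0 <= p by apply: Pr_ge0.
have [uW|uW] := boolP (u \in W); last first.
  have -> : p = 0 by rewrite /p Pr_notin.
  rewrite big1 ?mulr0 // => v _; rewrite !mul0r subr0.
  case/orP: (orbN (v \in S)) => vS.
    by rewrite big_pred0 ?normr0 // => X; rewrite vS andbF.
  apply/eqP; rewrite normr_eq0 eq_le; apply/andP; split; last exact: sumr_ge0.
  have U0 : up (u |: S) = 0 by rewrite upU1 // Pr_notin ?mulr0.
  rewrite -[leRHS]U0 -eAi // big_mkcond [leRHS]big_mkcond /=; apply: ler_sum => X _.
  by case: ((u \notin S) && _) => //=; case: ifP.
have p1 : p < 1 by apply: Pr_lt1.
apply: (@le_trans _ _ (\sum_v up S * p * `|Inf e lam W u v|)); last first.
  rewrite -mulr_sumr mulrC; apply: ler_wpM2r; last exact: HK.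
  by rewrite mulr_ge0 ?up_ge0.
have [S0|S0] := eqVneq (up S) 0.
  apply: ler_sum => v _; rewrite S0 !mul0r subr0.
  rewrite (_ : \sum_(X | _) a X = 0) ?normr0 //.
  apply/eqP; rewrite eq_le sumr_ge0 // andbT -[leRHS]S0 -eA.
  by rewrite big_mkcond; apply: ler_sum => X _; case: ifP.
apply: ler_sum => v _.
case/orP: (orbN (v \in S)) => vS.
  rewrite !big_pred0 ?mulr0 ?mul0r ?subrr ?normr0 ?mulr_ge0 ?up_ge0 // => X.
    by rewrite vS.
  by rewrite vS andbF.
rewrite eAi //; rewrite (upU1 vS).
have -> : \sum_(X : {set V} | (u \notin S) && (u \in X) && ((v \notin S) && (v \in X))) a X
    = up S * p * (if v == u then 1 else Pr (W :\: cl e u) v).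
  transitivity (up (v |: (u |: S))).
    rewrite aE1; apply: eq_bigl => X; rewrite !subUset !sub1set /=.
    by rewrite uS vS /= andbC -!andbA; case: (u \in X); case: (v \in X).
  have [->|vu] := eqVneq v u; first by rewrite setUA setUid upU1 // mulr1.
  by rewrite upU1 ?freeU1 ?upU1 // !inE negb_or vu.
rewrite (_ : up S * p * (up S * Pr W v) / up S = up S * p * Pr W v); last by field.
rewrite -mulrBr normrM ger0_norm ?mulr_ge0 ?up_ge0 //; apply: ler_wpM2l.
  by rewrite mulr_ge0 ?up_ge0.
rewrite /Inf; have [->|vu] := eqVneq v u.
  by rewrite -/p normr1 ger0_norm; lra.
rewrite (Pr_total esym eirr lam_ge0 uW vu) -/p.
rewrite (_ : _ - _ = (1 - p) * (Pr (W :\: cl e u) v - Pr (W :\ u) v)); last by ring.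
by rewrite normrM ler_piMl // ger0_norm; lra.
Qed.
End Pinned.

(** * Variance flow and the Poincare inequality *)

Lemma wt_scale (R : rcfType) (V : finType) (e : rel V) (lam : V -> R) (t : R) (X : {set V}) :
  wt e (fun v => t * lam v) X = wt e lam X * t ^+ #|X|.
Proof.
rewrite /wt; case: ifP => _; last by rewrite mul0r.
by rewrite big_split /= prodr_const mulrC.
Qed.

Section Flow.
Variables (R : rcfType) (V : finType) (e : rel V).
Hypothesis esym : forall u v, e u v = e v u.
Hypothesis eirr : forall v, e v v = false.
Variable lam : V -> R.
Hypothesis lam_ge0 : forall v, 0 <= lam v.
Variable f : {set V} -> R.
Local Notation wt := (wt e lam).

(* For [X] with weight [wt] and [S] obtained from [X] by keeping each vertex with
   probability [1 - t], the conditional mean of [f X] given [S] is [flowm S t], the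
   expected conditional variance is [flowg t], and [flowdg] is its derivative.  When
   [flowA S t = 0] both [flowm] and [flowq] are [0], which is harmless because then
   [flowB S t = 0] as well. *)
Definition flowA (S : {set V}) (t : R) : R :=
  \sum_(X : {set V} | S \subset X) wt X * t ^+ #|X :\: S|.
Definition flowB (S : {set V}) (t : R) : R :=
  \sum_(X : {set V} | S \subset X) wt X * f X * t ^+ #|X :\: S|.
Definition flowq (S : {set V}) (t : R) : R := flowB S t ^+ 2 / flowA S t.
Definition flowm (S : {set V}) (t : R) : R := flowB S t / flowA S t.
Definition flowg (t : R) : R :=
  \sum_X wt X * f X ^+ 2 - \sum_(S : {set V}) (1 - t) ^+ #|S| * flowq S t.
Definition flowdg (t : R) : R :=
  \sum_(S : {set V}) (1 - t) ^+ #|S| * \sum_(v | v \notin S)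
     (flowq (v |: S) t - 2 * flowm S t * flowB (v |: S) t
      + flowm S t ^+ 2 * flowA (v |: S) t).

Lemma flowA_ge0 S (t : R) : 0 <= t -> 0 <= flowA S t.
Proof. by move=> t0; apply: sumr_ge0 => X _; rewrite mulr_ge0 ?exprn_ge0 ?wt_ge0. Qed.

Lemma flowA_eq0 (S : {set V}) (t : R) : 0 < t -> flowA S t = 0 ->
  forall X : {set V}, S \subset X -> wt X = 0.
Proof.
move=> t0 /eqP; rewrite psumr_eq0; last first.
  by move=> X _; rewrite mulr_ge0 ?exprn_ge0 ?wt_ge0 ?ltW.
move=> /allP H X SX; have := H X; rewrite mem_index_enum SX => /(_ isT) /=.
by rewrite mulf_eq0 expf_eq0 (gt_eqF t0) andbF orbF => /eqP.
Qed.

Lemma flowB_eq0 (S : {set V}) (t u : R) : 0 < t -> flowA S t = 0 -> flowB S u = 0.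
Proof.
move=> t0 A0; rewrite /flowB big1 // => X SX.
by rewrite (flowA_eq0 t0 A0 SX) !mul0r.
Qed.

Lemma card_sub_split (S X : {set V}) : S \subset X -> #|X| = (#|S| + #|X :\: S|)%N.
Proof. by move=> SX; rewrite -(cardsID S X) (setIidPr SX). Qed.

(** Given the kept set [S], the law of [X] is the model with field [t * lam] conditioned to contain
    [S]; only the constant [t ^+ #|S|] has been divided out. This is how scaling the field enters
    the variance flow. *)
Lemma up_scale S t : up e (fun v => t * lam v) S = t ^+ #|S| * flowA S t.
Proof.
rewrite /up /flowA mulr_sumr; apply: eq_bigr => X SX.
by rewrite wt_scale (card_sub_split SX) exprD mulrCA.
Qed.

Lemma upf_scale S t : upf e (fun v => t * lam v) f S = t ^+ #|S| * flowB S t.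
Proof.
rewrite /upf /flowB mulr_sumr; apply: eq_bigr => X SX.
by rewrite wt_scale (card_sub_split SX) exprD; ring.
Qed.

Lemma flow_var (S : {set V}) (t : R) : 0 < t ->
  \sum_(X : {set V} | S \subset X) wt X * t ^+ #|X :\: S| * (f X - flowm S t) ^+ 2
  = \sum_(X : {set V} | S \subset X) wt X * t ^+ #|X :\: S| * f X ^+ 2 - flowq S t.
Proof.
move=> t0; pose m := flowm S t.
transitivity (\sum_(X : {set V} | S \subset X) wt X * t ^+ #|X :\: S| * f X ^+ 2
   - 2 * m * flowB S t + m ^+ 2 * flowA S t).
  rewrite !mulr_sumr -sumrB -big_split /=; apply: eq_bigr => X _; rewrite -/m; ring.
rewrite /m /flowm /flowq; have [A0|A0] := eqVneq (flowA S t) 0.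
  by rewrite (flowB_eq0 _ t0 A0); ring.
by field.
Qed.

Lemma flowg_var (t : R) : 0 < t ->
  flowg t = \sum_(S : {set V}) (1 - t) ^+ #|S| *
    \sum_(X : {set V} | S \subset X) wt X * t ^+ #|X :\: S| * (f X - flowm S t) ^+ 2.
Proof.
move=> t0; rewrite /flowg; under [RHS]eq_bigr do rewrite flow_var // mulrBr.
rewrite sumrB; congr (_ - _).
under [RHS]eq_bigr do rewrite mulr_sumr.
rewrite (exchange_big_dep xpredT) //=; apply: eq_bigr => X _.
rewrite -[LHS]mulr1 -[X in _ * X = _](sum_subset_pow X t) mulr_sumr; apply: eq_bigr => S _; ring.
Qed.

(** Summand by summand this is [pinned_spectral] for the field [t * lam]. Pinning a further vertex
    raises the power of [t] by one, which accounts for the factor [t] in front of the derivative. *)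
Lemma flow_ineq (t C : R) : 0 < t <= 1 -> 0 <= C ->
  (forall (W : {set V}) w, w \in W ->
     infl e (fun v => t * lam v) W w <= 1 + C * t) ->
  t * flowdg t <= (1 + C * t) * flowg t.
Proof.
move=> /andP[t0 t1] C0 HW; rewrite flowg_var // /flowdg !mulr_sumr.
apply: ler_sum => S _; rewrite mulrCA [leRHS]mulrCA; apply: ler_wpM2l.
  by rewrite exprn_ge0 // subr_ge0.
have l0 v : 0 <= t * lam v by rewrite mulr_ge0 // ltW.
have K0 : 0 < 1 + C * t by rewrite ltr_pwDl // mulr_ge0 // ltW.
have := pinned_spectral esym eirr l0 f S K0 HW.
have tS k : t ^+ k != 0 by rewrite expf_neq0 // gt_eqF.
have mE T : upf e (fun v => t * lam v) f T / up e (fun v => t * lam v) T = flowm T t.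
  by rewrite up_scale upf_scale -mulf_div divff // mul1r.
rewrite mE; under eq_bigr do rewrite mE up_scale.
set V1 := \sum_(v | _) _; set V2 := \sum_(X | _) _.
have -> : V2 = t ^+ #|S| *
   \sum_(X : {set V} | S \subset X) wt X * t ^+ #|X :\: S| * (f X - flowm S t) ^+ 2.
  rewrite mulr_sumr; apply: eq_bigr => X SX.
  by rewrite wt_scale (card_sub_split SX) exprD; ring.
have -> : V1 = t ^+ #|S| * (t * \sum_(v | v \notin S)
     (flowq (v |: S) t - 2 * flowm S t * flowB (v |: S) t
      + flowm S t ^+ 2 * flowA (v |: S) t)).
  rewrite !mulr_sumr; apply: eq_bigr => v vS.
  rewrite cardsU1 vS add1n exprS /flowq {1}/flowm.
  have [A0|A0] := eqVneq (flowA (v |: S) t) 0.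
    by rewrite (flowB_eq0 _ t0 A0) A0; ring.
  by field.
by rewrite [leRHS]mulrCA ler_pM2l // exprn_gt0.
Qed.

(** [dirich] sums over the pairs of configurations that a single update can exchange. [dirich_all]
    is a crude quantity that only controls the second-order term of [flowg] at 0. *)
Definition dirich : R :=
  \sum_(S : {set V}) \sum_(v | v \notin S) wt (v |: S) * (f (v |: S) - f S) ^+ 2.
Definition dirich_all : R :=
  \sum_(S : {set V}) \sum_(X : {set V} | S \subset X) wt X * (f X - f S) ^+ 2.

(** A variance only grows when the conditional mean of [f X] is replaced by [f S]. Then [X = S]
    contributes nothing, one lost vertex contributes the Dirichlet form times [t], and two or more
    lost vertices carry at least [t ^+ 2]. *)
Lemma flowg_le (t : R) : 0 < t <= 1 -> flowg t <= t * (dirich + t * dirich_all).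
Proof.
move=> /andP[t0 t1]; rewrite flowg_var // mulrDr mulrA.
rewrite /dirich /dirich_all !mulr_sumr -big_split /=; apply: ler_sum => S _.
apply: (@le_trans _ _
  (\sum_(X : {set V} | S \subset X) wt X * t ^+ #|X :\: S| * (f X - f S) ^+ 2)).
  have V0 : 0 <= \sum_(X : {set V} | S \subset X) wt X * t ^+ #|X :\: S| * (f X - flowm S t) ^+ 2.
    by apply: sumr_ge0 => X _; rewrite mulr_ge0 ?sqr_ge0 // mulr_ge0 ?wt_ge0 // exprn_ge0 // ltW.
  apply: (@le_trans _ _ (1 * \sum_(X : {set V} | S \subset X) wt X * t ^+ #|X :\: S| * (f X - flowm S t) ^+ 2)).
    by rewrite ler_wpM2r // exprn_ile1; lra.
  rewrite mul1r flow_var //.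
  have -> : \sum_(X : {set V} | S \subset X) wt X * t ^+ #|X :\: S| * (f X - f S) ^+ 2
    = \sum_(X : {set V} | S \subset X) wt X * t ^+ #|X :\: S| * f X ^+ 2
      - 2 * f S * flowB S t + f S ^+ 2 * flowA S t.
    rewrite !mulr_sumr -sumrB -big_split /=; apply: eq_bigr => X _; ring.
  rewrite -addrA lerD2l /flowq; have [A0|A0] := eqVneq (flowA S t) 0.
    by rewrite A0 (flowB_eq0 _ t0 A0); lra.
  have Ap : 0 < flowA S t by rewrite lt0r A0 flowA_ge0 ?ltW.
  rewrite -subr_ge0; have -> : - (2 * f S * flowB S t) + f S ^+ 2 * flowA S t
    - - (flowB S t ^+ 2 / flowA S t) = flowA S t * (flowB S t / flowA S t - f S) ^+ 2.
    by field.
  by rewrite mulr_ge0 ?sqr_ge0 ?ltW.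
rewrite [X in X + _]mulr_sumr [X in _ + X]mulr_sumr.
have -> : \sum_(v | v \notin S) t * (wt (v |: S) * (f (v |: S) - f S) ^+ 2)
  = \sum_(X : {set V}) \sum_(v | v \notin S) (X == v |: S)%:R * (t * (wt X * (f X - f S) ^+ 2)).
  rewrite exchange_big /=; apply: eq_bigr => v _.
  rewrite (bigD1 (v |: S)) //= eqxx mul1r big1 ?addr0 // => X /negbTE ->.
  by rewrite mul0r.
rewrite [X in _ <= _ + X]big_mkcond [leLHS]big_mkcond -big_split /=; apply: ler_sum => X _.
have F0 : 0 <= wt X * (f X - f S) ^+ 2 by rewrite mulr_ge0 ?wt_ge0 ?sqr_ge0.
have E0 : 0 <= \sum_(v | v \notin S) (X == v |: S)%:R * (t * (wt X * (f X - f S) ^+ 2)).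
  by apply: sumr_ge0 => v _; rewrite mulr_ge0 ?ler0n // mulr_ge0 // ltW.
case: ifPn => [SX|_]; last by rewrite addr0.
rewrite mulrAC; case kE : #|X :\: S| => [|[|k]].
- have -> : X = S.
    apply/eqP; rewrite eqEsubset SX andbT -setD_eq0 -cards_eq0; exact/eqP.
  by rewrite subrr expr0n /= !(mulr0, mul0r) addr0; apply: sumr_ge0 => v _; rewrite mulr0.
- move/eqP/cards1P: kE => [v vE].
  have vS : v \notin S by have := set11 v; rewrite -vE inE => /andP[].
  have XE : X = v |: S.
    apply/setP => x; have := congr1 (fun A : {set V} => x \in A) vE; rewrite !inE => <-.
    by case: (boolP (x \in S)) => [/(subsetP SX) ->|_] //=; rewrite orbF.
  rewrite expr1 mulrC -[leLHS]addr0; apply: lerD; last first.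
    by apply: mulr_ge0 => //; apply: (mulr_ge0 (ltW t0) (ltW t0)).
  rewrite (bigD1 v) //= -XE eqxx mul1r lerDl; apply: sumr_ge0 => u _.
  by rewrite mulr_ge0 ?ler0n // mulr_ge0 // ltW.
- rewrite -[leLHS]add0r lerD // mulrC ler_wpM2r // -expr2.
  by rewrite ler_wiXn2l //= ?ltW //; lra.
Qed.
End Flow.

(** * Derivatives of finite sums and powers *)

Section PointwiseDerivatives.
Import topology normedtype derive realfun numFieldNormedType.Exports.
Variable R : realType.
Implicit Types (f g : R -> R) (x a b : R).

Lemma is_derive_add f g x a b : is_derive x 1 f a -> is_derive x 1 g b ->
  is_derive x 1 (fun t => f t + g t) (a + b).
Proof. exact: is_deriveD. Qed.

Lemma is_derive_opp f x a : is_derive x 1 f a -> is_derive x 1 (fun t => - f t) (- a).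
Proof. exact: is_deriveN. Qed.

Lemma is_derive_mul f g x a b : is_derive x 1 f a -> is_derive x 1 g b ->
  is_derive x 1 (fun t => f t * g t) (f x * b + g x * a).
Proof. exact: is_deriveM. Qed.

Lemma is_derive_pow f x a n : is_derive x 1 f a ->
  is_derive x 1 (fun t => f t ^+ n) (n%:R * f x ^+ n.-1 * a).
Proof.
move=> df; elim: n => [|n IH].
  rewrite mul0r mul0r; exact: is_derive_cst.
have -> : (fun t => f t ^+ n.+1) = (fun t => f t * f t ^+ n).
  by apply: boolp.funext => t; rewrite exprS.
apply: is_derive_eq (is_derive_mul df IH) _.
by case: n {IH} => [|n] /=; rewrite ?exprS -?(natr1 n.+1); ring.
Qed.

Lemma is_derive_inv f x a : f x != 0 -> is_derive x 1 f a ->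
  is_derive x 1 (fun t => (f t)^-1) (- a / f x ^+ 2).
Proof.
move=> fx df; apply: is_derive_eq (is_deriveV fx df) _.
by rewrite /GRing.scale /= mulNr mulrC -mulNr.
Qed.

Lemma is_derive_bigsum (I : Type) (r : seq I) (P : pred I) (F : I -> R -> R)
    (dF : I -> R) x : (forall i, P i -> is_derive x 1 (F i) (dF i)) ->
  is_derive x 1 (fun t => \sum_(i <- r | P i) F i t) (\sum_(i <- r | P i) dF i).
Proof.
move=> H; elim: r => [|i r IH].
  have -> : (fun t => \sum_(i <- [::] | P i) F i t) = (fun=> 0).
    by apply: boolp.funext => t; rewrite big_nil.
  rewrite big_nil; exact: is_derive_cst.
have -> : (fun t => \sum_(j <- i :: r | P j) F j t)
   = (fun t => (if P i then F i t else 0) + \sum_(j <- r | P j) F j t).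
  by apply: boolp.funext => t; rewrite big_cons; case: ifP; rewrite ?add0r.
have -> : \sum_(j <- i :: r | P j) dF j
   = (if P i then dF i else 0) + \sum_(j <- r | P j) dF j.
  by rewrite big_cons; case: ifP; rewrite ?add0r.
apply: is_derive_add => //; case: ifP => [Pi|_]; first exact: H.
exact: is_derive_cst.
Qed.

Lemma derive_le0_nincr f (df : R -> R) (x y : R) : x <= y ->
  (forall t, x <= t <= y -> is_derive t 1 f (df t)) ->
  (forall t, x <= t <= y -> df t <= 0) -> f y <= f x.
Proof.
move=> xy Hd Hle.
apply: (@ler0_derive1_nincr R f x y) => //.
- by move=> t; rewrite in_itv /= => /andP[? ?]; have [] := Hd t; rewrite ?ltW.
- move=> t; rewrite in_itv /= => /andP[? ?].
  have dt : x <= t <= y by rewrite !ltW.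
  by rewrite derive1E (@derive_val _ _ _ _ _ _ _ (Hd t dt)) Hle.
- apply: derivable_within_continuous => t; rewrite in_itv /= => dt.
  by have [] := Hd t dt.
Qed.

End PointwiseDerivatives.

(** * The derivative of the variance flow *)

Section FlowDerivative.
Import topology normedtype derive realfun numFieldNormedType.Exports.
Variables (R : realType) (V : finType) (e : rel V).
Hypothesis esym : forall u v, e u v = e v u.
Hypothesis eirr : forall v, e v v = false.
Variable lam : V -> R.
Hypothesis lam_ge0 : forall v, 0 <= lam v.
Variable f : {set V} -> R.
Local Notation wt := (wt e lam).

(** The exponent [#|X :\: S|] brought down by differentiation counts the vertices of [X] that can be
    moved into [S], so differentiating at [S] means summing over the one-vertex extensions of
    [S]. *)
Lemma card_pow_sum (S : {set V}) (c : {set V} -> R) (t : R) :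
  \sum_(X : {set V} | S \subset X) c X * (#|X :\: S|%:R * t ^+ #|X :\: S|.-1)
  = \sum_(v | v \notin S) \sum_(X : {set V} | v |: S \subset X) c X * t ^+ #|X :\: (v |: S)|.
Proof.
rewrite (exchange_big_dep (fun X : {set V} => S \subset X)) /=; last first.
  by move=> v X _; rewrite subUset => /andP[].
apply: eq_bigr => X SX; rewrite (eq_bigl (mem (X :\: S))); last first.
  by move=> v /=; rewrite in_setD subUset sub1set SX andbT.
rewrite (eq_bigr (fun=> c X * t ^+ #|X :\: S|.-1)).
  by rewrite sumr_const -[RHS]mulr_natl; ring.
move=> v /= vX; congr (_ * _ ^+ _).
by rewrite [in RHS](cardsD1 v) vX /= setDDl setUC.
Qed.

Lemma flowA_derive (S : {set V}) (t : R) :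
  is_derive t 1 (flowA e lam S) (\sum_(v | v \notin S) flowA e lam (v |: S) t).
Proof.
rewrite -card_pow_sum; apply: is_derive_bigsum => X _.
apply: is_derive_eq (is_derive_mul (is_derive_cst _ _ _)
  (is_derive_pow #|X :\: S| (is_derive_id t 1))) _.
by rewrite /= mulr0 addr0 mulr1.
Qed.

Lemma flowB_derive (S : {set V}) (t : R) :
  is_derive t 1 (flowB e lam f S) (\sum_(v | v \notin S) flowB e lam f (v |: S) t).
Proof.
rewrite -(card_pow_sum S (fun X => wt X * f X)); apply: is_derive_bigsum => X _.
apply: is_derive_eq (is_derive_mul (is_derive_cst _ _ _)
  (is_derive_pow #|X :\: S| (is_derive_id t 1))) _.
by rewrite /= mulr0 addr0 mulr1.
Qed.

Lemma flowq_derive (S : {set V}) (t : R) : 0 < t ->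
  is_derive t 1 (flowq e lam f S) (\sum_(v | v \notin S)
     (2 * flowm e lam f S t * flowB e lam f (v |: S) t
      - flowm e lam f S t ^+ 2 * flowA e lam (v |: S) t)).
Proof.
(* If [flowA S] vanishes at one positive time, no configuration above [S] has weight, so [flowq S]
   is the zero function and not merely zero at [t]. *)
move=> t0; have [A0|A0] := eqVneq (flowA e lam S t) 0.
  have -> : flowq e lam f S = (fun=> 0).
    by apply: boolp.funext => u; rewrite /flowq (flowB_eq0 lam_ge0 f _ t0 A0) expr0n mul0r.
  rewrite /flowm (flowB_eq0 lam_ge0 f _ t0 A0) mul0r.
  rewrite big1; first exact: is_derive_cst.
  by move=> v _; ring.
apply: is_derive_eq (is_derive_mul (is_derive_pow 2 (flowB_derive S t))
  (is_derive_inv A0 (flowA_derive S t))) _.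
rewrite sumrB -!mulr_sumr /flowm /=; by field.
Qed.

Lemma flowg_derive (t : R) : 0 < t ->
  is_derive t 1 (flowg e lam f) (flowdg e lam f t).
Proof.
move=> t0; rewrite /flowg.
have dS (S : {set V}) : is_derive t 1 (fun t => (1 - t) ^+ #|S| * flowq e lam f S t)
  ((1 - t) ^+ #|S| * (\sum_(v | v \notin S)
     (2 * flowm e lam f S t * flowB e lam f (v |: S) t
      - flowm e lam f S t ^+ 2 * flowA e lam (v |: S) t))
   - flowq e lam f S t * (#|S|%:R * (1 - t) ^+ #|S|.-1)).
  have d1 : is_derive t 1 (fun t : R => 1 - t) (-1).
    apply: is_derive_eq (is_derive_add (is_derive_cst (1 : R) t (1 : R)) (@is_deriveNid R R t 1)) _.
    by rewrite add0r.
  apply: is_derive_eq (is_derive_mul (is_derive_pow #|S| d1) (flowq_derive S t0)) _.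
  by ring.
have := is_derive_add (is_derive_cst (\sum_X wt X * f X ^+ 2) t 1)
  (is_derive_opp (is_derive_bigsum (index_enum _) (fun S _ => dS S))).
move=> H; apply: is_derive_eq (H xpredT) _; rewrite add0r sumrB opprB /flowdg.
(* The factor [#|S|] is spread over the vertices of [S]; removing the chosen vertex turns pairs with
   [v] in [S] into pairs with [v] outside [S], as in [flowdg]. *)
have -> : \sum_(S : {set V}) flowq e lam f S t * (#|S|%:R * (1 - t) ^+ #|S|.-1)
  = \sum_(S : {set V}) \sum_(v | v \notin S) (1 - t) ^+ #|S| * flowq e lam f (v |: S) t.
  transitivity (\sum_(S : {set V}) \sum_(v in S) (1 - t) ^+ #|S|.-1 * flowq e lam f S t).
    by apply: eq_bigr => S _; rewrite sumr_const -[RHS]mulr_natl; ring.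
  rewrite (exchange_big_dep xpredT) //= [RHS](exchange_big_dep xpredT) //=.
  apply: eq_bigr => v _; rewrite sum_memU1; apply: eq_bigr => S vS.
  by rewrite cardsU1 vS.
rewrite -sumrB; apply: eq_bigr => S _.
rewrite -mulr_sumr -mulrBr -sumrB; congr (_ * _); apply: eq_bigr => v _; ring.
Qed.

Theorem poincare (C : R) (m := (\sum_X wt X * f X) / (\sum_X wt X)) : 0 <= C ->
  (forall (t : R) (W : {set V}) w, 0 < t <= 1 -> w \in W ->
     infl e (fun v => t * lam v) W w <= 1 + C * t) ->
  \sum_X wt X * (f X - m) ^+ 2 <= expR C * dirich e lam f.
Proof.
move=> C0 HW.
(* At time 1 nothing is kept: only the empty set survives in the sum, and the conditional variance
   is the full variance. *)
have g1 : flowg e lam f 1 = \sum_X wt X * (f X - m) ^+ 2.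
  rewrite flowg_var // (bigD1 finset.set0) //= cards0 expr0 mul1r [X in _ + X]big1 ?addr0.
    apply: eq_big => X; first by rewrite finset.sub0set.
    move=> _; rewrite expr1n mulr1; congr (_ * (_ - _) ^+ 2).
    rewrite /flowm /flowA /flowB /m; congr (_ / _).
      by apply: eq_big => Y; rewrite ?finset.sub0set // expr1n mulr1.
    by apply: eq_big => Y; rewrite ?finset.sub0set // expr1n mulr1.
  by move=> S; rewrite -cards_eq0 => S0; rewrite subrr expr0n (negbTE S0) mul0r.
rewrite -g1.
(* The integrating factor for [t * g' <= (1 + C * t) * g]: the sign of [dphi] is the sign of the
   difference of the two sides. *)
pose phi t := flowg e lam f t * t^-1 * expR (- (C * t)).
pose dphi t := expR (- (C * t)) / t ^+ 2 * (t * flowdg e lam f t - (1 + C * t) * flowg e lam f t).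
have key (t : R) : 0 < t <= 1 -> phi 1 <= phi t.
  move=> /andP[t0 t1]; apply: (@derive_le0_nincr _ phi dphi) => // u /andP[tu u1].
    have u0 : 0 < u by apply: lt_le_trans tu.
    have un0 : u != 0 by rewrite gt_eqF.
    have dC : is_derive u 1 (fun t : R => - (C * t)) (- C).
      apply: is_derive_eq (is_derive_opp (is_derive_mul (is_derive_cst C u 1) (is_derive_id u 1))) _.
      by rewrite mulr1 mulr0 addr0.
    have dE : is_derive u 1 (fun t : R => expR (- (C * t))) (expR (- (C * u)) * - C).
      exact: (@is_derive1_comp _ expR (fun t : R => - (C * t))).
    apply: is_derive_eq (is_derive_mul (is_derive_mul (flowg_derive u0)
      (is_derive_inv un0 (is_derive_id u 1))) dE) _.
    by rewrite /dphi; field.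
  have u0 : 0 < u by apply: lt_le_trans tu.
  rewrite /dphi; apply: mulr_ge0_le0; first by rewrite divr_ge0 ?expR_ge0 ?exprn_ge0 ?ltW.
  rewrite subr_le0; apply: flow_ineq => //; first by rewrite u0.
  by move=> W w wW; apply: HW => //; rewrite u0.
have Ed0 : 0 <= dirich_all e lam f.
  by apply: sumr_ge0 => S _; apply: sumr_ge0 => X _; rewrite mulr_ge0 ?wt_ge0 ?sqr_ge0.
have Ed1 : 0 <= dirich e lam f.
  by apply: sumr_ge0 => S _; apply: sumr_ge0 => X _; rewrite mulr_ge0 ?wt_ge0 ?sqr_ge0.
have key2 (t : R) : 0 < t <= 1 ->
    flowg e lam f 1 <= expR C * (dirich e lam f + t * dirich_all e lam f).
  move=> t01; have /andP[t0 t1] := t01.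
  have := key t t01; rewrite /phi invr1 !mulr1 => k1.
  have k2 : flowg e lam f t * t^-1 * expR (- (C * t))
      <= dirich e lam f + t * dirich_all e lam f.
    have D0 : 0 <= dirich e lam f + t * dirich_all e lam f.
      by rewrite addr_ge0 // mulr_ge0 // ltW.
    apply: (@le_trans _ _ ((dirich e lam f + t * dirich_all e lam f) * expR (- (C * t)))).
      rewrite ler_wpM2r ?expR_ge0 // ler_pdivrMr // mulrC; exact: flowg_le.
    by rewrite ler_piMr // -[leRHS]expR0 ler_expR oppr_le0; apply: mulr_ge0 (ltW t0).
  have := le_trans k1 k2; move=> /(ler_wpM2l (expR_ge0 C)); apply: le_trans.
  by rewrite expRN mulrCA divff ?mulr1 // gt_eqF ?expR_gt0.
set D := dirich e lam f in key2 *; set Da := dirich_all e lam f in key2 Ed0.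
(* In place of a limit at 0, a strict violation of the bound is refuted at an explicit time [t]: the
   excess divided by something larger than both the excess and the coefficient of [t]. *)
rewrite leNgt; apply/negP => lt1.
set g := flowg e lam f 1 in key2 lt1.
have eC := expR_gt0 C.
pose den := 1 + expR C * Da + (g - expR C * D).
have EDa : 0 <= expR C * Da by rewrite mulr_ge0 // ltW.
have den0 : 0 < den by rewrite /den; lra.
pose t := (g - expR C * D) / den.
have t01 : 0 < t <= 1.
  by rewrite /t divr_gt0 ?subr_gt0 //= ler_pdivrMr // /den; lra.
have := key2 t t01; rewrite leNgt => /negP; apply.
have tden : t * den = g - expR C * D by rewrite /t divfK // gt_eqF.
have /andP[t0 t1] := t01.
rewrite mulrDr -ltrBrDl -tden [expR C * (_ * _)]mulrCA ltr_pM2l // /den; lra.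
Qed.
End FlowDerivative.

(** * Glauber dynamics *)

Section Glauber.
Variables (R : rcfType) (V : finType) (e : rel V).
Hypothesis esym : forall u v, e u v = e v u.
Hypothesis eirr : forall v, e v v = false.
Variable lam : V -> R.
Hypothesis lam_ge0 : forall v, 0 <= lam v.
Local Notation wt := (wt e lam).
Implicit Types (f g : {set V} -> R) (X : {set V}).

Definition Ew f : R := \sum_X wt X * f X.

Definition occupy (v : V) X : {set V} := if [disjoint X & nbr e v] then v |: X else X :\ v.
Definition heat (v : V) f X : R :=
  lam v / (1 + lam v) * f (occupy v X) + (1 + lam v)^-1 * f (X :\ v).

(** The update forgets the state of [v], so [heat v f] is constant on the pair: it is the
    conditional expectation given the other vertices, hence a projection. *)
Lemma heat_pair v f X : v \notin X -> [disjoint X & nbr e v] ->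
  let h := lam v / (1 + lam v) * f (v |: X) + (1 + lam v)^-1 * f X in
  heat v f X = h /\ heat v f (v |: X) = h.
Proof.
move=> vX dX /=; rewrite /heat /occupy dX.
have -> : X :\ v = X by apply/setDidPl; rewrite disjoint_sym disjoints1.
have -> : [disjoint v |: X & nbr e v].
  rewrite disjoints_subset subUset sub1set -disjoints_subset dX andbT.
  by rewrite !inE eirr.
by rewrite setUA setUid setU1K.
Qed.

Lemma lam1_neq0 v : 1 + lam v != 0.
Proof. by rewrite gt_eqF // ltr_pwDl. Qed.

(** The total weight splits into pairs [X], [v |: X] whose weights are in ratio [lam v], or into [X]
    alone when a neighbour of [v] is occupied. Identities for one update therefore need checking on
    one pair only. *)
Lemma Ew_split v (F : {set V} -> R) (G : {set V} -> R) :
  (forall X, v \notin X -> [disjoint X & nbr e v] ->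
     F X + lam v * F (v |: X) = G X + lam v * G (v |: X)) ->
  (forall X, v \notin X -> ~~ [disjoint X & nbr e v] -> F X = G X) ->
  Ew F = Ew G.
Proof.
move=> H1 H2; rewrite /Ew !(sum_split_mem v); apply: eq_bigr => X vX.
rewrite !wtU1 //; case: ifPn => dX; last by rewrite !mul0r !addr0 H2.
by rewrite ![lam v * wt X]mulrC -!mulrA -!mulrDr H1.
Qed.

Lemma heat_out v f X : v \notin X -> ~~ [disjoint X & nbr e v] -> heat v f X = f X.
Proof.
move=> vX dX; rewrite /heat /occupy (negbTE dX).
have -> : X :\ v = X by apply/setDidPl; rewrite disjoint_sym disjoints1.
by field; apply: lam1_neq0.
Qed.

Lemma Ew_heat v f : Ew (heat v f) = Ew f.
Proof.
apply: (@Ew_split v) => X vX dX; last exact: heat_out.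
have [-> ->] := heat_pair f vX dX; field; exact: lam1_neq0.
Qed.

Lemma Ew_heat_proj v f : Ew (fun X => heat v f X ^+ 2) = Ew (fun X => f X * heat v f X).
Proof.
apply: (@Ew_split v) => X vX dX; last by rewrite heat_out.
have [-> ->] := heat_pair f vX dX; field; exact: lam1_neq0.
Qed.

(** Since the update is a projection, the right side is the mean conditional variance of [f] at [v].
    On each pair it equals the Dirichlet term divided by [1 + lam v]. *)
Lemma heat_dirich v f (L : R) : (forall v, lam v <= L) ->
  (1 + L)^-1 * (\sum_(X : {set V} | v \notin X) wt (v |: X) * (f (v |: X) - f X) ^+ 2)
  <= Ew (fun X => f X ^+ 2) - Ew (fun X => f X * heat v f X).
Proof.
move=> HL; rewrite /Ew !(sum_split_mem v) -sumrB mulr_sumr; apply: ler_sum => X vX.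
rewrite !wtU1 //; case: ifPn => dX; last by rewrite heat_out // !mul0r mulr0 !addr0 expr2 subrr.
have [-> ->] := heat_pair f vX dX.
rewrite [leRHS](_ : _ = (1 + lam v)^-1 * (lam v * wt X * (f (v |: X) - f X) ^+ 2)); last first.
  by field; apply: lam1_neq0.
apply: ler_wpM2r; first by rewrite mulr_ge0 ?sqr_ge0 // mulr_ge0 ?wt_ge0.
by rewrite lef_pV2 ?posrE ?lerD2l // ltr_pwDl // (le_trans (lam_ge0 v)).
Qed.

Variable M : nat.
Hypothesis VM : (#|V| <= M)%N.
Hypothesis M0 : (0 < M)%N.

(* One of [M] slots is drawn uniformly; the slots beyond the vertices are idle. *)
Definition gop f X : R :=
  M%:R^-1 * (\sum_v heat v f X + (M - #|V|)%:R * f X).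

Lemma gop_lin f c X : gop (fun Y => f Y - c) X = gop f X - c.
Proof.
rewrite /gop; have Mn0 : M%:R != 0 :> R by rewrite pnatr_eq0 -lt0n.
have -> : \sum_v heat v (fun Y => f Y - c) X = \sum_v heat v f X - #|V|%:R * c.
  rewrite mulr_natl -sumr_const -sumrB; apply: eq_bigr => v _.
  by rewrite /heat; field; apply: lam1_neq0.
by rewrite natrB //; field.
Qed.

Lemma eq_gop f g : f =1 g -> gop f =1 gop g.
Proof.
move=> fg X; rewrite /gop fg; congr (_ * (_ + _)); apply: eq_bigr => v _.
by rewrite /heat !fg.
Qed.

Lemma Ew_gop f : Ew (gop f) = Ew f.
Proof.
have Mn0 : M%:R != 0 :> R by rewrite pnatr_eq0 -lt0n.
have -> : Ew (gop f) = M%:R^-1 * (\sum_v Ew (heat v f) + (M - #|V|)%:R * Ew f).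
  rewrite /Ew exchange_big /= [in RHS]mulr_sumr -big_split mulr_sumr /=; apply: eq_bigr => X _.
  by rewrite /gop -mulr_sumr; ring.
under eq_bigr do rewrite Ew_heat.
by rewrite sumr_const -[_ *+ _]mulr_natl natrB //; field.
Qed.

(** By convexity the square of the average over slots is at most the average of the squares; each
    update loses its conditional variance, and the losses add up to a multiple of the Dirichlet
    form, which the Poincare hypothesis compares with the second moment. *)
Lemma gop_contract f (L C : R) : (forall v, lam v <= L) -> 0 < C -> 0 <= L ->
  Ew (fun X => f X ^+ 2) <= C * dirich e lam f ->
  Ew (fun X => gop f X ^+ 2)
   <= (1 - (C * (1 + L) * M%:R)^-1) * Ew (fun X => f X ^+ 2).
Proof.
move=> HL C0 L0 Hp; have Mp : 0 < M%:R :> R by rewrite ltr0n.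
have Mn0 : M%:R != 0 :> R by rewrite gt_eqF.
set E2 := Ew (fun X => f X ^+ 2) in Hp *.
have step1 : Ew (fun X => gop f X ^+ 2) <=
   M%:R^-1 * (\sum_v Ew (fun X => heat v f X ^+ 2) + (M - #|V|)%:R * E2).
  rewrite [leRHS](_ : _ = Ew (fun X => M%:R^-1 * (\sum_v heat v f X ^+ 2 + (M - #|V|)%:R * f X ^+ 2))); last first.
    rewrite /E2 /Ew exchange_big /= [in LHS]mulr_sumr -big_split mulr_sumr /=; apply: eq_bigr => X _.
    by rewrite -mulr_sumr; ring.
  apply: ler_sum => X _; apply: ler_wpM2l; first exact: wt_ge0.
  pose s := [seq heat v f X | v <- index_enum V] ++ nseq (M - #|V|) (f X).
  have sz : size s = M by rewrite size_cat size_map size_nseq -[index_enum V]enumT -cardE subnKC.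
  have := @sqr_sum_le R _ s id M; rewrite sz => /(_ (leqnn _)).
  rewrite !big_cat /= !big_map !big_nseq !iter_addr_0 => Hs.
  rewrite -(mulr_natl (f X)) -(mulr_natl (f X ^+ 2)) in Hs.
  have := ler_wpM2l (sqr_ge0 (M%:R^-1 : R)) Hs; rewrite -exprMn => /le_trans; apply.
  rewrite le_eqVlt; apply/orP; left; apply/eqP.
  by move: (_ + _) => z; field.
apply: le_trans step1 _; under eq_bigr do rewrite Ew_heat_proj.
have step2 : (1 + L)^-1 * dirich e lam f <= #|V|%:R * E2 - \sum_v Ew (fun X => f X * heat v f X).
  rewrite mulr_natl -sumr_const -sumrB /dirich.
  rewrite (exchange_big_dep xpredT) //= mulr_sumr; apply: ler_sum => v _.
  exact: heat_dirich.
have L1 : 0 < 1 + L by lra.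
rewrite natrB //.
have step3 : (C * (1 + L))^-1 * E2 <= (1 + L)^-1 * dirich e lam f.
  rewrite invfM mulrAC mulrC ler_wpM2l ?invr_ge0 ?(ltW L1) //.
  by rewrite mulrC ler_pdivrMr // mulrC.
have := le_trans step3 step2; set S := \sum_v _; set z := (C * (1 + L))^-1 => H.
have -> : (1 - (C * (1 + L) * M%:R)^-1) * E2 = M%:R^-1 * (M%:R * E2 - z * E2).
  by rewrite invfM -/z; field.
rewrite ler_wpM2l ?invr_ge0 ?(ltW Mp) //; lra.
Qed.

Lemma iter_gop_lin f c t X :
  iter t gop (fun Y => f Y - c) X = iter t gop f X - c.
Proof.
elim: t X => //= t IH X; rewrite -gop_lin; exact: eq_gop.
Qed.

Lemma Ew_iter_gop f t : Ew (iter t gop f) = Ew f.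
Proof. by elim: t => //= t IH; rewrite Ew_gop. Qed.

Variables (L C : R).
Hypothesis lamL : forall v, lam v <= L.
Hypothesis C0 : 0 < C.
Hypothesis L0 : 0 <= L.
Hypothesis gap1 : 1 <= C * (1 + L) * M%:R.
Hypothesis poinc : forall f, Ew f = 0 -> Ew (fun X => f X ^+ 2) <= C * dirich e lam f.

Let gam := 1 - (C * (1 + L) * M%:R)^-1.

Lemma iter_gop_L2 f t : Ew f = 0 ->
  Ew (fun X => iter t gop f X ^+ 2) <= gam ^+ t * Ew (fun X => f X ^+ 2).
Proof.
move=> f0; elim: t => [|t IH]; first by rewrite expr0 mul1r.
have g0 : 0 <= gam by rewrite subr_ge0 invf_le1 // (lt_le_trans ltr01).
rewrite exprS -mulrA; apply: le_trans (ler_wpM2l g0 IH).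
by apply: gop_contract => //; apply: poinc; rewrite Ew_iter_gop.
Qed.

(** The empty configuration has weight 1, so a squared value there is at most the whole second
    moment: contraction in mean square becomes a pointwise bound. The variance of the indicator of
    [X0] is at most [wt X0], which makes the error relative. If [wt X0 = 0] the same estimate gives
    error exactly 0. *)
Lemma gop_mixing t (X0 : {set V}) (a : R) : 0 <= a ->
  gam ^+ t * Zs e lam setT ^+ 2 <= a ^+ 2 * wt X0 \/ wt X0 = 0 ->
  `|iter t gop (fun X => (X == X0)%:R) set0 - wt X0 / Zs e lam setT|
    <= a * (wt X0 / Zs e lam setT).
Proof.
move=> a0 Ht; set Z := Zs e lam setT in Ht *.
have Z0 : 0 < Z by apply: Zs_gt0.
have ZE : Z = \sum_X wt X by apply: eq_bigl => X; rewrite subsetT.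
pose f X : R := (X == X0)%:R; pose m := wt X0 / Z.
have Ef : Ew f = wt X0.
  rewrite /Ew (bigD1 X0) //= /f eqxx mulr1 big1 ?addr0 // => X /negbTE ->.
  by rewrite mulr0.
have Ef2 : Ew (fun X => f X ^+ 2) = wt X0.
  by rewrite -Ef; apply: eq_bigr => X _; rewrite /f; case: eqP; rewrite ?expr1n ?expr0n.
have E0 : Ew (fun X => f X - m) = 0.
  rewrite /Ew; under eq_bigr do rewrite mulrBr.
  by rewrite sumrB -mulr_suml -ZE /m mulrC divfK ?gt_eqF // -Ef subrr.
have V0 : Ew (fun X => (f X - m) ^+ 2) <= wt X0.
  have -> : Ew (fun X => (f X - m) ^+ 2) = wt X0 - 2 * m * wt X0 + m ^+ 2 * Z.
    rewrite -{1}Ef2 -Ef ZE /Ew !mulr_sumr -sumrB -big_split /=.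
    by apply: eq_bigr => X _; ring.
  have -> : m ^+ 2 * Z = m * wt X0 by rewrite /m; field; rewrite gt_eqF.
  have : 0 <= m * wt X0 by rewrite mulr_ge0 ?divr_ge0 ?wt_ge0 ?ltW.
  lra.
have := iter_gop_L2 t E0.
have g0 : 0 <= gam by rewrite subr_ge0 invf_le1 // (lt_le_trans ltr01).
move=> /le_trans /(_ (ler_wpM2l (exprn_ge0 t g0) V0)) H.
have : (iter t gop f set0 - m) ^+ 2 <= gam ^+ t * wt X0.
  apply: le_trans H; rewrite /Ew (bigD1 set0) //= wt0 mul1r iter_gop_lin lerDl.
  by apply: sumr_ge0 => X _; rewrite mulr_ge0 ?wt_ge0 ?sqr_ge0.
move=> H2; have m0 : 0 <= a * m by rewrite mulr_ge0 // divr_ge0 ?wt_ge0 // ltW.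
rewrite -(ger0_norm m0) -ler_sqr ?nnegrE ?normr_ge0 // !real_normK ?num_real //.
apply: le_trans H2 _.
case: Ht => [Ht|w0]; last by rewrite w0 mulr0 sqr_ge0.
have -> : (a * m) ^+ 2 = a ^+ 2 * wt X0 / Z ^+ 2 * wt X0.
  by rewrite /m; field; rewrite gt_eqF.
by rewrite ler_wpM2r ?wt_ge0 // ler_pdivlMr // exprn_gt0.
Qed.

End Glauber.

(** * Averages over coin sequences *)

Section Average.
Variable R : realFieldType.
Implicit Types (G : seq bool -> R).

Fixpoint avg (k : nat) G : R :=
  if k is k'.+1 then (avg k' (fun s => G (true :: s)) + avg k' (fun s => G (false :: s))) / 2
  else G [::].

Lemma eq_avg k G G' : (forall s, size s = k -> G s = G' s) -> avg k G = avg k G'.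
Proof.
elim: k G G' => [|k IH] G G' H /=; first exact: H.
by congr ((_ + _) / 2); apply: IH => s ss; apply: H; rewrite /= ss.
Qed.

Lemma avg_cat k1 k2 G :
  avg (k1 + k2) G = avg k1 (fun s1 => avg k2 (fun s2 => G (s1 ++ s2))).
Proof. by elim: k1 G => //= k1 IH G; rewrite !IH. Qed.

Lemma avg_cst k c : avg k (fun=> c) = c.
Proof. by elim: k => //= k ->; field. Qed.

Lemma avgD k G G' : avg k (fun s => G s + G' s) = avg k G + avg k G'.
Proof. by elim: k G G' => //= k IH G G'; rewrite !IH; field. Qed.

Lemma avgM k c G : avg k (fun s => c * G s) = c * avg k G.
Proof. by elim: k G => //= k IH G; rewrite !IH; field. Qed.

Lemma avg_sum k (I : Type) (r : seq I) (F : I -> seq bool -> R) :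
  avg k (fun s => \sum_(i <- r) F i s) = \sum_(i <- r) avg k (F i).
Proof.
elim: r => [|i r IH].
  by rewrite big_nil -[RHS](avg_cst k); apply: eq_avg => s _; rewrite big_nil.
rewrite big_cons -IH -avgD; apply: eq_avg => s _; exact: big_cons.
Qed.

Lemma ler_avg k G G' : (forall s, size s = k -> G s <= G' s) -> avg k G <= avg k G'.
Proof.
elim: k G G' => [|k IH] G G' H /=; first exact: H.
by rewrite ler_pM2r ?invr_gt0 // lerD // IH // => s ss; apply: H; rewrite /= ss.
Qed.

Lemma avg_ge0 k G : (forall s, size s = k -> 0 <= G s) -> 0 <= avg k G.
Proof. by move=> H; rewrite -(avg_cst k 0); apply: ler_avg. Qed.

Lemma avg_take q k G : avg (q + k) (fun s => G (take q s)) = avg q G.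
Proof.
rewrite avg_cat; apply: eq_avg => s1 s1q; rewrite -[RHS](avg_cst k).
by apply: eq_avg => s2 _; rewrite take_size_cat.
Qed.

(** For [y = 0] the assumption forces [Y] to vanish on every sequence of length [k]. This case
    arises when the two Gibbs distributions coincide. *)
Lemma avg_markov k (Y : seq bool -> R) (y c : R) :
  (forall s, 0 <= Y s) -> 0 <= y -> 0 <= c -> avg k Y <= c * y ->
  avg k (fun s => ((y < Y s)%R)%:R) <= c.
Proof.
move=> Y0; rewrite le_eqVlt => /predU1P[<-|y0] c0 H; last first.
  rewrite -(ler_pM2r y0); apply: le_trans H; rewrite mulrC -avgM; apply: ler_avg => s _.
  by have [/ltW h|_] := ltrP y (Y s); rewrite ?mulr1 ?mulr0.
apply: le_trans c0; rewrite mulr0 in H.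
elim: k Y Y0 H => [|k IH] Y Y0 /= H; first by rewrite ltNge H.
rewrite pmulr_lle0 ?invr_gt0 //; move: H; rewrite pmulr_lle0 ?invr_gt0 // => H.
have h1 : 0 <= avg k (fun s => Y (true :: s)) by apply: avg_ge0.
have h2 : 0 <= avg k (fun s => Y (false :: s)) by apply: avg_ge0.
have i1 := IH (fun s => Y (true :: s)) (fun s => Y0 _).
have i2 := IH (fun s => Y (false :: s)) (fun s => Y0 _).
by have := i1 ltac:(lra); have := i2 ltac:(lra); lra.
Qed.

(** Most significant bit first, as a left fold: the machine builds the same number by doubling and
    adding a coin. *)
Definition bval (s : seq bool) : nat := foldl (fun u (c : bool) => u + u + c)%N 0%N s.

Lemma foldl_bval u s : foldl (fun u (c : bool) => u + u + c)%N u s = (u * 2 ^ size s + bval s)%N.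
Proof.
rewrite /bval; elim: s u => [|c s IH] u /=; first by rewrite expn0 muln1 addn0.
by rewrite IH [in RHS]IH /= add0n expnS; ring.
Qed.

Lemma bval_cons c s : bval (c :: s) = (c * 2 ^ size s + bval s)%N.
Proof. by rewrite {1}/bval /= foldl_bval. Qed.

Lemma avg_bval B (g : nat -> R) :
  avg B (fun s => g (bval s)) = (2 ^ B)%:R^-1 * \sum_(u < 2 ^ B) g u.
Proof.
elim: B g => [|B IH] g /=.
  by rewrite expn0 invr1 mul1r big_ord_recl big_ord0 addr0.
have -> : avg B (fun s => g (bval (true :: s))) = avg B (fun s => g (2 ^ B + bval s)%N).
  by apply: eq_avg => s ss; rewrite bval_cons ss mul1n.
have -> : avg B (fun s => g (bval (false :: s))) = avg B (fun s => g (bval s)).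
  by apply: eq_avg => s ss; rewrite bval_cons mul0n.
rewrite (IH (fun u => g (2 ^ B + u)%N)) IH.
have -> : \sum_(u < 2 ^ B.+1) g u = \sum_(u < 2 ^ B) g u + \sum_(u < 2 ^ B) g (2 ^ B + u)%N.
  by rewrite expnS mul2n -addnn big_split_ord.
rewrite expnS natrM; field.
by rewrite pnatr_eq0 expn_eq0.
Qed.

Fixpoint bitlists (k : nat) : seq (seq bool) :=
  if k is k'.+1 then map (cons true) (bitlists k') ++ map (cons false) (bitlists k')
  else [:: [::]].

Lemma mem_bitlists k s : (s \in bitlists k) = (size s == k).
Proof.
elim: k s => [|k IH] [|c s] //=; rewrite mem_cat.
  by apply/negP => /orP[] /mapP[].
rewrite eqSS -IH; apply/orP/idP => [[] /mapP[s' s'k [_ ->]] //|sk].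
by case: c; [left|right]; apply: map_f.
Qed.

Lemma uniq_bitlists k : uniq (bitlists k).
Proof.
elim: k => //= k IH; rewrite cat_uniq !map_inj_uniq ?IH ?andbT /=; try by move=> s s' [].
by apply/hasPn => s /mapP[s' _ ->]; apply/negP => /mapP[].
Qed.

Lemma sum_bitlists k G : \sum_(s <- bitlists k) G s = (2 ^ k)%:R * avg k G.
Proof.
elim: k G => [|k IH] G /=; first by rewrite big_seq1 mul1r.
rewrite big_cat !big_map (IH (fun s => G (true :: s))) (IH (fun s => G (false :: s))).
by rewrite expnS natrM /=; field.
Qed.

Lemma bits_ofE T (b : {ffun 'I_T -> bool}) (i : 'I_T) : bits_of b i = b i.
Proof.
rewrite /bits_of; case: eqP => [h|]; last by rewrite ltn_ord.
by congr (b _); apply: val_inj.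
Qed.

(** Bridge from counting finite functions on the coins to the recursive average, on which
    independence of successive blocks is mere concatenation. *)
Lemma sum_ffun_avg T G :
  \sum_(b : {ffun 'I_T -> bool}) G (mkseq (bits_of b) T) = (2 ^ T)%:R * avg T G.
Proof.
rewrite -sum_bitlists -(big_map (fun b : {ffun 'I_T -> bool} => mkseq (bits_of b) T) xpredT G).
apply: perm_big; apply: uniq_perm; rewrite ?uniq_bitlists //.
  rewrite map_inj_uniq ?index_enum_uniq // => b b' E; apply/ffunP => i.
  have := congr1 (fun s => nth false s i) E.
  by rewrite !nth_mkseq // !bits_ofE.
move=> s; rewrite mem_bitlists; apply/mapP/eqP => [[b _ ->]|sT]; first by rewrite size_mkseq.
exists [ffun i : 'I_T => nth false s i]; first by rewrite mem_index_enum.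
apply: (@eq_from_nth _ false); rewrite ?size_mkseq // sT => i iT.
by rewrite nth_mkseq // (bits_ofE _ (Ordinal iT)) ffunE.
Qed.

End Average.

(** * Independent samples and second moments *)

Section Sampling.
Variables (R : realFieldType) (St : finType).
Variables (q : nat) (smp : seq bool -> St).
Local Notation avg := (@avg R).

Definition Eq (f : St -> R) : R := avg q (fun s => f (smp s)).

Fixpoint samples (m : nat) (s : seq bool) : seq St :=
  if m is m'.+1 then smp (take q s) :: samples m' (drop q s) else [::].

Lemma size_samples m s : size (samples m s) = m.
Proof. by elim: m s => //= m IH s; rewrite IH. Qed.

Lemma samples_cat (s1 s2 : seq bool) m : size s1 = q ->
  samples m.+1 (s1 ++ s2) = smp s1 :: samples m s2.
Proof. by move=> h /=; rewrite take_size_cat // drop_size_cat. Qed.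

Lemma avg_samples m (G : seq St -> R) :
  avg (m.+1 * q) (fun s => G (samples m.+1 s))
  = avg q (fun s1 => avg (m * q) (fun s2 => G (smp s1 :: samples m s2))).
Proof.
rewrite mulSn avg_cat; apply: eq_avg => s1 h; apply: eq_avg => s2 _.
by rewrite samples_cat.
Qed.

Lemma samples_mean m (f : St -> R) : Eq f = 0 ->
  avg (m * q) (fun s => \sum_(x <- samples m s) f x) = 0.
Proof.
move=> f0; elim: m => [|m IH]; first by rewrite mul0n /= big_nil.
rewrite (avg_samples m (fun r => \sum_(x <- r) f x)).
rewrite -[RHS]f0; apply: eq_avg => s1 _.
transitivity (avg (m * q) (fun s2 => f (smp s1) + \sum_(x <- samples m s2) f x)).
  by apply: eq_avg => s2 _; rewrite big_cons.
by rewrite avgD avg_cst IH addr0.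
Qed.

Lemma samples_var m (f : St -> R) : Eq f = 0 ->
  avg (m * q) (fun s => (\sum_(x <- samples m s) f x) ^+ 2) = m%:R * Eq (fun x => f x ^+ 2).
Proof.
move=> f0; elim: m => [|m IH]; first by rewrite mul0n /= big_nil expr0n mul0r.
rewrite (avg_samples m (fun r => (\sum_(x <- r) f x) ^+ 2)).
transitivity (avg q (fun s1 => f (smp s1) ^+ 2 + m%:R * Eq (fun x => f x ^+ 2))).
  apply: eq_avg => s1 _.
  transitivity (avg (m * q) (fun s2 => f (smp s1) ^+ 2 +
     (2 * f (smp s1) * (\sum_(x <- samples m s2) f x)
      + (\sum_(x <- samples m s2) f x) ^+ 2))).
    by apply: eq_avg => s2 _; rewrite big_cons; ring.
  by rewrite !avgD avg_cst avgM samples_mean // IH mulr0 add0r.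
rewrite avgD avg_cst -/(Eq (fun x => f x ^+ 2)) -natr1; ring.
Qed.

Lemma EqE (f : St -> R) : Eq f = \sum_x Eq (fun y => (y == x)%:R) * f x.
Proof.
rewrite /Eq; transitivity (\sum_x avg q (fun s => f x * (smp s == x)%:R)).
  rewrite -avg_sum; apply: eq_avg => s _.
  rewrite (bigD1 (smp s)) //= eqxx mulr1 big1 ?addr0 // => x.
  by rewrite eq_sym => /negbTE ->; rewrite mulr0.
by apply: eq_bigr => x _; rewrite avgM mulrC.
Qed.

Lemma EqB (f : St -> R) c : Eq (fun x => f x - c) = Eq f - c.
Proof. by rewrite /Eq avgD avg_cst. Qed.

(* Chebyshev's inequality, with the threshold squared so that [u = 0] is allowed. *)
Lemma samples_chebyshev m (f : St -> R) (u c : R) : 0 <= c ->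
  Eq (fun x => f x ^+ 2) <= c * m%:R * u ^+ 2 ->
  avg (m * q) (fun s => (((m%:R * u) ^+ 2 <
     (\sum_(x <- samples m s) f x - m%:R * Eq f) ^+ 2)%R)%:R) <= c.
Proof.
move=> c0 H; apply: avg_markov => //; try by move=> s; apply: sqr_ge0.
  exact: sqr_ge0.
pose g x := f x - Eq f.
have g0 : Eq g = 0 by rewrite /g EqB subrr.
have -> : avg (m * q) (fun s => (\sum_(x <- samples m s) f x - m%:R * Eq f) ^+ 2)
  = m%:R * Eq (fun x => g x ^+ 2).
  rewrite -(samples_var m g0); apply: eq_avg => s _; congr (_ ^+ 2).
  by rewrite /g sumrB big_const_seq count_predT size_samples iter_addr_0 mulr_natl.
have : Eq (fun x => g x ^+ 2) <= Eq (fun x => f x ^+ 2).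
  have -> : Eq (fun x => g x ^+ 2) = Eq (fun x => f x ^+ 2) - Eq f ^+ 2.
    have E : Eq (fun x => g x ^+ 2)
      = avg q (fun s => f (smp s) ^+ 2 + ((- (2 * Eq f)) * f (smp s) + Eq f ^+ 2)).
      by apply: eq_avg => s _; rewrite /g; ring.
    by rewrite E !avgD avgM avg_cst -/(Eq f) -/(Eq (fun x => f x ^+ 2)); ring.
  by rewrite lerBlDr lerDl sqr_ge0.
move=> /le_trans /(_ H) /(ler_wpM2l (ler0n R m)) /le_trans; apply.
by rewrite le_eqVlt; apply/orP; left; apply/eqP; ring.
Qed.
End Sampling.

Section Walk.
Variables (R : realFieldType) (St : finType) (B : nat) (stepf : St -> nat -> nat -> St).
Local Notation avg := (@avg R).

(** Every step reads exactly [B + B] coins: [B] choose the slot and [B] decide acceptance. *)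
Fixpoint walk (t : nat) (X : St) (s : seq bool) : St :=
  if t is t'.+1 then
    walk t' (stepf X (bval (take B s)) (bval (take B (drop B s)))) (drop (B + B) s)
  else X.

Definition wop (f : St -> R) (X : St) : R :=
  (2 ^ B)%:R^-1 * \sum_(u < 2 ^ B) (2 ^ B)%:R^-1 * \sum_(w < 2 ^ B) f (stepf X u w).

Lemma avg_walk t (f : St -> R) X :
  avg (t * (B + B)) (fun s => f (walk t X s)) = iter t wop f X.
Proof.
elim: t X => [|t IH] X //=; rewrite mulSn avg_cat avg_cat.
rewrite /wop -(avg_bval B (fun u => (2 ^ B)%:R^-1 * \sum_(w < 2 ^ B) iter t wop f (stepf X u w))).
apply: eq_avg => s1 h1.
rewrite -(avg_bval B (fun w => iter t wop f (stepf X (bval s1) w))).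
apply: eq_avg => s2 h2; rewrite -IH; apply: eq_avg => s3 _.
rewrite -catA take_size_cat // drop_size_cat // take_size_cat //.
by rewrite catA drop_size_cat // size_cat h1 h2.
Qed.
End Walk.

Lemma sum_insub (R : pzRingType) (n M : nat) (a : 'I_n -> R) (c : R) : (n <= M)%N ->
  \sum_(u < M) (if insub (u : nat) is Some v then a v else c)
  = \sum_v a v + (M - n)%:R * c.
Proof.
move=> /subnKC <-; rewrite big_split_ord /= addKn; congr (_ + _).
  by apply: eq_bigr => v _; rewrite (valK v).
rewrite (eq_bigr (fun=> c)); first by rewrite sumr_const card_ord mulr_natl.
by move=> u _; rewrite insubF //= ltnNge leq_addr.
Qed.

Lemma sum_lt_if (R : pzRingType) (k M : nat) (x y : R) : (k <= M)%N ->
  \sum_(w < M) (if (w < k)%N then x else y) = k%:R * x + (M - k)%:R * y.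
Proof.
move=> /subnKC <-; rewrite big_split_ord /= addKn; congr (_ + _).
  rewrite (eq_bigr (fun=> x)); first by rewrite sumr_const card_ord mulr_natl.
  by move=> u _; rewrite ltn_ord.
rewrite (eq_bigr (fun=> y)); first by rewrite sumr_const card_ord mulr_natl.
by move=> u _; rewrite ltnNge leq_addr.
Qed.

Section DyadicGlauber.
Variables (R : rcfType) (n : nat) (e : rel 'I_n) (B : nat) (k : 'I_n -> nat).
Local Notation M := (2 ^ B)%N.
Hypothesis nM : (n <= M)%N.
Hypothesis kM : forall v, (0 < k v < M)%N.

Definition gstep (X : {set 'I_n}) (u w : nat) : {set 'I_n} :=
  if insub u is Some v then
    if (w < k v)%N && [disjoint X & nbr e v] then v |: X else X :\ v
  else X.

Definition klam (v : 'I_n) : R := (k v)%:R / (M - k v)%:R.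

Lemma klam_gt0 v : 0 < klam v.
Proof. by have /andP[k0 k1] := kM v; rewrite divr_gt0 ?ltr0n // subn_gt0. Qed.

Lemma klam1 v : 1 + klam v = M%:R / (M - k v)%:R.
Proof.
have /andP[k0 k1] := kM v; rewrite /klam.
rewrite -[X in X + _](@divff _ (M - k v)%:R) ?pnatr_eq0 -?lt0n ?subn_gt0 //.
by rewrite -mulrDl -natrD subnK // ltnW.
Qed.

(** Because [1 + klam v = M / (M - k v)], the event [w < k v] has probability exactly
    [klam v / (1 + klam v)]; the walk driven by coins is the heat bath with no rounding error. *)
Lemma wop_gop (f : {set 'I_n} -> R) X : wop B gstep f X = gop e klam M f X.
Proof.
rewrite /wop /gop card_ord; congr (_ * _).
have M0 : M%:R != 0 :> R by rewrite pnatr_eq0 expn_eq0.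
transitivity (\sum_(u < M) (if insub (u : nat) is Some v then heat e klam v f X else f X)).
  apply: eq_bigr => u _; rewrite /gstep; case: insub => [v|]; last first.
    by rewrite sumr_const card_ord -[f X *+ _]mulr_natl mulKf.
  have /andP[k0 k1] := kM v.
  rewrite (eq_bigr (fun w : 'I_M => if (w < k v)%N then f (occupy e v X) else f (X :\ v))); last first.
    by move=> w _; rewrite /occupy; case: ltnP => //= _; case: ifP.
  rewrite sum_lt_if ?(ltnW k1) // /heat klam1 /klam natrB ?(ltnW k1) //.
  have h : M%:R - (k v)%:R != 0 :> R by rewrite subr_eq0 eqr_nat gtn_eqF.
  by field; rewrite h M0.
exact: sum_insub.
Qed.

Lemma iter_wop_gop t (f : {set 'I_n} -> R) X :
  iter t (wop B gstep) f X = iter t (gop e klam M) f X.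
Proof.
elim: t X => //= t IH X; rewrite wop_gop; exact: eq_gop.
Qed.
End DyadicGlauber.

(** * The reweighted estimator *)

Lemma prod_diff_le (R : realDomainType) (I : Type) (r : seq I) (P : pred I) (a b : I -> R) :
  (forall i, 0 <= a i <= 1) -> (forall i, 0 <= b i <= 1) ->
  `|\prod_(i <- r | P i) a i - \prod_(i <- r | P i) b i| <= \sum_(i <- r | P i) `|a i - b i|.
Proof.
move=> a01 b01; elim: r => [|i r IH]; first by rewrite !big_nil subrr normr0.
rewrite !big_cons; case: ifP => // _; set x := \prod_(j <- r | P j) a j in IH *.
set y := \prod_(j <- r | P j) b j in IH *.
have y01 : `|y| <= 1.
  rewrite normr_prod; apply: prodr_ile1 => j _; rewrite normr_ge0 /=.
  by have /andP[? ?] := b01 j; rewrite ger0_norm.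
have -> : a i * x - b i * y = a i * (x - y) + (a i - b i) * y by ring.
apply: (le_trans (ler_normD _ _)); rewrite !normrM addrC lerD //.
  by rewrite ler_piMr.
apply: le_trans IH; rewrite ler_piMl //.
by have /andP[? ?] := a01 i; rewrite ger0_norm.
Qed.

Lemma union_bound3 (R : realFieldType) (g b1 b2 b3 : bool) :
  (~~ b1 -> ~~ b2 -> ~~ b3 -> g) -> 1 <= g%:R + (b1%:R + (b2%:R + b3%:R)) :> R.
Proof.
by case: g b1 b2 b3 => -[] [] [] // H; rewrite /=; try lra; have := H isT isT isT.
Qed.

Section Reweight.
Variables (R : rcfType) (V : finType) (e : rel V).
Hypothesis esym : forall u v, e u v = e v u.
Hypothesis eirr : forall v, e v v = false.
Variables lamm laml lamp : V -> R.
Hypothesis m0 : forall v, 0 <= lamm v.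
Hypothesis l0 : forall v, 0 <= laml v.
Hypothesis p0 : forall v, 0 < lamp v.
Hypothesis mp : forall v, lamm v <= lamp v.
Hypothesis lp : forall v, laml v <= lamp v.

Definition reweight (lam : V -> R) (X : {set V}) : R := \prod_(v in X) (lam v / lamp v).
Local Notation W1 := (reweight lamm).
Local Notation W2 := (reweight laml).
Local Notation wtp := (wt e lamp).
Local Notation Zp := (Zs e lamp setT).
Local Notation Z1 := (Zs e lamm setT).
Local Notation Z2 := (Zs e laml setT).

Let p_ge0 v : 0 <= lamp v := ltW (p0 v).

Lemma wt_reweight lam X : wt e lam X = wtp X * reweight lam X.
Proof.
rewrite /wt /reweight; case: ifP => _; last by rewrite mul0r.
rewrite -big_split /=; apply: eq_bigr => v _; rewrite mulrC divfK //.
by rewrite gt_eqF.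
Qed.

Lemma reweight01 lam X : (forall v, 0 <= lam v) -> (forall v, lam v <= lamp v) ->
  0 <= reweight lam X <= 1.
Proof.
move=> h0 h1; have h v : 0 <= lam v / lamp v <= 1.
  by rewrite divr_ge0 //= ler_pdivrMr // mul1r.
rewrite /reweight prodr_ge0 /=; last by move=> v _; have /andP[] := h v.
by apply: prodr_ile1 => v _; apply: h.
Qed.

Lemma ZsT (lam : V -> R) : Zs e lam setT = \sum_X wt e lam X.
Proof. by apply: eq_bigl => X; rewrite subsetT. Qed.

Definition Ep (f : {set V} -> R) : R := \sum_X wtp X / Zp * f X.

Lemma Zp_gt0 : 0 < Zp. Proof. exact: Zs_gt0. Qed.
Lemma Z1_gt0 : 0 < Z1. Proof. exact: Zs_gt0. Qed.
Lemma Z2_gt0 : 0 < Z2. Proof. exact: Zs_gt0. Qed.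

Lemma Ep_ge0 f : (forall X, 0 <= f X) -> 0 <= Ep f.
Proof.
move=> f0; apply: sumr_ge0 => X _; rewrite mulr_ge0 // divr_ge0 ?wt_ge0 //.
exact: ltW Zp_gt0.
Qed.

Lemma Ep_le f g : (forall X, f X <= g X) -> Ep f <= Ep g.
Proof.
move=> fg; apply: ler_sum => X _; rewrite ler_wpM2l // divr_ge0 ?wt_ge0 //.
exact: ltW Zp_gt0.
Qed.

Lemma Ep_cst c : Ep (fun=> c) = c.
Proof. by rewrite /Ep -!mulr_suml -ZsT divff ?mul1r // gt_eqF ?Zp_gt0. Qed.

Lemma EpD f g : Ep (fun X => f X + g X) = Ep f + Ep g.
Proof. by rewrite /Ep -big_split; apply: eq_bigr => X _; rewrite mulrDr. Qed.

Lemma EpM c f : Ep (fun X => c * f X) = c * Ep f.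
Proof. by rewrite /Ep mulr_sumr; apply: eq_bigr => X _; rewrite mulrCA. Qed.

Lemma Ep_sqr f : Ep f ^+ 2 <= Ep (fun X => f X ^+ 2).
Proof.
have : 0 <= Ep (fun X => (f X - Ep f) ^+ 2) by apply: Ep_ge0 => X; apply: sqr_ge0.
have -> : Ep (fun X => (f X - Ep f) ^+ 2)
   = Ep (fun X => f X ^+ 2 + ((- (2 * Ep f)) * f X + Ep f ^+ 2)).
  by apply: eq_bigr => X _; congr (_ * _); ring.
by rewrite !EpD EpM Ep_cst; lra.
Qed.

Definition tv : R := 2^-1 * \sum_X `|wt e lamm X / Z1 - wt e laml X / Z2|.
(* Up to scaling, the density of the signed measure [mu - nu] with respect to the
   sampled measure: it has mean zero, and its absolute value has mean
   [2 * r1 * tv]. *)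
Definition contrast (X : {set V}) : R := W1 X - Z1 / Z2 * W2 X.
Local Notation D := contrast.
Let r1 := Z1 / Zp.

Lemma tv_ge0 : 0 <= tv. Proof. by rewrite mulr_ge0 ?invr_ge0 // sumr_ge0. Qed.

Lemma tv_le1 : tv <= 1.
Proof.
rewrite /tv ler_pdivrMl // mulr1.
apply: (@le_trans _ _ (\sum_X (wt e lamm X / Z1 + wt e laml X / Z2))).
  apply: ler_sum => X _; apply: (le_trans (ler_normB _ _)).
  by rewrite !ger0_norm // divr_ge0 ?wt_ge0 // ltW // ?Z1_gt0 ?Z2_gt0.
rewrite big_split /= -!mulr_suml -!ZsT !divff ?gt_eqF ?Z1_gt0 ?Z2_gt0 //; lra.
Qed.

Lemma Ep_reweight lam : Ep (reweight lam) = Zs e lam setT / Zp.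
Proof.
rewrite (ZsT lam) mulr_suml; apply: eq_bigr => X _; rewrite (wt_reweight lam); ring.
Qed.

Lemma Ep_contrast : Ep D = 0.
Proof.
have -> : Ep D = Ep W1 + (- (Z1 / Z2)) * Ep W2.
  by rewrite -EpM -EpD; apply: eq_bigr => X _; rewrite /contrast mulNr.
rewrite !Ep_reweight; field.
by rewrite !gt_eqF ?Zp_gt0 ?Z2_gt0.
Qed.

Lemma Ep_abs_contrast : Ep (fun X => `|D X|) = 2 * r1 * tv.
Proof.
rewrite /tv /r1 mulr_sumr mulr_sumr /Ep; apply: eq_bigr => X _.
have -> : wt e lamm X / Z1 - wt e laml X / Z2 = wtp X / Z1 * D X.
  rewrite (wt_reweight lamm) (wt_reweight laml) /contrast; field.
  by rewrite !gt_eqF ?Z1_gt0 ?Z2_gt0.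
rewrite normrM ger0_norm; last by rewrite divr_ge0 ?wt_ge0 // ltW // Z1_gt0.
by field; rewrite !gt_eqF ?Zp_gt0 ?Z1_gt0.
Qed.

Variables (C0 K : R).
Hypothesis tv_low : forall v, `|lamm v - laml v| <= C0 * tv.
Hypothesis C0_ge0 : 0 <= C0.
Hypothesis Z3m : Zp <= 3 * Z1.
Hypothesis Z3l : Zp <= 3 * Z2.
Hypothesis lampK : forall v, (lamp v)^-1 <= K.
Hypothesis nK : #|V|%:R <= K.

Lemma pair_prob (u v : V) : u != v ->
  \sum_(X : {set V} | (u \in X) && (v \in X)) wtp X <= lamp u * lamp v * Zp.
Proof.
move=> uv.
have -> : \sum_(X : {set V} | (u \in X) && (v \in X)) wtp X = up e lamp (u |: (v |: set0)).
  by apply: eq_bigl => X; rewrite !subUset !sub1set sub0set andbT.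
rewrite (upU1 esym eirr p_ge0) ?(upU1 esym eirr p_ge0) ?inE ?orbF //.
have -> : up e lamp set0 = Zp by rewrite upE // free0 wt0 mul1r.
rewrite [leRHS](_ : _ = Zp * lamp v * lamp u); last by ring.
apply: ler_pM; [|exact: Pr_ge0| |exact: Pr_le_lam].
  by rewrite mulr_ge0 ?Pr_ge0 // ltW // Zp_gt0.
by rewrite ler_wpM2l ?Pr_le_lam // ltW // Zp_gt0.
Qed.

Lemma single_prob (v : V) : \sum_(X : {set V} | v \in X) wtp X <= lamp v * Zp.
Proof.
have -> : \sum_(X : {set V} | v \in X) wtp X = up e lamp (v |: set0).
  by apply: eq_bigl => X; rewrite !subUset !sub1set sub0set andbT.
rewrite (upU1 esym eirr p_ge0) ?inE //.
have -> : up e lamp set0 = Zp by rewrite upE // free0 wt0 mul1r.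
by rewrite mulrC ler_wpM2r ?Pr_le_lam // ltW // Zp_gt0.
Qed.

(** The difference of two products is at most the sum of the differences of their factors over the
    occupied vertices. In the expanded square, off-diagonal pairs have probability at most
    [lamp u * lamp v], which cancels both denominators; a diagonal term keeps one factor
    [(lamp u)^-1 <= K]. This gives [#|V| ^ 2 + #|V| * K], and [#|V| <= K]. *)
Lemma reweight_diff_moment :
  Ep (fun X => (W1 X - W2 X) ^+ 2) <= 2 * #|V|%:R * K * (C0 * tv) ^+ 2.
Proof.
pose c (v : V) : R := `|lamm v - laml v| / lamp v.
have c0 v : 0 <= c v by rewrite divr_ge0.
have d0 : 0 <= C0 * tv by rewrite mulr_ge0 // tv_ge0.
apply: (@le_trans _ _ (Ep (fun X => (\sum_(v in X) c v) ^+ 2))).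
  apply: Ep_le => X; rewrite -[leLHS]real_normK ?num_real //.
  rewrite ler_sqr ?nnegrE ?sumr_ge0 //.
  apply: (le_trans (prod_diff_le _ _ _ _)) => [v|v|].
  - by rewrite divr_ge0 //= ler_pdivrMr // mul1r.
  - by rewrite divr_ge0 //= ler_pdivrMr // mul1r.
  apply: ler_sum => v _; rewrite -mulrBl normrM /c.
  by rewrite [`|(lamp v)^-1|]gtr0_norm ?invr_gt0.
have -> : Ep (fun X => (\sum_(v in X) c v) ^+ 2)
   = \sum_u \sum_v c u * c v / Zp * \sum_(X : {set V} | (u \in X) && (v \in X)) wtp X.
  transitivity (\sum_(X : {set V}) \sum_(u : V) \sum_(v : V)
     (if (u \in X) && (v \in X) then wtp X / Zp * (c u * c v) else 0)).
    rewrite /Ep; apply: eq_bigr => X _; rewrite expr2 mulr_suml mulr_sumr.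
    rewrite big_mkcond; apply: eq_bigr => u _ /=; case: (u \in X) => /=; last by rewrite big1.
    rewrite mulr_sumr mulr_sumr big_mkcond; apply: eq_bigr => v _ /=.
    by case: (v \in X).
  rewrite exchange_big; apply: eq_bigr => u _; rewrite exchange_big; apply: eq_bigr => v _.
  rewrite mulr_sumr [RHS]big_mkcond; apply: eq_bigr => X _; case: ifP => // _; ring.
apply: (@le_trans _ _ (\sum_u \sum_v ((C0 * tv) ^+ 2 + (u == v)%:R * (K * (C0 * tv) ^+ 2)))).
  apply: ler_sum => u _; apply: ler_sum => v _; have [<-|uv] := eqVneq u v.
    rewrite mul1r.
    have -> : \sum_(X : {set V} | (u \in X) && (u \in X)) wtp X
        = \sum_(X : {set V} | u \in X) wtp X by apply: eq_bigl => X; rewrite andbb.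
    apply: (@le_trans _ _ (c u * c u / Zp * (lamp u * Zp))).
      apply: ler_wpM2l; last exact: single_prob.
      exact: (divr_ge0 (mulr_ge0 (c0 u) (c0 u)) (ltW Zp_gt0)).
    have -> : c u * c u / Zp * (lamp u * Zp) = (lamp u)^-1 * `|lamm u - laml u| ^+ 2.
      by rewrite /c; field; rewrite !gt_eqF ?Zp_gt0.
    rewrite -[leLHS]add0r lerD ?sqr_ge0 //; apply: ler_pM => //.
    - by rewrite invr_ge0 ltW.
    - by rewrite sqr_ge0.
    - by rewrite ler_sqr ?nnegrE.
  rewrite mul0r addr0.
  apply: (@le_trans _ _ (c u * c v / Zp * (lamp u * lamp v * Zp))).
    apply: ler_wpM2l; last exact: pair_prob.
    exact: (divr_ge0 (mulr_ge0 (c0 u) (c0 v)) (ltW Zp_gt0)).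
  have -> : c u * c v / Zp * (lamp u * lamp v * Zp) = `|lamm u - laml u| * `|lamm v - laml v|.
    by rewrite /c; field; rewrite !gt_eqF ?Zp_gt0.
  by rewrite expr2 ler_pM.
under eq_bigr do rewrite big_split /=.
rewrite big_split /=.
have -> : \sum_(u : V) \sum_(v : V) (u == v)%:R * (K * (C0 * tv) ^+ 2) = #|V|%:R * (K * (C0 * tv) ^+ 2).
  rewrite mulr_natl -sumr_const; apply: eq_bigr => u _.
  rewrite (bigD1 u) //= eqxx mul1r big1 ?addr0 // => v; rewrite eq_sym => /negbTE ->.
  by rewrite mul0r.
under eq_bigr do rewrite sumr_const -[_ *+ _]mulr_natl.
rewrite sumr_const -[_ *+ _]mulr_natl.
have s0 := sqr_ge0 (C0 * tv); set s := (C0 * tv) ^+ 2 in s0 *.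
have n0 : 0 <= #|V|%:R :> R by rewrite ler0n.
have := ler_wpM2l n0 (ler_wpM2r s0 nK); lra.
Qed.

(** Write [D = (W1 - W2) + t * W2] with [t = 1 - Z1 / Z2]. Up to the factor [Zp / Z2 <= 3], [t] is
    the mean of [W2 - W1], so [t ^+ 2 <= 9 * Q]; then [2 + 2 * 9 = 20]. *)
Lemma contrast_moment :
  Ep (fun X => D X ^+ 2) <= 40 * #|V|%:R * K * (C0 * tv) ^+ 2.
Proof.
set Q := Ep (fun X => (W1 X - W2 X) ^+ 2).
suff H : Ep (fun X => D X ^+ 2) <= 20 * Q.
  by apply: le_trans H _; have := reweight_diff_moment; rewrite -/Q; lra.
set t := 1 - Z1 / Z2.
have tQ : t ^+ 2 <= 9 * Q.
  have -> : t = - (Zp / Z2) * Ep (fun X => W1 X - W2 X).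
    have -> : Ep (fun X => W1 X - W2 X) = Ep W1 + (-1) * Ep W2.
      by rewrite -EpM -EpD; apply: eq_bigr => X _; rewrite mulN1r.
    rewrite !Ep_reweight /t; field.
    by rewrite !gt_eqF ?Zp_gt0 ?Z2_gt0.
  rewrite exprMn sqrrN; apply: ler_pM; rewrite ?sqr_ge0 ?Ep_sqr //.
  have -> : (9 : R) = 3 ^+ 2 by ring.
  rewrite ler_sqr ?nnegrE ?divr_ge0 ?(ltW Zp_gt0) ?(ltW Z2_gt0) //.
  by rewrite ler_pdivrMr ?Z2_gt0.
apply: (@le_trans _ _ (Ep (fun X => 2 * (W1 X - W2 X) ^+ 2 + 2 * t ^+ 2))).
  apply: Ep_le => X; have /andP[w0 w1] := reweight01 X l0 lp.
  have -> : D X = (W1 X - W2 X) + t * W2 X by rewrite /contrast /t; ring.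
  set x := W1 X - W2 X; set y := t * W2 X.
  have y2 : y ^+ 2 <= t ^+ 2.
    by rewrite /y exprMn ler_piMr ?sqr_ge0 // exprn_ile1.
  have := sqr_ge0 (x - y); clearbody x y t; lra.
by rewrite EpD EpM Ep_cst -/Q; lra.
Qed.

Section Estimator.
Variables (q : nat) (smp : seq bool -> {set V}) (eps : R) (m : nat).
Hypothesis eps01 : 0 < eps < 1.
Hypothesis close : forall X,
  `|Eq q smp (fun Y => (Y == X)%:R) - wtp X / Zp| <= eps / 20 * (wtp X / Zp).
Hypothesis m_large : 80 * (C0 ^+ 2 * #|V|%:R * K) <= m%:R * eps ^+ 2 / 90 ^+ 2.
Hypothesis m_large2 : 2 <= m%:R * eps ^+ 2 / 180 ^+ 2.

(** A pointwise relative error of the sampler gives, for every [f], an error relative to the mean of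
    [|f|]. For the contrast that mean is proportional to the distance, so the bias stays
    relative. *)
Lemma Eq_close (f : {set V} -> R) :
  `|Eq q smp f - Ep f| <= eps / 20 * Ep (fun X => `|f X|).
Proof.
rewrite EqE /Ep -sumrB mulr_sumr; apply: (le_trans (ler_norm_sum _ _ _)).
apply: ler_sum => X _; rewrite -mulrBl normrM mulrA ler_wpM2r //.
Qed.

Lemma Eq_le2 (f : {set V} -> R) : (forall X, 0 <= f X) -> Eq q smp f <= 2 * Ep f.
Proof.
move=> f0; have := Eq_close f; have f1 := Ep_ge0 f0.
have -> : Ep (fun X => `|f X|) = Ep f by apply: eq_bigr => X _; rewrite ger0_norm.
rewrite ler_norml => /andP[_ h].
have h2 : eps / 20 * Ep f <= 1 * Ep f by rewrite ler_wpM2r //; move: eps01; lra.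
lra.
Qed.

(** Self-normalised: the sums of the reweights over the same samples replace the unknown partition
    functions. *)
Definition estimate (xs : seq {set V}) : R :=
  let a := \sum_(x <- xs) W1 x in let b := \sum_(x <- xs) W2 x in
  2^-1 * \sum_(x <- xs) `|W1 x / a - W2 x / b|.

Lemma r1_ge : 3^-1 <= r1.
Proof. by rewrite /r1 ler_pdivlMr ?Zp_gt0 // mulrC ler_pdivrMr // mulrC. Qed.

(** Replacing the unknown ratio [Z1 / Z2] by [a / b] changes the sum of absolute values by at most
    [|Z1 / Z2 - a / b| * b], which is exactly the modulus of the summed contrast. As the contrast
    has mean zero, that sum is small compared with the distance. *)
Lemma estimate_accurate (xs : seq {set V}) : size xs = m ->
  `|\sum_(x <- xs) W1 x - m%:R * r1| <= eps / 10 * (m%:R * r1) ->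
  `|\sum_(x <- xs) D x| <= eps / 10 * (m%:R * (2 * r1 * tv)) ->
  `|\sum_(x <- xs) `|D x| - m%:R * (2 * r1 * tv)| <= eps / 10 * (m%:R * (2 * r1 * tv)) ->
  (1 - eps) * tv <= estimate xs <= (1 + eps) * tv.
Proof.
move=> szx; rewrite /estimate /=; set a := \sum_(x <- xs) W1 x; set b := \sum_(x <- xs) W2 x.
set SD := \sum_(x <- xs) D x; set SA := \sum_(x <- xs) `|D x|.
set A := m%:R * r1; have -> : m%:R * (2 * r1 * tv) = 2 * A * tv by rewrite /A; ring.
move=> ha hD hA.
have /andP[e1 e2] := eps01.
have mp0 : 0 < m%:R :> R.
  rewrite ltr0n lt0n; apply: contraTneq m_large2 => ->; rewrite !mul0r -ltNge; lra.
have A0 : 0 < A by apply: mulr_gt0 => //; apply: lt_le_trans r1_ge; rewrite invr_gt0.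
have t0 := tv_ge0; have t1 := tv_le1.
have At0 : 0 <= A * tv by rewrite mulr_ge0 // ltW.
have At1 : A * tv <= A by rewrite ler_piMr // ltW.
have eA : eps * A <= A by exact: (ler_piMl (ltW A0) (ltW e2)).
have eAt : eps * (A * tv) <= A * tv by exact: (ler_piMl At0 (ltW e2)).
have eAt0 : 0 <= eps * (A * tv) by exact: (mulr_ge0 (ltW e1) At0).
move: ha; rewrite ler_norml => /andP[ha1 ha2].
have SDE : SD = a - Z1 / Z2 * b.
  by rewrite /SD /contrast sumrB -mulr_sumr.
have q0 : 0 < Z1 / Z2 by rewrite divr_gt0 ?Z1_gt0 ?Z2_gt0.
have hD' := hD; move: hD; rewrite ler_norml => /andP[hD1 hD2].
have ap : 0 < a by lra.
have bp : 0 < b.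
  by rewrite -(pmulr_rgt0 _ q0); move: SDE hD2; lra.
pose S := \sum_(x <- xs) `|W1 x - a / b * W2 x|.
have SE : \sum_(x <- xs) `|W1 x / a - W2 x / b| = S / a.
  rewrite /S mulr_suml; apply: eq_bigr => x _.
  have -> : `|W1 x - a / b * W2 x| / a = `|(W1 x - a / b * W2 x) / a|.
    by rewrite normrM [`|a^-1|]gtr0_norm ?invr_gt0.
  congr `| _ |.
  by field; rewrite !gt_eqF.
have SS : `|S - SA| <= `|SD|.
  rewrite /S /SA -sumrB; apply: (le_trans (ler_norm_sum _ _ _)).
  apply: (@le_trans _ _ (\sum_(x <- xs) `|Z1 / Z2 - a / b| * W2 x)).
    apply: ler_sum => x _; apply: (le_trans (ler_dist_dist _ _)).
    have /andP[w0 _] := reweight01 x l0 lp.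
    have -> : `|Z1 / Z2 - a / b| * W2 x = `|(Z1 / Z2 - a / b) * W2 x|.
      by rewrite normrM (ger0_norm w0).
    rewrite le_eqVlt; apply/orP; left; apply/eqP.
    by congr `| _ |; rewrite /contrast; ring.
  have -> : \sum_(x <- xs) `|Z1 / Z2 - a / b| * W2 x = `|- ((Z1 / Z2 - a / b) * b)|.
    by rewrite normrN normrM (gtr0_norm bp) -mulr_sumr.
  rewrite le_eqVlt; apply/orP; left; apply/eqP; congr `| _ |.
  by rewrite SDE; field; rewrite !gt_eqF ?Z2_gt0.
have := le_trans SS hD'; rewrite ler_norml => /andP[s1 s2].
move: hA; rewrite ler_norml => /andP[s3 s4].
have -> : 2^-1 * \sum_(x <- xs) `|W1 x / a - W2 x / b| = S / 2 / a by rewrite SE; field; rewrite gt_eqF.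
have nn : 0 <= tv * (a - A + eps / 10 * A) by rewrite mulr_ge0 //; lra.
have nn2 : 0 <= tv * (A + eps / 10 * A - a) by rewrite mulr_ge0 //; lra.
have ee : 0 <= eps * (tv * (a - A + eps / 10 * A)) by rewrite mulr_ge0 // ltW.
have ee2 : 0 <= (1 - eps) * (tv * (A + eps / 10 * A - a)) by rewrite mulr_ge0 //; lra.
have q1 : eps * (eps * (A * tv)) <= eps * (A * tv) by exact: (ler_piMl eAt0 (ltW e2)).
apply/andP; split; [rewrite ler_pdivlMr //|rewrite ler_pdivrMr //]; lra.
Qed.

(** Three averages must be accurate, and each fails with probability at most 1/9. In each,
    [eps / 20] of the error comes from sampling and [eps / 20] from the bias of the sampler. *)
Lemma estimate_prob :
  2 / 3 <= @avg R (m * q) (fun s => let d := estimate (samples q smp m s) in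
    (((1 - eps) * tv <= d)%R && (d <= (1 + eps) * tv)%R)%:R).
Proof.
have /andP[e1 e2] := eps01.
have t0 := tv_ge0; have r0 := r1_ge.
have mp0 : 0 <= m%:R :> R by rewrite ler0n.
have n0 : 0 <= #|V|%:R :> R by rewrite ler0n.
have r19 : 9^-1 <= r1 ^+ 2.
  have -> : (9^-1 : R) = 3^-1 ^+ 2 by rewrite exprVn; congr (_^-1); ring.
  by rewrite ler_sqr ?nnegrE //; lra.
(* With [r1 ^+ 2 >= 1/9] the right side is at least [m * eps ^+ 2 * tv ^+ 2 / 90 ^+ 2]; the same
   count without the factor 2 gives the 180 used for [W1]. The 80 is twice the 40 of
   [contrast_moment]. *)
have mom : Eq q smp (fun X => D X ^+ 2) <= 9^-1 * m%:R * (eps / 20 * (2 * r1 * tv)) ^+ 2.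
  apply: le_trans (Eq_le2 (fun X => sqr_ge0 _)) _.
  apply: (@le_trans _ _ (2 * (40 * #|V|%:R * K * (C0 * tv) ^+ 2))).
    by rewrite ler_wpM2l // contrast_moment.
  have -> : 9^-1 * m%:R * (eps / 20 * (2 * r1 * tv)) ^+ 2
     = 30 ^- 2 * (m%:R * eps ^+ 2) * r1 ^+ 2 * tv ^+ 2 by field.
  have -> : 2 * (40 * #|V|%:R * K * (C0 * tv) ^+ 2) = 80 * (C0 ^+ 2 * #|V|%:R * K) * tv ^+ 2.
    by ring.
  apply: ler_wpM2r; first exact: sqr_ge0.
  apply: (@le_trans _ _ (30 ^- 2 * (m%:R * eps ^+ 2) * 9^-1)).
    by move: m_large; lra.
  by rewrite ler_wpM2l // mulr_ge0 ?invr_ge0 // mulr_ge0 // sqr_ge0.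
have momA : Eq q smp (fun X => `|D X| ^+ 2) <= 9^-1 * m%:R * (eps / 20 * (2 * r1 * tv)) ^+ 2.
  apply: le_trans mom; rewrite le_eqVlt; apply/orP; left; apply/eqP.
  by apply: eq_avg => s _; rewrite real_normK ?num_real.
have momW : Eq q smp (fun X => W1 X ^+ 2) <= 9^-1 * m%:R * (eps / 20 * r1) ^+ 2.
  apply: le_trans (Eq_le2 (fun X => sqr_ge0 _)) _.
  have : Ep (fun X => W1 X ^+ 2) <= 1.
    rewrite -[leRHS]Ep_cst; apply: Ep_le => X; have /andP[? ?] := reweight01 X m0 mp.
    by rewrite exprn_ile1.
  have -> : 9^-1 * m%:R * (eps / 20 * r1) ^+ 2 = 60 ^- 2 * (m%:R * eps ^+ 2) * r1 ^+ 2 by field.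
  have : 60 ^- 2 * (m%:R * eps ^+ 2) * 9^-1 <= 60 ^- 2 * (m%:R * eps ^+ 2) * r1 ^+ 2.
    by rewrite ler_wpM2l // mulr_ge0 ?invr_ge0 // mulr_ge0 // sqr_ge0.
  by move: m_large2; lra.
have c9 : 0 <= 9^-1 :> R by rewrite invr_ge0.
have P1 := samples_chebyshev c9 mom.
have P2 := samples_chebyshev c9 momA.
have P3 := samples_chebyshev c9 momW.
set B1 := (X in avg _ X <= _) in P1; set B2 := (X in avg _ X <= _) in P2.
set B3 := (X in avg _ X <= _) in P3.
have := lerD P1 (lerD P2 P3); rewrite -!avgD.
set G := (X in _ <= avg _ X).
suff H : 1 <= avg (m * q) (fun s => G s + (B1 s + (B2 s + B3 s))).
  by move: H; rewrite !avgD; lra.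
rewrite -[leLHS](avg_cst (m * q)); apply: ler_avg => s _.
have dev (x y u : R) : 0 <= u -> ~~ ((m%:R * u) ^+ 2 < (x - y) ^+ 2)%R -> `|x - y| <= m%:R * u.
  move=> u0; rewrite -leNgt -[leLHS]real_normK ?num_real // ler_sqr ?nnegrE //.
  by rewrite mulr_ge0.
have z0 : 0 <= eps / 20 * (2 * r1 * tv).
  by apply: mulr_ge0; [lra|apply: mulr_ge0 => //; lra].
have z1 : 0 <= eps / 20 * r1 by apply: mulr_ge0; lra.
apply: union_bound3 => b1 b2 b3.
have {}b1 := dev _ _ _ z0 b1; have {}b2 := dev _ _ _ z0 b2; have {}b3 := dev _ _ _ z1 b3.
apply: estimate_accurate; first exact: size_samples.
- have := Eq_close W1; rewrite Ep_reweight -/r1.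
  have -> : Ep (fun X => `|W1 X|) = r1.
    rewrite /r1 -Ep_reweight; apply: eq_bigr => X _; have /andP[? _] := reweight01 X m0 mp.
    by rewrite ger0_norm.
  move=> c1; have := ler_wpM2l mp0 c1; rewrite -[X in X * `|_|]ger0_norm // -normrM => c2.
  have := le_trans (ler_normD _ _) (lerD b3 c2).
  by congr (`| _ | <= _); [ring|field].
- have := Eq_close D; rewrite Ep_contrast subr0 Ep_abs_contrast.
  move=> c1; have := ler_wpM2l mp0 c1; rewrite -[X in X * `|_|]ger0_norm // -normrM => c2.
  have := le_trans (ler_normD _ _) (lerD b1 c2).
  by congr (`| _ | <= _); [ring|field].
- have := Eq_close (fun X => `|D X|); rewrite Ep_abs_contrast.
  have -> : Ep (fun X => `| `|D X| |) = 2 * r1 * tv.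
    by rewrite -Ep_abs_contrast; apply: eq_bigr => X _; rewrite normr_id.
  move=> c1; have := ler_wpM2l mp0 c1; rewrite -[X in X * `|_|]ger0_norm // -normrM => c2.
  have := le_trans (ler_normD _ _) (lerD b2 c2).
  by congr (`| _ | <= _); [ring|field].
Qed.

End Estimator.
End Reweight.

(** * Partition functions of nearby fields, and a lower bound on the distance *)

Section Compare.
Variables (R : rcfType) (V : finType) (e : rel V).
Hypothesis esym : forall u v, e u v = e v u.
Hypothesis eirr : forall v, e v v = false.

Lemma eq_Zs (lam lam' : V -> R) (U : {set V}) : {in U, lam =1 lam'} ->
  Zs e lam U = Zs e lam' U.
Proof.
move=> E; apply: eq_bigr => X XU; rewrite /wt; case: ifP => // _.
by apply: eq_bigr => v vX; rewrite E // (subsetP XU).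
Qed.

(** By [Zs_rec] the partition function is affine in the field at [v], with slope the partition
    function off [cl v], which is at most the whole. *)
Lemma Zs_field_step (lam : V -> R) (v : V) (a : R) : (forall u, 0 <= lam u) -> lam v <= a ->
  Zs e (fun u => if u == v then a else lam u) setT <= (1 + (a - lam v)) * Zs e lam setT.
Proof.
move=> l0 la; rewrite !(Zs_rec esym eirr _ (in_setT v)) eqxx.
have E (U : {set V}) : v \notin U -> Zs e (fun u => if u == v then a else lam u) U = Zs e lam U.
  by move=> vU; apply: eq_Zs => u uU; case: eqP => // uv; rewrite -uv uU in vU.
rewrite !E ?inE ?eqxx //.
have h1 := Zs_ge1 e l0 (setT :\ v); have h2 := Zs_ge1 e l0 (setT :\: cl e v).
have h3 : Zs e lam (setT :\: cl e v) <= Zs e lam (setT :\ v).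
  by apply: Zs_le => //; apply: setDS; apply: subsetUl.
have da : 0 <= a - lam v by rewrite subr_ge0.
have := ler_wpM2l da h3.
have : 0 <= (a - lam v) * (lam v * Zs e lam (setT :\: cl e v)).
  by rewrite mulr_ge0 // mulr_ge0 // (le_trans ler01).
set z := Zs e lam _; set z' := Zs e lam _; lra.
Qed.

Lemma Zs_field_le (lam lam' : V -> R) (d : R) : (forall u, 0 <= lam u) ->
  (forall u, lam u <= lam' u <= lam u + d) ->
  Zs e lam' setT <= (1 + d) ^+ #|V| * Zs e lam setT.
Proof.
move=> l0 ll.
have d0 (v : V) : 0 <= d by have /andP[h1 h2] := ll v; move: h1 h2; lra.
pose g (s : seq V) u := if u \in s then lam' u else lam u.
have H s : uniq s -> Zs e (g s) setT <= (1 + d) ^+ size s * Zs e lam setT.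
  elim: s => [|v s IH] /=; first by rewrite expr0 mul1r (@eq_Zs _ lam).
  move=> /andP[vs us].
  have g0 u : 0 <= g s u.
    by rewrite /g; case: ifP => // _; have /andP[h _] := ll u; apply: le_trans h.
  have gv : g s v = lam v by rewrite /g (negbTE vs).
  have /andP[h1 h2] := ll v.
  have := @Zs_field_step (g s) v (lam' v) g0; rewrite gv => /(_ h1).
  rewrite (@eq_Zs _ (g (v :: s))); last first.
    by move=> u _; rewrite /g inE; case: eqP => [->|].
  move/le_trans; apply; rewrite exprS -mulrA; apply: ler_pM => //.
  - by rewrite addr_ge0 // subr_ge0.
  - exact/ltW/Zs_gt0.
  - by rewrite lerD2l lerBlDl.
  - exact: IH.
have := H (enum V) (enum_uniq _); rewrite -cardE; congr (_ <= _).
by apply: eq_Zs => u _; rewrite /g mem_enum.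
Qed.

Lemma Zs_field_le3 (lam lam' : V -> R) : (0 < #|V|)%N -> (forall u, 0 <= lam u) ->
  (forall u, lam u <= lam' u <= lam u + (2 * #|V|%:R)^-1) ->
  Zs e lam' setT <= 3 * Zs e lam setT.
Proof.
move=> V0 l0 ll; apply: le_trans (Zs_field_le l0 ll) _.
apply: ler_wpM2r; first exact/ltW/Zs_gt0.
have n1 : 1 <= #|V|%:R :> R by rewrite ler1n.
pose y : R := (2 * #|V|%:R)^-1.
have y01 : 0 <= y <= 1 by rewrite /y invr_ge0 invf_le1; lra.
have := pow1D_le #|V| y01.
have -> : #|V|%:R * y = 2^-1 :> R.
  by rewrite /y invfM mulrCA divff ?mulr1 // gt_eqF //; lra.
rewrite -/y; set p := (1 + y) ^+ _; lra.
Qed.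

Lemma Zs_remove_le (lam : V -> R) (L : R) (U A : {set V}) : (forall u, 0 <= lam u <= L) ->
  Zs e lam U <= (1 + L) ^+ #|A| * Zs e lam (U :\: A).
Proof.
move=> ll; have l0 u : 0 <= lam u by have /andP[] := ll u.
elim: {A}#|A| {-2}A (erefl #|A|) U => [|k IH] A cA U.
  by move/eqP: cA; rewrite cards_eq0 => /eqP ->; rewrite cards0 expr0 mul1r setD0.
have [v vA] : exists v, v \in A by apply/set0Pn; rewrite -card_gt0 cA.
have L0 : 0 <= L by have /andP[h1 h2] := ll v; apply: le_trans h2.
have cA' : #|A :\ v| = k by move: cA; rewrite (cardsD1 v A) vA add1n => -[].
have step : Zs e lam U <= (1 + L) * Zs e lam (U :\ v).
  have z0 := Zs_gt0 e l0 (U :\ v).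
  have [vU|vU] := boolP (v \in U); last first.
    have -> : U :\ v = U by apply/setDidPl; rewrite disjoint_sym disjoints1.
    rewrite ler_peMl ?lerDl //; exact/ltW/Zs_gt0.
  rewrite (Zs_rec esym eirr _ vU) mulrDl mul1r lerD2l.
  apply: ler_pM => //; first exact/ltW/Zs_gt0.
    by have /andP[] := ll v.
  by apply: Zs_le => //; apply: setDS; apply: subsetUl.
apply: le_trans step _; rewrite cA exprS -mulrA ler_wpM2l ?addr_ge0 //.
have := IH _ cA' (U :\ v); rewrite cA' setDDl.
by have -> : [set v] :|: A :\ v = A by rewrite setD1K.
Qed.

Lemma Zs_sum_in (lam : V -> R) (v : V) : (forall u, 0 <= lam u) ->
  \sum_(X : {set V} | v \in X) wt e lam X = lam v * Zs e lam (setT :\: cl e v).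
Proof.
move=> l0; have -> : \sum_(X : {set V} | v \in X) wt e lam X = up e lam (v |: set0).
  by apply: eq_bigl => X; rewrite !subUset !sub1set sub0set andbT.
rewrite (upU1 esym eirr l0) ?inE //.
have -> : up e lam set0 = Zs e lam setT by rewrite upE // free0 wt0 mul1r.
by rewrite free0 /Pr inE mulrC divfK // Zs_neq0.
Qed.

(** Two events suffice as tests: [v] occupied, and all of [cl v] vacant. The ratio of their
    probabilities is the field at [v], so if both nearly agree under the two models then so do the
    fields, provided the second event is not rare. Its probability is at least [(1 + L) ^- d.+1],
    since deleting a vertex loses at most a factor [1 + L]. *)
Lemma tv_lower (lamm laml : V -> R) (L : R) (d : nat) (v : V) :
  (forall u, 0 <= lamm u <= L) -> (forall u, 0 <= laml u <= L) ->
  (#|nbr e v| <= d)%N ->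
  `|lamm v - laml v| <= 2 * (1 + L) * (1 + L) ^+ d.+1 * tv e lamm laml.
Proof.
move=> lm ll dv.
have m0 u : 0 <= lamm u by have /andP[] := lm u.
have l0 u : 0 <= laml u by have /andP[] := ll u.
have L0 : 0 <= L by have /andP[h1 h2] := lm v; apply: le_trans h2.
have Z1 := Zs_gt0 e m0 setT; have Z2 := Zs_gt0 e l0 setT.
set Zm := Zs e lamm setT in Z1; set Zl := Zs e laml setT in Z2.
have ev (P : pred {set V}) :
    `|(\sum_(X | P X) wt e lamm X) / Zm - (\sum_(X | P X) wt e laml X) / Zl| <= 2 * tv e lamm laml.
  rewrite /tv mulVKf ?pnatr_eq0 // !mulr_suml -sumrB.
  apply: (le_trans (ler_norm_sum _ _ _)).
  by rewrite big_mkcond; apply: ler_sum => X _; case: ifP.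
have hA := ev (fun X => v \in X); rewrite !Zs_sum_in // in hA.
have hB := ev (fun X => X \subset setT :\: cl e v).
rewrite -/(Zs e lamm (setT :\: cl e v)) -/(Zs e laml (setT :\: cl e v)) in hB.
set am := Zs e lamm (setT :\: cl e v) in hA hB; set al := Zs e laml _ in hA hB.
have al0 : 0 < al by apply: Zs_gt0.
have t0 : 0 <= tv e lamm laml by apply: tv_ge0.
have key : `|lamm v - laml v| * (al / Zl) <= (1 + L) * (2 * tv e lamm laml).
  have -> : `|lamm v - laml v| * (al / Zl) = `|(lamm v - laml v) * (al / Zl)|.
    by rewrite normrM [`|al / Zl|]gtr0_norm // divr_gt0.
  have -> : (lamm v - laml v) * (al / Zl) =
     (lamm v * am / Zm - laml v * al / Zl) - lamm v * (am / Zm - al / Zl) by ring.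
  apply: (le_trans (ler_normB _ _)); rewrite mulrDl mul1r lerD // normrM.
  rewrite ger0_norm //; apply: ler_pM => //; by have /andP[] := lm v.
have low : Zl <= (1 + L) ^+ d.+1 * al.
  apply: le_trans (Zs_remove_le setT (cl e v) ll) _; apply: ler_wpM2r; first exact: ltW.
  rewrite ler_weXn2l ?lerDl // /cl.
  by rewrite cardsU1; case: (_ \notin _); rewrite ?add1n ?add0n ?ltnS // (leq_trans dv).
have low2 : ((1 + L) ^+ d.+1)^-1 <= al / Zl.
  rewrite ler_pdivlMr // mulrC ler_pdivrMr; first by rewrite mulrC.
  by rewrite exprn_gt0 // ltr_pwDl.
have P0 : 0 < (1 + L) ^+ d.+1 by rewrite exprn_gt0 // ltr_pwDl.
have := le_trans (ler_wpM2l (normr_ge0 _) low2) key.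
rewrite ler_pdivrMr //; move/le_trans; apply.
by rewrite le_eqVlt; apply/orP; left; apply/eqP; ring.
Qed.

End Compare.

(** * Size of the critical fugacity *)

Section LambdaC.
Variable R : realType.

Lemma pow_le_expR (x : R) n : 0 <= x -> (1 + x) ^+ n <= expR (n%:R * x).
Proof.
move=> x0; rewrite expRM_natl; apply: lerXn2r; rewrite ?nnegrE ?expR_ge0 ?addr_ge0 //.
exact: expR_ge1Dx.
Qed.

Lemma lambda_cE d : (2 <= d)%N ->
  lambda_c R d.+1 = (1 + (d%:R - 1)^-1) ^+ d / (d%:R - 1).
Proof.
case: d => [|[|d]] // _; rewrite /lambda_c /= -(natr1 d.+1) addrK.
have d0 : d.+1%:R != 0 :> R by rewrite pnatr_eq0.
rewrite [X in _ / X = _]exprS invfM mulrA mulrAC; congr (_ / _).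
by rewrite -expr_div_n; congr (_ ^+ _); rewrite mulrDl divff // mul1r.
Qed.

(** The upper bound makes degree times field bounded, so that all constants are independent of the
    degree. The lower bound ensures that [eta * lambda_c] leaves room for rounding of order
    [1 / n]. *)
Lemma lambda_c_bounds d : (2 <= d)%N ->
  d.+2%:R * lambda_c R d.+1 <= 4 * expR 2 /\ d%:R^-1 <= lambda_c R d.+1.
Proof.
move=> d2; rewrite lambda_cE //; have D2 : 2 <= d%:R :> R by rewrite ler_nat.
have -> : d.+2%:R = d%:R + 2 :> R by rewrite -addn2 natrD.
move: D2 (@pow_le_expR (d%:R - 1)^-1 d); set D : R := d%:R => D2 H.
have D1 : 0 < D - 1 by lra.
have i0 : 0 <= (D - 1)^-1 by rewrite invr_ge0 ltW.
split.
  have e2 : (1 + (D - 1)^-1) ^+ d <= expR 2.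
    apply: le_trans (H i0) _; rewrite ler_expR ler_pdivrMr //; lra.
  rewrite mulrCA mulrC; apply: ler_pM => //.
  - by rewrite divr_ge0 ?ltW //; lra.
  - by rewrite exprn_ge0 // addr_ge0.
  - by rewrite ler_pdivrMr //; lra.
apply: (@le_trans _ _ ((D - 1)^-1)).
  by rewrite lef_pV2 ?posrE //; lra.
by rewrite ler_peMl // exprn_ege1 // lerDl.
Qed.
End LambdaC.

Section Translate.
Variables (R : realType) (n : nat) (e : rel 'I_n).

Lemma sum_ffun_set (F : {set 'I_n} -> R) :
  \sum_(s : {ffun 'I_n -> bool}) F [set v | s v] = \sum_X F X.
Proof.
rewrite (reindex (fun s : {ffun 'I_n -> bool} => [set v | s v])) //=.
exists (fun X : {set 'I_n} => [ffun v => v \in X]) => s _.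
  by apply/ffunP => v; rewrite ffunE inE.
by apply/setP => v; rewrite inE ffunE.
Qed.

Lemma hc_weightE (lam : 'I_n -> R) (s : {ffun 'I_n -> bool}) :
  hc_weight e lam s = wt e lam [set v | s v].
Proof.
rewrite /hc_weight /wt; have -> : indep e s = stable e [set v | s v].
  apply/forallP/stableP => [H u v|H u].
    by rewrite !inE => su sv; have /forallP/(_ v)/implyP := H u; apply; rewrite su.
  apply/forallP => v; apply/implyP => /andP[su sv]; apply: H; by rewrite inE.
by case: ifP => // _; apply: eq_bigl => v; rewrite inE.
Qed.

Lemma hc_ZE (lam : 'I_n -> R) : hc_Z e lam = Zs e lam setT.
Proof.
rewrite /hc_Z ZsT -sum_ffun_set; apply: eq_bigr => s _; exact: hc_weightE.
Qed.

Lemma dTVE (lamm laml : 'I_n -> R) : dTV e lamm laml = tv e lamm laml.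
Proof.
rewrite /dTV /tv -sum_ffun_set; congr (_ * _); apply: eq_bigr => s _.
by rewrite /gibbs !hc_weightE !hc_ZE.
Qed.
End Translate.

(** * Mixing and accuracy of the sampler *)

Lemma mixing_exponent (n b l m : nat) : (0 < m)%N -> (0 < b)%N -> (n <= m)%N ->
  (n * 3 * b + 2 * (l + 5) <= 15 * (m * (b + l)))%N.
Proof.
move=> m0 b0 nm; have : (n * b <= m * (b + l))%N by apply: leq_mul => //; apply: leq_addr.
have : (1 * (b + l) <= m * (b + l))%N by apply: leq_mul.
by rewrite -mulnA [(3 * b)%N]mulnC mulnA; move: (m * _)%N (n * b)%N => x y; lia.
Qed.

Section Mixing.
Variables (R : realType) (eta : R).
Hypothesis eta01 : 0 < eta < 1.

(** [decay] is the sum of the geometric series of the contraction ratio; [gapc] is the Poincare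
    constant [expR C] for the resulting [C = 4 * expR 2 * decay]. *)
Definition decay : R := (1 - Num.sqrt (1 - eta / 2))^-1.
Definition gapc : R := expR (4 * expR 2 * decay).

Lemma decay_rho : 0 <= Num.sqrt (1 - eta / 2) < 1.
Proof.
rewrite sqrtr_ge0 /= -[ltRHS]sqrtr1 ltr_sqrt ?ltr01 //; move: eta01; lra.
Qed.

Lemma decay_ge0 : 0 <= decay.
Proof. by rewrite invr_ge0 subr_ge0 ltW //; have /andP[] := decay_rho. Qed.

Section Graph.
Variables (V : finType) (e : rel V) (d : nat) (lam : V -> R).
Hypothesis esym : forall u v, e u v = e v u.
Hypothesis eirr : forall v, e v v = false.
Hypothesis d2 : (2 <= d)%N.
Hypothesis degd : forall v, (#|nbr e v| <= d.+1)%N.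
Hypothesis lam_ge0 : forall v, 0 <= lam v.
Hypothesis lam_le : forall v, lam v <= (1 - eta) * lambda_c R d.+1.

Lemma lamc_ge0 : 0 <= lambda_c R d.+1.
Proof.
by have [_] := lambda_c_bounds R d2; apply: le_trans; rewrite invr_ge0 ler0n.
Qed.

Lemma infl_scaled (t : R) (W : {set V}) w : 0 < t <= 1 -> w \in W ->
  infl e (fun v => t * lam v) W w <= 1 + 4 * expR 2 * decay * t.
Proof.
move=> /andP[t0 t1] wW; pose L := (1 - eta) * lambda_c R d.+1.
have e1 : 0 <= 1 - eta by move: eta01; lra.
have L0 : 0 <= L by rewrite mulr_ge0 // lamc_ge0.
have tL : t * L <= L by rewrite ler_piMl.
have tl0 v : 0 <= t * lam v by rewrite mulr_ge0 // ltW.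
have tlL v : t * lam v <= t * L by rewrite ler_wpM2l ?lam_le // ltW.
apply: le_trans (infl_bound esym eirr tl0 tlL decay_rho _ degd wW) _.
  move=> h l szh h01 /andP[l0 lL].
  have lle : 0 <= l <= (1 - eta) * (d%:R ^+ d / d.-1%:R ^+ d.+1) by rewrite l0 (le_trans lL).
  exact: (contraction d2 eta01 szh h01 lle).
rewrite lerD2l -/decay.
have [K0 _] := lambda_c_bounds R d2.
have : d.+1%:R * L <= 4 * expR 2.
  apply: le_trans K0; apply: ler_pM => //; first by rewrite ler_nat.
  by rewrite /L ler_piMl ?lamc_ge0 //; move: eta01; lra.
move=> /(ler_wpM2r (mulr_ge0 (ltW t0) decay_ge0)) h.
rewrite [leLHS](_ : _ = d.+1%:R * L * (t * decay)); last by rewrite /decay; ring.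
apply: le_trans h _; rewrite le_eqVlt; apply/orP; left; apply/eqP; ring.
Qed.

Lemma hardcore_poincare (f : {set V} -> R) : Ew e lam f = 0 ->
  Ew e lam (fun X => f X ^+ 2) <= gapc * dirich e lam f.
Proof.
move=> f0; have C0 : 0 <= 4 * expR 2 * decay.
  by rewrite mulr_ge0 ?decay_ge0 // mulr_ge0 ?expR_ge0.
have := @poincare R V e esym eirr lam lam_ge0 f _ C0 infl_scaled.
by rewrite -/(Ew e lam f) f0 mul0r; under eq_bigr do rewrite subr0.
Qed.
End Graph.

Variables (n : nat) (e : rel 'I_n) (d B : nat) (k : 'I_n -> nat).
Hypothesis esym : forall u v, e u v = e v u.
Hypothesis eirr : forall v, e v v = false.
Hypothesis d2 : (2 <= d)%N.
Hypothesis degd : forall v, (#|nbr e v| <= d.+1)%N.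
Local Notation M := (2 ^ B)%N.
Hypothesis nM : (n <= M)%N.
Hypothesis kM : forall v, (0 < k v < M)%N.
Local Notation lam := (klam R B k).
Hypothesis lam_le : forall v, lam v <= (1 - eta) * lambda_c R d.+1.

Let lam_ge0 v : 0 <= lam v := ltW (klam_gt0 R kM v).
Let M_gt0 : 0 < M%:R :> R. Proof. by rewrite ltr0n expn_gt0. Qed.

Lemma wt_lower X : stable e X -> M%:R ^- n <= wt e lam X.
Proof.
move=> sX; rewrite /wt sX.
have M1 : 1 <= M%:R :> R by rewrite ler1n expn_gt0.
apply: (@le_trans _ _ (\prod_(v in X) M%:R^-1)).
  rewrite prodr_const exprVn lef_pV2 ?posrE ?exprn_gt0 //.
  by rewrite ler_weXn2l // -[leqRHS]card_ord max_card.
apply: ler_prod => v _; rewrite invr_ge0 ler0n /= /klam.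
have /andP[k0 k1] := kM v.
have h : 0 < (M - k v)%:R :> R by rewrite ltr0n subn_gt0.
rewrite ler_pdivlMr // mulrC ler_pdivrMr // -natrM ler_nat.
by apply: leq_trans (leq_subr _ _) _; rewrite leq_pmull.
Qed.

Lemma Zs_upper : Zs e lam setT <= M%:R ^+ n.
Proof.
have h v : 0 <= lam v <= M%:R - 1.
  rewrite lam_ge0 /= lerBrDl klam1 //; have /andP[k0 k1] := kM v.
  rewrite ler_pdivrMr ?ltr0n ?subn_gt0 // -natrM ler_nat.
  by rewrite leq_pmulr // subn_gt0.
have := Zs_remove_le esym eirr setT setT h.
rewrite cardsT card_ord addrC subrK setDv /Zs => /le_trans; apply.
by rewrite (eq_bigl (pred1 set0)) ?big_pred1_eq ?wt0 ?mulr1 // => X; rewrite subset0.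
Qed.

(** Stable configurations weigh at least [M ^- n] and the partition function is at most [M ^ n], so
    [gop_mixing] asks for decay below [(eps / 20) ^ 2 * M ^- (3 * n)]. The exponent reached after
    [t] steps is [M ^ 2 * (B + Lg) / c], at least [15 * M * (B + Lg)] as [15 * c <= M]. The demand
    is at most [3 * n * B + 2 * (Lg + 5)], because [2 <= expR 1] and [20 <= 2 ^ 5]. *)
Theorem glauber_close (Lg : nat) (eps : R) (t := (M ^ 3 * (B + Lg))%N) :
  (0 < B)%N -> 0 < eps -> 1 <= eps * (2 ^ Lg)%:R ->
  15 * (gapc * (1 + 4 * expR 2)) <= M%:R ->
  forall X, `|Eq (t * (B + B)) (walk B (gstep e k) t set0) (fun Y => (Y == X)%:R)
      - wt e lam X / Zs e lam setT| <= eps / 20 * (wt e lam X / Zs e lam setT).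
Proof.
move=> B0 eps0 epsL Mlarge X.
rewrite /Eq (avg_walk B (gstep e k) t (fun Y => (Y == X)%:R : R)) iter_wop_gop //.
set c := gapc * (1 + 4 * expR 2) in Mlarge.
have K0 : 0 <= 4 * expR 2 :> R by rewrite mulr_ge0 ?expR_ge0.
have g0 : 0 < gapc by apply: expR_gt0.
have g1 : 1 <= gapc by rewrite -[leLHS]expR0 ler_expR mulr_ge0 ?decay_ge0.
have c1 : 1 <= c by rewrite /c -[leLHS]mul1r ler_pM //; lra.
have M1 : 1 <= M%:R :> R by rewrite ler1n expn_gt0.
have lamK v : lam v <= 4 * expR 2.
  apply: (le_trans (lam_le v)); have [h1 _] := lambda_c_bounds R d2.
  apply: le_trans h1; apply: ler_pM; rewrite ?lamc_ge0 //; try by move: eta01; lra.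
  by apply: (@le_trans _ _ 1); [move: eta01; lra | rewrite ler1n].
apply: (@gop_mixing R _ e esym eirr lam lam_ge0 M _ _ (4 * expR 2) gapc) => //.
- by rewrite card_ord.
- by rewrite expn_gt0.
- by rewrite -/c -[leLHS]mul1r ler_pM.
- move=> f; exact: (@hardcore_poincare _ e d).
- by rewrite divr_ge0 // ltW.
case sX : (stable e X); last by right; rewrite /wt sX.
left; rewrite -/c.
have w0 := wt_lower sX; have z0 := Zs_upper.
have Zp : 0 < Zs e lam setT by apply: Zs_gt0.
have Mn : 0 < M%:R ^+ n :> R by rewrite exprn_gt0.
have cM : 0 < c * M%:R by rewrite mulr_gt0 //; lra.
have gam0 : 0 <= 1 - (c * M%:R)^-1.
  rewrite subr_ge0 invf_le1 // -[leLHS]mul1r ler_pM //.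
apply: (@le_trans _ _ ((1 - (c * M%:R)^-1) ^+ t * (M%:R ^+ n) ^+ 2)).
  apply: ler_wpM2l; first exact: exprn_ge0.
  by rewrite ler_sqr ?nnegrE // ltW.
apply: (@le_trans _ _ ((eps / 20) ^+ 2 * M%:R ^- n)); last first.
  by apply: ler_wpM2l w0; apply: sqr_ge0.
rewrite ler_pdivlMr // -mulrA -exprSr.
have two j : (2 ^ j)%:R <= expR j%:R :> R.
  rewrite -[j%:R]mulr1 expRM_natl natrX lerXn2r ?nnegrE ?expR_ge0 //.
  by apply: le_trans (expR_ge1Dx 1); rewrite (_ : 2 = 1 + 1).
have e20 : expR (- (Lg + 5)%:R) <= eps / 20.
  rewrite expRN ler_pdivlMr // mulrC ler_pdivrMr ?expR_gt0 //.
  apply: (@le_trans _ _ (eps * (2 ^ (Lg + 5))%:R)); last first.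
    by rewrite ler_wpM2l ?two // ltW.
  rewrite expnD natrM mulrA -[leLHS]mul1r; apply: ler_pM => //.
  by rewrite ler_nat.
have e40 : expR (- (2 * (Lg + 5)%:R)) <= (eps / 20) ^+ 2.
  rewrite -mulrN expRM_natl lerXn2r ?nnegrE ?expR_ge0 //.
  by rewrite divr_ge0 // ltW.
apply: le_trans e40.
have gle : (1 - (c * M%:R)^-1) ^+ t <= expR (- (t%:R * (c * M%:R)^-1)).
  by rewrite -mulrN expRM_natl lerXn2r ?nnegrE ?expR_ge0 // expR_ge1Dx.
have mle : (M%:R ^+ n) ^+ 3 <= expR ((n * 3)%:R * B%:R) :> R.
  by rewrite -exprM expRM_natl lerXn2r ?nnegrE ?expR_ge0 // ltW.
apply: le_trans (ler_pM (exprn_ge0 _ gam0) _ gle mle) _.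
  by rewrite exprn_ge0 // ltW.
rewrite -expRD ler_expR.
have tE : t%:R * (c * M%:R)^-1 = M%:R ^+ 2 * (B + Lg)%:R / c.
  rewrite /t natrM natrX; move: M_gt0 c1; move: M%:R => m m0 c1.
  by field; rewrite !gt_eqF //; lra.
have H1 : 15 * (M%:R * (B + Lg)%:R) <= M%:R ^+ 2 * (B + Lg)%:R / c.
  rewrite ler_pdivlMr; last by lra.
  have h0 : 0 <= M%:R * (B + Lg)%:R :> R by rewrite mulr_ge0 ?ler0n.
  have := ler_wpM2l h0 Mlarge; move: (M%:R : R) ((B + Lg)%:R : R) => m h; lra.
have H2 : (n * 3)%:R * B%:R + 2 * (Lg + 5)%:R <= 15 * (M%:R * (B + Lg)%:R) :> R.
  rewrite -!natrM -natrD ler_nat.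
  by apply: mixing_exponent => //; rewrite expn_gt0.
rewrite tE; lra.
Qed.
End Mixing.

(** * Rounding the field and fixing the constants *)

Section Algorithm.
Variable R : realType.

(* [k] is the least positive integer with [lam < k / (M - k)]; accepting with
   probability [k / M] is the heat bath of fugacity [k / (M - k)]. *)
Definition kspec (lam : R) (M k : nat) : Prop :=
  [/\ (0 < k)%N, lam * (M%:R - k%:R) < k%:R & k%:R - 1 <= lam * (M%:R - k%:R + 1)].

Lemma kspec_lt (lam K : R) M k : 0 <= lam <= K -> 2 * (1 + K) <= M%:R ->
  kspec lam M k -> (k < M)%N.
Proof.
move=> /andP[l0 lK] MK [k0 _ h]; rewrite ltnNge; apply/negP => Mk.
have Mk' : M%:R <= k%:R :> R by rewrite ler_nat.
have : lam * (M%:R - k%:R + 1) <= lam * 1 by rewrite ler_wpM2l //; lra.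
lra.
Qed.

(** Minimality of [k] bounds the numerator of the overshoot by [1 + lam], while its denominator
    [M - k] is at least [M / (2 * (1 + K))]; hence the rounding error is of order [1 / M]. *)
Lemma kspec_klam (lam K : R) B k : 0 <= lam <= K -> 2 * (1 + K) <= (2 ^ B)%:R ->
  kspec lam (2 ^ B) k ->
  lam <= k%:R / (2 ^ B - k)%:R <= lam + 2 * (1 + K) ^+ 2 / (2 ^ B)%:R.
Proof.
move=> lK MK ks; have kM := kspec_lt lK MK ks; case: ks => k0 h1 h2.
have /andP[l0 l1] := lK; rewrite natrB ?(ltnW kM) //.
have : k%:R < (2 ^ B)%:R :> R by rewrite ltr_nat.
move: h1 h2 MK; move: ((2 ^ B)%:R : R) (k%:R : R) => M x h1 h2 MK xM.
have Mx : 0 < M - x by rewrite subr_gt0.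
have M0 : 0 < M by lra.
apply/andP; split; first by rewrite ler_pdivlMr // ltW.
rewrite ler_pdivrMr // mulrDl; set c := 2 * (1 + K) ^+ 2 / M.
have h3 : x - lam * (M - x) <= 1 + lam by lra.
have h4 : M <= 2 * (1 + K) * (M - x).
  have h5 : (x - 1) * (1 + lam) <= lam * M by lra.
  have h6 : M <= (1 + lam) * (M - x + 1) by lra.
  have h7 : (1 + lam) * (M - x + 1) <= (1 + K) * (M - x + 1).
    by rewrite ler_wpM2r //; lra.
  by lra.
suff : 1 + lam <= c * (M - x) by lra.
rewrite /c mulrAC ler_pdivlMr //.
apply: (@le_trans _ _ ((1 + K) * (2 * (1 + K) * (M - x)))).
  by apply: ler_pM; lra.
by rewrite expr2 le_eqVlt; apply/orP; left; apply/eqP; ring.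
Qed.

Variable eta : R.
Hypothesis eta01 : 0 < eta < 1.
(** [K0] bounds the critical fugacity, even times the degree plus one; [C0] is then the constant of
    [tv_lower], and [c2 / M] the rounding error from [kspec_klam]. *)
Let K0 : R := 4 * expR 2.
Let C0 : R := 2 * (1 + K0) * expR K0.
Let c2 : R := 2 * (1 + K0) ^+ 2.

Section Instance.
Variables (n : nat) (e : rel 'I_n) (lamm laml : 'I_n -> R) (eps : R).
Variables (A : R) (B Lg : nat) (k : 'I_n -> nat).
Hypothesis sg : simple_graph e.
Hypothesis D3 : (3 <= max_degree e)%N.
Hypothesis eps0 : 0 < eps.
Hypothesis eps1 : eps < 1.
Hypothesis m0 : forall v, 0 <= lamm v.
Hypothesis l0 : forall v, 0 <= laml v.
Hypothesis um : uniqueness e eta lamm.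
Hypothesis ul : uniqueness e eta laml.
Hypothesis dp : forall v, `|lamm v - laml v| <= (4 * n%:R)^-1.
Hypothesis epsL : 1 <= eps * (2 ^ Lg)%:R.
Hypothesis ks : forall v, kspec (Num.max (lamm v) (laml v)) (2 ^ B) (k v).
Local Notation M := (2 ^ B)%N.
Hypothesis AnM : A * n%:R <= M%:R.
(** The demands on the constant in [M >= A * n]: [A1] gives mixing, [A2] keeps the rounded field in
    the uniqueness regime for [eta / 2], [A3] makes the rounding at most [1 / (4 * n)], and [A4] and
    [A5] make the number of samples sufficient. *)
Hypothesis A1 : 15 * (gapc (eta / 2) * (1 + 4 * expR 2)) <= A.
Hypothesis A2 : 2 * c2 / eta <= A.
Hypothesis A3 : 4 * c2 <= A.
Hypothesis A4 : 90 ^+ 2 * 80 * C0 ^+ 2 <= A.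
Hypothesis A5 : 180 * 2 <= A.

Let lam v := Num.max (lamm v) (laml v).
Let d := (max_degree e).-1.

Lemma max_degE : max_degree e = d.+1.
Proof. by rewrite /d prednK // (leq_trans _ D3). Qed.

Lemma deg_le_n : (d.+1 <= n)%N.
Proof.
rewrite -max_degE; apply/bigmax_leqP => v _; rewrite /degree.
by rewrite -[leqRHS]card_ord max_card.
Qed.

Lemma nbr_le v : (#|nbr e v| <= d.+1)%N.
Proof. by rewrite -max_degE /max_degree (leq_bigmax v). Qed.

Let d2 : (2 <= d)%N. Proof. by rewrite -ltnS -max_degE. Qed.
Let K0_ge0 : 0 <= K0. Proof. by rewrite mulr_ge0 ?expR_ge0. Qed.
Let n_gt0 : 0 < n%:R :> R. Proof. by rewrite ltr0n (leq_trans _ deg_le_n). Qed.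

Lemma lc_K0 : lambda_c R d.+1 <= K0.
Proof.
have [h _] := lambda_c_bounds R d2; apply: le_trans h.
by rewrite ler_peMl ?ler1n // lamc_ge0.
Qed.

Lemma lam_bounds v : 0 <= lam v <= (1 - eta) * lambda_c R d.+1.
Proof.
rewrite /lam le_max m0 /= ge_max -max_degE.
by rewrite um ul.
Qed.

Lemma lam_K0 v : 0 <= lam v <= K0.
Proof.
have /andP[-> h] := lam_bounds v; apply: (le_trans h); apply: le_trans lc_K0.
by rewrite ler_piMl ?lamc_ge0 //; move: eta01; lra.
Qed.

Let n1 : 1 <= n%:R :> R. Proof. by rewrite ler1n -(ltr0n R). Qed.
Let A0 : 0 < A. Proof. by apply: lt_le_trans A5; rewrite mulr_gt0. Qed.

Lemma A_le_M : A <= M%:R.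
Proof. by apply: le_trans AnM; rewrite ler_peMr // ltW. Qed.

Let c2_ge0 : 0 <= c2. Proof. by rewrite mulr_ge0 // sqr_ge0. Qed.

Lemma M_K0 : 2 * (1 + K0) <= M%:R.
Proof.
apply: le_trans A_le_M; apply: le_trans A3; rewrite /c2.
have h : 1 + K0 <= (1 + K0) ^+ 2 by rewrite expr2 ler_peMr //; move: K0_ge0; lra.
have := sqr_ge0 (1 + K0); lra.
Qed.

Let M_gt0 : 0 < M%:R :> R. Proof. by rewrite ltr0n expn_gt0. Qed.

Lemma kM v : (0 < k v < M)%N.
Proof. by have ksv := ks v; rewrite (kspec_lt (lam_K0 v) M_K0 ksv) andbT; case: ksv. Qed.

Lemma klam_bounds v : lam v <= klam R B k v <= lam v + c2 / M%:R.
Proof. exact: (kspec_klam (lam_K0 v) M_K0 (ks v)). Qed.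

Lemma c2M (a : R) : 0 < a -> c2 * a <= A -> c2 / M%:R <= (a * n%:R)^-1.
Proof.
move=> a0 h; rewrite ler_pdivrMr // ler_pdivlMl ?mulr_gt0 //.
apply: le_trans AnM; rewrite mulrAC [a * _]mulrC ler_wpM2r // ltW //.
Qed.

(** Half of the slack [eta] pays for the rounding: [c2 / M <= eta / (2 * n)], and
    [1 / n <= lambda_c]. *)
Lemma klam_unique v : klam R B k v <= (1 - eta / 2) * lambda_c R d.+1.
Proof.
have /andP[_ h] := klam_bounds v; apply: le_trans h _.
have /andP[_ h] := lam_bounds v.
have e0 : 0 < eta by have /andP[] := eta01.
have a0 : 0 < 2 / eta by rewrite divr_gt0.
have h2 : c2 / M%:R <= (2 / eta * n%:R)^-1.
  by apply: c2M => //; apply: le_trans A2; rewrite mulrA [c2 * 2]mulrC.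
have [_ h3] := lambda_c_bounds R d2.
have h4 : (n%:R)^-1 <= lambda_c R d.+1.
  have d0 : 0 < d%:R :> R by rewrite ltr0n (leq_trans _ d2).
  apply: le_trans h3; rewrite lef_pV2 ?posrE ?n_gt0 // ler_nat.
  exact: ltnW deg_le_n.
have := ler_wpM2l (ltW e0) h4; move: h2; rewrite invfM invf_div; lra.
Qed.

(** [1 / (4 * n)] from the distance of the two fields plus [1 / (4 * n)] from rounding gives the
    [1 / (2 * n)] that [Zs_field_le3] admits. *)
Lemma lam_close (lam' : 'I_n -> R) v : (forall v, lam' v <= lam v) ->
  lam v - lam' v <= (4 * n%:R)^-1 ->
  lam' v <= klam R B k v <= lam' v + (2 * #|'I_n|%:R)^-1.
Proof.
move=> h1 h2; rewrite card_ord; have /andP[h3 h4] := klam_bounds v.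
rewrite (le_trans (h1 v) h3) /=.
have h5 : c2 / M%:R <= (4 * n%:R)^-1 by apply: c2M => //; rewrite mulrC.
have -> : (2 * n%:R)^-1 = (4 * n%:R)^-1 + (4 * n%:R)^-1 :> R.
  by field; rewrite gt_eqF.
by move: h1 => _; lra.
Qed.

Let t := (M ^ 3 * (B + Lg))%N.
Let smp := walk B (gstep e k) t set0.

Theorem estimator_accurate (m := (M * M * (2 ^ Lg) * (2 ^ Lg))%N) (q := (t * (B + B))%N) :
  (0 < B)%N ->
  2 / 3 <= @avg R (m * q) (fun s =>
    let x := estimate lamm laml (klam R B k) (samples q smp m s) in
    (((1 - eps) * dTV e lamm laml <= x)%R && (x <= (1 + eps) * dTV e lamm laml)%R)%:R).
Proof.
move=> B0; rewrite dTVE.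
have [esym eirr] := sg.
have mlam v : lamm v <= lam v by rewrite /lam le_max lexx.
have llam v : laml v <= lam v by rewrite /lam le_max lexx orbT.
have cm v : lam v - lamm v <= (4 * n%:R)^-1.
  apply: le_trans (dp v); rewrite /lam; case: (leP (lamm v) (laml v)) => h.
    by rewrite distrC ger0_norm // subr_ge0.
  by rewrite subrr.
have cl v : lam v - laml v <= (4 * n%:R)^-1.
  apply: le_trans (dp v); rewrite /lam; case: (leP (lamm v) (laml v)) => h.
    by rewrite subrr.
  by rewrite ger0_norm // subr_ge0 ltW.
have n0 : (0 < #|'I_n|)%N by rewrite card_ord -(ltr0n R).
have Lu (lam' : 'I_n -> R) : uniqueness e eta lam' -> (forall v, 0 <= lam' v) ->
    forall v, 0 <= lam' v <= lambda_c R d.+1.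
  move=> u h0 v; rewrite h0 /=; apply: (le_trans (u v)); rewrite max_degE.
  by rewrite ler_piMl ?lamc_ge0 //; move: eta01; lra.
(* Since [eps * E >= 1], the factor [E ^ 2] in [m] absorbs [eps ^ 2]. The remaining [M ^ 2] beats
   [A * n * M], where one [M] is the bound on the inverse field. *)
have Mp2 : M%:R * M%:R <= m%:R * eps ^+ 2.
  rewrite /m !natrM; have eL := epsL; set E := (2 ^ Lg)%:R in eL *.
  have -> : M%:R * M%:R * E * E * eps ^+ 2 = (M%:R * M%:R) * (eps * E) ^+ 2 :> R by ring.
  by rewrite ler_peMr ?mulr_ge0 ?ler0n // exprn_ege1.
apply: (@estimate_prob R _ e esym eirr lamm laml (klam R B k) m0 l0 _ _ _ C0 M%:R) => //.
- by move=> v; apply: klam_gt0; apply: kM.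
- by move=> v; have /andP[] := lam_close mlam (cm v).
- by move=> v; have /andP[] := lam_close llam (cl v).
- move=> v; apply: le_trans (tv_lower esym eirr (Lu _ um m0) (Lu _ ul l0) (nbr_le v)) _.
  apply: ler_wpM2r; first exact: tv_ge0.
  have lc0 := lamc_ge0 R d2; have lcK := lc_K0.
  apply: ler_pM; rewrite ?exprn_ge0 ?mulr_ge0 ?addr_ge0 //.
    by rewrite ler_wpM2l // lerD2l.
  apply: le_trans (pow_le_expR _ lc0) _; rewrite ler_expR.
  by have [] := lambda_c_bounds R d2.
- by rewrite !mulr_ge0 ?expR_ge0 ?addr_ge0.
- by apply: Zs_field_le3 => // v; apply: lam_close.
- by apply: Zs_field_le3 => // v; apply: lam_close.
- move=> v; rewrite /klam invf_div; have /andP[k0 k1] := kM v.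
  rewrite ler_pdivrMr ?ltr0n // -natrM ler_nat.
  by apply: leq_trans (leq_subr _ _) _; rewrite leq_pmulr.
- rewrite card_ord; apply: le_trans AnM; rewrite ler_peMl ?(ltW n_gt0) //.
  by apply: le_trans A5; lra.
- by rewrite eps0.
- move=> X; apply: (@glauber_close R (eta / 2) _ n e d B k esym eirr d2 nbr_le) => //.
  + by move: eta01; lra.
  + rewrite -(ler_nat R); apply: le_trans AnM; rewrite ler_peMl ?(ltW n_gt0) //.
    by apply: le_trans A5; lra.
  + exact: kM.
  + exact: klam_unique.
  + exact: le_trans A_le_M.
- rewrite card_ord ler_pdivlMr ?exprn_gt0 //; apply: le_trans Mp2.
  apply: (@le_trans _ _ (A * n%:R * M%:R)); last by rewrite ler_wpM2r // ltW.
  rewrite (_ : _ * 90 ^+ 2 = 90 ^+ 2 * 80 * C0 ^+ 2 * (n%:R * M%:R)); last by ring.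
  rewrite -[leRHS]mulrA; apply: ler_wpM2r A4; exact: (mulr_ge0 (ltW n_gt0) (ltW M_gt0)).
- rewrite ler_pdivlMr ?exprn_gt0 //; apply: le_trans Mp2.
  have h : 180 * 2 <= M%:R :> R by apply: le_trans A5 A_le_M.
  apply: (@le_trans _ _ ((180 * 2) * (180 * 2))); last by apply: ler_pM => //; rewrite mulr_ge0.
  by rewrite expr2; lra.
Qed.
End Instance.

Theorem estimator_exists : exists b0 : nat, (0 < b0)%N /\
  forall (n : nat) (e : rel 'I_n) (lamm laml : 'I_n -> R) (eps : R) (y Lg : nat) (k : 'I_n -> nat),
    simple_graph e -> (3 <= max_degree e)%N -> 0 < eps -> eps < 1 ->
    (forall v, 0 <= lamm v) -> (forall v, 0 <= laml v) ->
    uniqueness e eta lamm -> uniqueness e eta laml ->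
    (forall v, `|lamm v - laml v| <= (4 * n%:R)^-1) ->
    (n <= 2 ^ y)%N -> 1 <= eps * (2 ^ Lg)%:R ->
    let B := (b0 + y)%N in let M := (2 ^ B)%N in
    (forall v, kspec (Num.max (lamm v) (laml v)) M (k v)) ->
    forall t m q : nat, t = (M ^ 3 * (B + Lg))%N ->
    m = (M * M * (2 ^ Lg) * (2 ^ Lg))%N -> q = (t * (B + B))%N ->
    2 / 3 <= @avg R (m * q) (fun s =>
      let x := estimate lamm laml (klam R B k)
        (samples q (walk B (gstep e k) t set0) m s) in
      (((1 - eps) * dTV e lamm laml <= x)%R && (x <= (1 + eps) * dTV e lamm laml)%R)%:R).
Proof.
(* A sum of nonnegative demands dominates each of them. Only [eta] enters, so the exponent [b0] can
   be a constant of the program. *)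
pose A : R := 1 + (15 * (gapc (eta / 2) * (1 + 4 * expR 2)) + (2 * c2 / eta + (4 * c2
   + (90 ^+ 2 * 80 * C0 ^+ 2 + 180 * 2)))).
have [b0 b0A] : exists b0 : nat, A <= (2 ^ b0)%:R.
  have [j jA] : exists j : nat, A <= j%:R.
    by exists (Num.bound `|A|); apply: le_trans (ler_norm _) (ltW (archi_boundP (normr_ge0 A))).
  by exists j; apply: le_trans jA _; rewrite ler_nat ltnW // ltn_expl.
exists b0.+1; split => // n e lamm laml eps y Lg k sg D3 e0 e1 m0 l0 um ul dp ny epsL B M ks t m q -> -> ->.
have K0_ge0 : 0 <= K0 by rewrite mulr_ge0 ?expR_ge0.
have c2_ge0 : 0 <= c2 by rewrite mulr_ge0 // sqr_ge0.
have p1 : 0 <= 15 * (gapc (eta / 2) * (1 + 4 * expR 2)).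
  by rewrite mulr_ge0 // mulr_ge0 ?expR_ge0 // addr_ge0.
have p2 : 0 <= 2 * c2 / eta by rewrite divr_ge0 ?mulr_ge0 //; move: eta01; lra.
have p3 : 0 <= 90 ^+ 2 * 80 * C0 ^+ 2 by apply: mulr_ge0 (sqr_ge0 _); rewrite mulr_ge0 ?sqr_ge0.
have p4 : 0 <= 4 * c2 by rewrite mulr_ge0.
apply: (@estimator_accurate n e lamm laml eps A) => //.
- rewrite /B addSn expnS expnD !natrM.
  have h : A * n%:R <= (2 ^ b0)%:R * (2 ^ y)%:R by apply: ler_pM; rewrite ?ler_nat // /A; lra.
  by apply: le_trans h _; rewrite ler_peMl ?mulr_ge0 ?ler0n //; lra.
- by rewrite /A; lra.
- by rewrite /A; lra.
- by rewrite /A; lra.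
- by rewrite /A; lra.
- by rewrite /A; lra.
Qed.
End Algorithm.

(** * Structured programs and their compilation *)

Inductive test : Type := TLeN (a b : nat) | TLtR (a b : nat).
Inductive cmd : Type :=
| Block (l : seq instr)
| Seq (c1 c2 : cmd)
| If (t : test) (c1 c2 : cmd)
| Until (t : test) (c : cmd).

Definition straight (i : instr) : bool :=
  match i with JLeN _ _ _ | JLtR _ _ _ | Jmp _ | Halt => false | _ => true end.
Fixpoint wf (c : cmd) : bool :=
  match c with
  | Block l => all straight l
  | Seq c1 c2 | If _ c1 c2 => wf c1 && wf c2
  | Until _ c => wf c
  end.

Fixpoint csize (c : cmd) : nat :=
  match c with
  | Block l => size l
  | Seq c1 c2 => csize c1 + csize c2
  | If _ c1 c2 => (csize c2 + csize c1).+2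
  | Until _ c => (csize c).+2
  end.

Definition jump (t : test) (p : nat) : instr :=
  match t with TLeN a b => JLeN a b p | TLtR a b => JLtR a b p end.

(** Jumps are taken when the test holds, so the alternative comes first and the main branch is the
    jump target. [Until] leaves the loop on a true test. *)
Fixpoint compile (p : nat) (c : cmd) : seq instr :=
  match c with
  | Block l => l
  | Seq c1 c2 => compile p c1 ++ compile (p + csize c1) c2
  | If t c1 c2 =>
      jump t (p + (csize c2).+2)
      :: compile p.+1 c2 ++ Jmp (p + csize c)
      :: compile (p + (csize c2).+2) c1
  | Until t c1 => jump t (p + csize c) :: rcons (compile p.+1 c1) (Jmp p)
  end.

Lemma size_compile p c : size (compile p c) = csize c.
Proof.
elim: c p => [l|c1 H1 c2 H2|t c1 H1 c2 H2|t c1 H1] p //=.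
- by rewrite size_cat H1 H2.
- by rewrite size_cat /= H1 H2 addnS.
- by rewrite size_rcons H1.
Qed.

Section Semantics.
Variables (R : realType) (bits : nat -> bool).
Local Notation mst := (mstate R).

Definition at_pc (p : nat) (s : mst) : mst := MState p (nreg s) (rreg s) (used s).

(** The effect of an instruction is read off the machine's own [step] on a one-instruction program,
    so no second semantics has to be matched with it. *)
Definition sem (i : instr) (s : mst) : mst := step [:: i] bits (at_pc 0 s).
Definition sems (l : seq instr) (s : mst) : mst := foldl (fun s i => sem i s) s l.

Definition holds (t : test) (s : mst) : bool :=
  match t with
  | TLeN a b => (nreg s a <= nreg s b)%N
  | TLtR a b => rreg s a < rreg s b
  end.

(** The counter is the exact number of machine steps, jumps included: a false test in [If] or
    [Until] costs the test and one unconditional jump. *)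
Inductive exec : cmd -> mst -> nat -> mst -> Prop :=
| EBlock l s : exec (Block l) s (size l) (sems l s)
| ESeq c1 c2 s k1 s1 k2 s2 : exec c1 s k1 s1 -> exec c2 s1 k2 s2 ->
    exec (Seq c1 c2) s (k1 + k2) s2
| EIfT t c1 c2 s k s' : holds t s -> exec c1 s k s' -> exec (If t c1 c2) s k.+1 s'
| EIfF t c1 c2 s k s' : ~~ holds t s -> exec c2 s k s' -> exec (If t c1 c2) s k.+2 s'
| EUntilT t c s : holds t s -> exec (Until t c) s 1 s
| EUntilF t c s k s1 k' s' : ~~ holds t s -> exec c s k s1 ->
    exec (Until t c) s1 k' s' -> exec (Until t c) s (k + k').+2 s'.

Variable prog : seq instr.

Definition placed (p : nat) (l : seq instr) : Prop :=
  forall i, (i < size l)%N -> nth Halt prog (p + i) = nth Halt l i.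

Lemma placed_cat p l1 l2 : placed p (l1 ++ l2) -> placed p l1 /\ placed (p + size l1) l2.
Proof.
move=> H; split=> i il.
  by rewrite H ?nth_cat ?il // size_cat (leq_trans il) // leq_addr.
rewrite -addnA H; last by rewrite size_cat ltn_add2l.
by rewrite nth_cat ltnNge leq_addr /= addKn.
Qed.

Lemma placed_cons p i l : placed p (i :: l) -> nth Halt prog p = i /\ placed p.+1 l.
Proof.
move=> H; split; first by have := H 0%N isT; rewrite addn0.
by move=> j jl; have := H j.+1 jl; rewrite addnS addSn.
Qed.

Lemma run_step f (s : mst) : ~~ halted prog s -> run prog bits f.+1 s = run prog bits f (step prog bits s).
Proof. by move=> /negbTE /= ->. Qed.

Lemma step_straight p i (s : mst) : straight i -> nth Halt prog p = i ->
  ~~ halted prog (at_pc p s) /\ step prog bits (at_pc p s) = at_pc p.+1 (sem i s).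
Proof. by move=> si E; rewrite /halted /sem /step /= E; case: i si {E}. Qed.

Lemma run_block l p (s : mst) f : all straight l -> placed p l ->
  run prog bits (size l + f) (at_pc p s) = run prog bits f (at_pc (p + size l) (sems l s)).
Proof.
elim: l p s => [|i l IH] p s; first by rewrite addn0.
move=> /andP[si sl] /placed_cons[pi pl].
have [h1 h2] := step_straight s si pi.
by rewrite [size _]/= addSn run_step // h2 IH // addSnnS.
Qed.

Lemma step_jump t p q (s : mst) : nth Halt prog p = jump t q ->
  ~~ halted prog (at_pc p s) /\
  step prog bits (at_pc p s) = at_pc (if holds t s then q else p.+1) s.
Proof. by case: t => a b E; rewrite /halted /step /= E /=; split => //; case: ifP. Qed.

Lemma step_Jmp p q (s : mst) : nth Halt prog p = Jmp q ->
  ~~ halted prog (at_pc p s) /\ step prog bits (at_pc p s) = at_pc q s.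
Proof. by move=> E; rewrite /halted /step /= E. Qed.

Lemma run_exec c s k s' : exec c s k s' -> wf c -> forall p f, placed p (compile p c) ->
  run prog bits (k + f) (at_pc p s) = run prog bits f (at_pc (p + csize c) s').
Proof.
elim=> {c s k s'}.
- by move=> l s wl p f; apply: run_block.
- move=> c1 c2 s k1 s1 k2 s2 _ IH1 _ IH2 /andP[w1 w2] p f.
  move/placed_cat; rewrite size_compile => -[p1 p2].
  by rewrite -addnA IH1 // IH2 // addnA.
- move=> t c1 c2 s k s' ht _ IH /andP[w1 w2] p f.
  case/placed_cons => pj; move/placed_cat; rewrite size_compile => -[_ /placed_cons[_ pp]].
  have [h1 h2] := step_jump s pj.
  rewrite addSn run_step // h2 ht IH //; last first.
    by move: pp; rewrite (_ : (p.+1 + csize c2).+1 = (p + (csize c2).+2)%N) //; lia.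
  by congr (run _ _ _ (at_pc _ _)); rewrite /=; lia.
- move=> t c1 c2 s k s' ht _ IH /andP[w1 w2] p f.
  case/placed_cons => pj; move/placed_cat; rewrite size_compile => -[pp /placed_cons[pj2 _]].
  have [h1 h2] := step_jump s pj.
  rewrite !addSn run_step // h2 (negbTE ht) -addnS IH //.
  have [h3 h4] := step_Jmp s' pj2.
  by rewrite run_step // h4.
- move=> t c s ht w p f /placed_cons[pj _].
  by have [h1 h2] := step_jump s pj; rewrite add1n run_step // h2 ht.
- move=> t c s k s1 k' s' ht _ IH1 _ IH2 w p f pl; have := pl.
  case/placed_cons => pj; rewrite -cats1; move/placed_cat; rewrite size_compile.
  move=> [pp /placed_cons[pj2 _]].
  have [h1 h2] := step_jump s pj.
  rewrite !addSn run_step // h2 (negbTE ht) -addnA -addnS IH1 //.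
  have [h3 h4] := step_Jmp s1 pj2.
  by rewrite run_step // h4 IH2.
Qed.

(** Total correctness with a time bound, in the style of a weakest precondition, so that
    specifications chain in continuation form. *)
Definition tot (c : cmd) (s : mst) (K : nat) (Q : mst -> Prop) : Prop :=
  exists k s', [/\ exec c s k s', (k <= K)%N & Q s'].

Lemma tot_conseq c s K K' (Q Q' : mst -> Prop) :
  tot c s K Q -> (K <= K')%N -> (forall s, Q s -> Q' s) -> tot c s K' Q'.
Proof.
by move=> [k [s' [h1 h2 h3]]] KK QQ; exists k, s'; split; auto; apply: leq_trans KK.
Qed.

Lemma tot_block l s (Q : mst -> Prop) : Q (sems l s) -> tot (Block l) s (size l) Q.
Proof. by move=> q; exists (size l), (sems l s); split => //; apply: EBlock. Qed.

Lemma tot_seq c1 c2 s K1 K2 (Q : mst -> Prop) :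
  tot c1 s K1 (fun s1 => tot c2 s1 K2 Q) -> tot (Seq c1 c2) s (K1 + K2) Q.
Proof.
move=> [k1 [s1 [e1 h1 [k2 [s2 [e2 h2 q]]]]]].
by exists (k1 + k2)%N, s2; split => //; [apply: ESeq e1 e2|apply: leq_add].
Qed.

Lemma tot_if t c1 c2 s K (Q : mst -> Prop) :
  (holds t s -> tot c1 s K Q) -> (~~ holds t s -> tot c2 s K Q) ->
  tot (If t c1 c2) s K.+2 Q.
Proof.
move=> H1 H2; have [ht|ht] := boolP (holds t s).
  have [k [s' [e h q]]] := H1 ht.
  by exists k.+1, s'; split => //; [apply: EIfT|rewrite ltnS ltnW // ltnS].
have [k [s' [e h q]]] := H2 ht.
by exists k.+2, s'; split => //; apply: EIfF.
Qed.

Lemma tot_until t c s K n (I : nat -> mst -> Prop) : I 0%N s ->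
  (forall i s, (i < n)%N -> I i s -> ~~ holds t s /\ tot c s K (I i.+1)) ->
  (forall s, I n s -> holds t s) ->
  tot (Until t c) s (n * K.+2).+1 (I n).
Proof.
move=> I0 Hs Hn.
suff H j i s' : (i + j)%N = n -> I i s' -> tot (Until t c) s' (j * K.+2).+1 (I n).
  exact: (H n 0%N).
elim: j i s' => [|j IH] i s' ij Ii.
  rewrite addn0 in ij; rewrite ij in Ii.
  by exists 1%N, s'; split => //; apply: EUntilT; apply: Hn.
have [|ht [k1 [s1 [e1 h1 q1]]]] := Hs i s' _ Ii; first by lia.
have [|k2 [s2 [e2 h2 q2]]] := IH i.+1 s1 _ q1; first by rewrite addSn -addnS.
exists (k1 + k2).+2, s2; split => //; first exact: EUntilF e1 e2.
by rewrite mulSn; lia.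
Qed.

End Semantics.

Definition program (c : cmd) : seq instr := rcons (compile 0 c) Halt.

Lemma program_output (R : realType) (bits : nat -> bool) (c : cmd) (s : mstate R) K T (Q : mstate R -> Prop) :
  wf c -> pc s = 0%N -> tot bits c s K Q -> (K <= T)%N ->
  exists2 s', Q s' & output_within (program c) T bits s = Some (rreg s' 0).
Proof.
move=> w p0 [k [s' [ex kK q]]] KT; exists s' => //.
rewrite /output_within; have sE : s = at_pc 0 s by case: s p0 {ex q} => //= ? ? ? ? ->.
have pl : placed (program c) 0 (compile 0 c).
  by move=> i il; rewrite /program nth_rcons il.
rewrite sE -(subnKC (leq_trans kK KT)) (run_exec ex w _ pl) add0n.
case: (T - k)%N => [|f]; rewrite /= /halted /= /program nth_rcons size_compile ltnn eqxx //.
Qed.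

Local Open Scope nat_scope.

(** * The program *)

Ltac upd_cases := rewrite /upd; repeat (case: eqP => ?; try lia).
Ltac other_reg := repeat (case: eqP => [?|_]; first by lia).

Section Pieces.
Variables (R : realType) (bits : nat -> bool).
Local Notation mst := (mstate R).
Local Notation tot := (tot bits).

Lemma tot_blockW l (s : mst) K (Q : mst -> Prop) :
  size l <= K -> Q (sems bits l s) -> tot (Block l) s K Q.
Proof. by move=> h q; apply: (tot_conseq (tot_block q)). Qed.

(** The natural registers only add and subtract, so a product is repeated addition. The cost is
    linear in [b], which every use can afford. *)
Definition cmul (d a b i o : nat) : cmd :=
  Seq (Block [:: NConst d 0; NConst i 0; NConst o 1])
      (Until (TLeN b i) (Block [:: NAdd d d a; NAdd i i o])).

Lemma tot_mul d a b i o (s : mst) x y K (Q : mst -> Prop) :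
  uniq [:: d; i; o] -> a \notin [:: d; i; o] -> b \notin [:: d; i; o] ->
  nreg s a = x -> nreg s b = y -> 4 * y + 4 <= K ->
  (forall s', nreg s' d = x * y -> (forall j, j \notin [:: d; i; o] -> nreg s' j = nreg s j) ->
     rreg s' = rreg s -> used s' = used s -> Q s') ->
  tot (cmul d a b i o) s K Q.
Proof.
rewrite /= !inE !negb_or andbT => /andP[/andP[di do_] io] /and3P[ad ai ao] /and3P[bd bi bo] ax bY yK H.
apply: (tot_conseq (K := 3 + (y * 4).+1) (Q := Q)) => //; last by lia.
apply: tot_seq; apply: (tot_blockW (K := 3)) => //.
pose I k (s' : mst) := [/\ nreg s' d = x * k, nreg s' i = k, nreg s' o = 1,
  (forall j, j \notin [:: d; i; o] -> nreg s' j = nreg s j) & rreg s' = rreg s /\ used s' = used s].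
apply: (tot_conseq (tot_until (K := 2) (n := y) (I := I) _ _ _)) => //.
- split => //=; rewrite /upd ?eqxx ?muln0 //.
  + by rewrite (negbTE di) (negbTE do_).
  + by rewrite (negbTE io).
  + by move=> j; rewrite !inE !negb_or => /and3P[/negbTE -> /negbTE -> /negbTE ->].
- move=> k s' ky [h1 h2 h3 h4 [h5 h6]]; split.
    by rewrite /= h4 ?inE ?negb_or ?bd ?bi ?bo // bY h2 -ltnNge.
  apply: tot_blockW => //; split => //=; rewrite /upd ?eqxx.
  + rewrite (negbTE di) h1 h4 ?inE ?negb_or ?ad ?ai ?ao // ax; lia.
  + by rewrite (eq_sym i) (negbTE di) (eq_sym o) (negbTE do_) h2 h3 addn1.
  + by rewrite (eq_sym o) (negbTE io) (eq_sym o) (negbTE do_).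
  + by move=> j jn; have := jn; rewrite !inE !negb_or => /and3P[/negbTE -> /negbTE -> _]; apply: h4.
- by move=> s' [h1 h2 h3 h4 _]; rewrite /= h4 ?inE ?negb_or ?bd ?bi ?bo // bY h2.
- by move=> s' [h1 h2 h3 h4 [h5 h6]]; apply: H.
Qed.

Lemma ord_pair_lt n (u v : 'I_n) : u * n + v < n * n.
Proof.
have := ltn_ord u; have := ltn_ord v => hv hu.
by apply: (@leq_trans (u * n + n)); [lia|rewrite -mulSnr leq_mul2r hu orbT].
Qed.

Variables (n : nat) (e : rel 'I_n).
Hypothesis esym : forall u v, e u v = e v u.
Hypothesis eirr : forall v, e v v = false.
Hypothesis n4 : 4 <= n.

(** Registers below 64 are kept for the program. Adding [n * n] places the copy of the adjacency
    matrix beyond the original. *)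
Definition abase := n * n + 64.
Definition adj (s : mst) : Prop :=
  forall u v : 'I_n, nreg s (abase + 1 + u * n + v) = e u v.

(* The registers 1 to 4 serve as scratch space before row 0 of the adjacency
   matrix is saved, so its entries are recovered from column 0. *)
Definition repair : cmd := Block [:: NLoad 5 4; NStore 2 5; NAdd 4 4 0; NAdd 2 2 3].

Lemma tot_repair (s : mst) p q (Q : mst -> Prop) :
  nreg s 2 = p -> nreg s 4 = q -> nreg s 0 = n -> nreg s 3 = 1 -> 5 < p -> 5 < q ->
  (forall s', nreg s' 2 = p.+1 -> nreg s' 4 = q + n -> nreg s' p = nreg s q ->
     (forall j, j \notin [:: 2; 4; 5; p] -> nreg s' j = nreg s j) ->
     rreg s' = rreg s -> used s' = used s -> Q s') ->
  tot repair s 4 Q.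
Proof.
move=> s2 s4 s0 s3 p5 q5 H; apply: tot_blockW => //; apply: H => //=.
- by rewrite /upd /= s2 s3; upd_cases.
- by rewrite /upd /= s2 s4; upd_cases.
- by rewrite /upd /= s2 s4; upd_cases.
- move=> j; rewrite !inE !negb_or => /and4P[/eqP ? /eqP ? /eqP ? /eqP ?].
  by rewrite /upd /= s2; upd_cases.
Qed.

Definition copy_graph : cmd :=
  Seq (cmul 1 0 0 2 3)
  (Seq (Block [:: NConst 2 64; NAdd 1 1 2; NConst 2 5; NAdd 3 1 2])
  (Seq (Until (TLeN 1 2)
     (Block [:: NLoad 4 2; NStore 3 4; NConst 4 1; NAdd 2 2 4; NAdd 3 3 4]))
  (Seq (Block [:: NConst 3 1; NAdd 4 1 0; NAdd 4 4 3; NAdd 2 1 3; NAdd 2 2 3])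
  (Seq repair (Seq repair repair))))).

Lemma tot_copy_graph (s : mst) K (Q : mst -> Prop) :
  nreg s 0 = n -> (forall u v : 'I_n, nreg s (1 + u * n + v) = e u v) ->
  (forall i, n * n < i -> nreg s i = 0) ->
  11 * abase + 30 <= K ->
  (forall s', nreg s' 0 = n -> nreg s' 1 = abase -> adj s' ->
     rreg s' = rreg s -> used s' = used s -> Q s') ->
  tot copy_graph s K Q.
Proof.
move=> s0 sE sz KK H.
apply: (tot_conseq (K := (4 * n + 4) + (4 + (((abase - 5) * 7).+1 + (5 + (4 + (4 + 4)))))) (Q := Q)) => //; last first.
  by move: KK n4; rewrite /abase; nia.
apply: tot_seq; apply: (tot_mul _ _ _ s0 s0) => // s1 h1 h2 h3 h4.
apply: tot_seq; apply: tot_blockW => //.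
set s2 := sems _ _ s1.
have s2_1 : nreg s2 1 = abase by rewrite /s2 /= /upd /= h1.
have s2_other j : 4 < j \/ j = 0 -> nreg s2 j = nreg s j.
  by move=> j5; rewrite /s2 /= /upd; other_reg; apply: h2; rewrite !inE; lia.
apply: tot_seq.
pose I k (s' : mst) := [/\ nreg s' 1 = abase, nreg s' 2 = 5 + k, nreg s' 3 = abase + 5 + k,
  (forall j, 5 <= j < 5 + k -> nreg s' (abase + j) = nreg s j) &
  [/\ (forall j, 4 < j < abase + 5 \/ abase + 5 + k <= j \/ j = 0 -> nreg s' j = nreg s j),
    rreg s' = rreg s & used s' = used s]].
apply: (tot_conseq (tot_until (K := 5) (n := abase - 5) (I := I) _ _ _)) => //.
- split; [exact: s2_1|by []| |by move=> j; lia|split; [|by rewrite /s2 /= h3|by rewrite /s2 /= h4]].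
    by rewrite /s2 /= /upd /= h1 /abase; lia.
  by move=> j hj; apply: s2_other; lia.
- move=> k s' ka [g1 g2 g3 g4 [g5 g6 g7]]; split.
    by rewrite /= g1 g2 -ltnNge; move: ka; rewrite /abase; lia.
  have hk : 5 + k < abase by lia.
  have a64 : 64 <= abase by rewrite /abase; lia.
  have src : nreg s' (5 + k) = nreg s (5 + k) by apply: g5; left; lia.
  apply: tot_blockW => //; split => //=.
  + by rewrite /upd /= g3; case: eqP => // ?; lia.
  + rewrite /upd /= g3 (_ : (2 == abase + 5 + k) = false); last by lia. by rewrite g2; lia.
  + rewrite /upd /= g3 (_ : (3 == abase + 5 + k) = false); last by lia. by lia.
  + move=> j hj; rewrite /upd /= g3 g2.
    do 3 (case: eqP => [?|_]; first by lia).
    case: eqP => [jk|jk]; first by rewrite src; congr (nreg s _); lia.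
    by apply: g4; lia.
  + split; [|by []|by []] => j hj; rewrite /upd /= g3.
    other_reg.
    by apply: g5; lia.
- by move=> s' [g1 g2 _ _ _]; rewrite /= g1 g2; lia.
move=> s3 [g1 g2 g3 g4 [g5 g6 g7]].
have a64 : 64 <= abase by rewrite /abase; lia.
have g4' j : 5 <= j < abase -> nreg s3 (abase + j) = nreg s j by move=> hj; apply: g4; lia.
have s30 : nreg s3 0 = n by rewrite g5 ?s0 //; lia.
apply: tot_seq; apply: tot_blockW => //; set s4 := sems _ _ s3.
have k0 : nreg s4 0 = n by rewrite /s4 /=.
have k1 : nreg s4 1 = abase by rewrite /s4 /=.
have k2 : nreg s4 2 = abase + 2 by rewrite /s4 /= /upd /= g1; lia.
have k3 : nreg s4 3 = 1 by [].
have k4 : nreg s4 4 = abase + (1 + 1 * n) by rewrite /s4 /= /upd /= g1 s30; lia.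
have ks j : 4 < j -> nreg s4 j = nreg s3 j.
  by move=> hj; rewrite /s4 /= /upd; other_reg.
have kr : rreg s4 = rreg s by [].
have ku : used s4 = used s by [].
move: s4 k0 k1 k2 k3 k4 ks kr ku => s4 k0 k1 k2 k3 k4 ks kr ku.
have n5 : 1 + 1 * n < abase /\ 1 + 3 * n < abase by rewrite /abase; nia.
apply: tot_seq; apply: (tot_repair k2 k4 k0 k3); [lia|lia|] => s5 p2 p4 pv pj pr pu.
have q0 : nreg s5 0 = n by rewrite pj // !inE; lia.
have q3 : nreg s5 3 = 1 by rewrite pj // !inE; lia.
have q2 : nreg s5 2 = abase + 3 by rewrite p2; lia.
have q4 : nreg s5 4 = abase + (1 + 2 * n) by rewrite p4; lia.
apply: tot_seq; apply: (tot_repair q2 q4 q0 q3); [lia|lia|] => s6 p2' p4' pv' pj' pr' pu'.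
have r0 : nreg s6 0 = n by rewrite pj' // !inE; lia.
have r3 : nreg s6 3 = 1 by rewrite pj' // !inE; lia.
have r2 : nreg s6 2 = abase + 4 by rewrite p2'; lia.
have r4 : nreg s6 4 = abase + (1 + 3 * n) by rewrite p4'; lia.
apply: (tot_conseq (K := 4) (Q := Q)) => //.
apply: (tot_repair r2 r4 r0 r3); [lia|lia|] => s7 p2'' p4'' pv'' pj'' pr'' pu''.
have base j : 5 <= j < abase -> nreg s4 (abase + j) = nreg s j.
  by move=> hj; rewrite ks ?g4' //; lia.
have far j : 5 <= j < abase -> nreg s7 (abase + j) = nreg s j.
  by move=> hj; rewrite pj'' ?pj' ?pj ?base // !inE; lia.
have v1 : nreg s7 (abase + 2) = nreg s (1 + 1 * n).
  by rewrite pj'' ?pj' ?pv ?base // ?inE; lia.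
have v2 : nreg s7 (abase + 3) = nreg s (1 + 2 * n).
  by rewrite pj'' ?pv' ?pj ?base // ?inE; lia.
have v3 : nreg s7 (abase + 4) = nreg s (1 + 3 * n).
  by rewrite pv'' pj' ?pj ?base // ?inE; lia.
(* This register is never written and starts at 0, the right value for the diagonal entry of row 0
   because the graph has no loops. *)
have v0 : nreg s7 (abase + 1) = 0.
  rewrite pj'' ?pj' ?pj ?ks ?g5 ?sz // ?inE; rewrite /abase; lia.
apply: H; rewrite ?pr'' ?pr' ?pr ?pu'' ?pu' ?pu //.
- by rewrite pj'' // !inE; lia.
- by rewrite pj'' ?pj' ?pj // !inE; lia.
move=> u v; have uv := ord_pair_lt u v.
have [far5|near] := leqP 5 (1 + u * n + v).
  have -> : abase + 1 + u * n + v = abase + (1 + u * n + v) by lia.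
  by rewrite far ?sE //; rewrite /abase; lia.
(* As [n >= 4], the four overwritten registers lie in row 0, so symmetry recovers them from column
   0. *)
have u0 : u = 0 :> nat by case: (nat_of_ord u) near => // u'; rewrite mulSn; lia.
have cE : nreg s (1 + v * n) = e u v by have := sE v u; rewrite u0 addn0 esym.
rewrite u0 mul0n addn0; rewrite u0 mul0n addn0 in near.
case vE : (nat_of_ord v) near => [|[|[|[|?]]]] // _; rewrite vE in cE.
- by rewrite addn0 v0 -cE -[in LHS](_ : nreg s (1 + 0 * n) = 0) //; have := sE u u; rewrite u0 eirr mul0n !addn0.
- by rewrite -addnA v1.
- by rewrite -addnA v2.
- by rewrite -addnA v3.
Qed.
End Pieces.

(** * Copying the real inputs and computing the sizes *)

Section Setup.
Variables (R : realType) (bits : nat -> bool).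
Local Notation mst := (mstate R).
Local Notation tot := (tot bits).
Variables (n b0 : nat).

Definition xbase := 2 * n + 64.

(** Real register 0 is the transfer register, so its own content is saved before the loop starts at
    index 1. *)
Definition copy_reals : cmd :=
  Seq (Block [:: NConst 2 64; NAdd 2 2 0; NAdd 2 2 0; RStore 2 0; NConst 3 1; NConst 4 0])
  (Seq (Block [:: NConst 18 1; NAdd 19 2 3; NAdd 20 0 0; NAdd 20 20 3])
  (Until (TLeN 20 18) (Block [:: RLoad 0 18; RStore 19 0; NAdd 18 18 3; NAdd 19 19 3]))).

Lemma tot_copy_reals (s : mst) K (Q : mst -> Prop) : nreg s 0 = n -> 12 * n + 11 <= K ->
  (forall s', nreg s' 2 = xbase -> nreg s' 3 = 1 -> nreg s' 4 = 0 ->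
     (forall j, j \notin [:: 2; 3; 4; 18; 19; 20] -> nreg s' j = nreg s j) ->
     (forall i, i <= 2 * n -> rreg s' (xbase + i) = rreg s i) -> used s' = used s -> Q s') ->
  tot copy_reals s K Q.
Proof.
move=> s0 KK H.
apply: (tot_conseq (K := 6 + (4 + ((2 * n) * 6).+1)) (Q := Q)) => //; last by lia.
have xb : xbase = 64 + n + n by rewrite /xbase; lia.
apply: tot_seq; apply: tot_blockW => //; set s1 := sems _ _ s.
have k2 : nreg s1 2 = xbase by rewrite /s1 /= /upd /= s0.
have k3 : nreg s1 3 = 1 by [].
have k4 : nreg s1 4 = 0 by [].
have kj j : j \notin [:: 2; 3; 4] -> nreg s1 j = nreg s j.
  by rewrite !inE => hj; rewrite /s1 /= /upd; other_reg.
have kx i : rreg s1 i = if i == xbase then rreg s 0 else rreg s i.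
  by rewrite /s1 /= /upd /= s0 -xb.
have ku : used s1 = used s by [].
move: s1 k2 k3 k4 kj kx ku => s1 k2 k3 k4 kj kx ku.
apply: tot_seq; apply: tot_blockW => //; set s2 := sems _ _ s1.
pose I k (s' : mst) := [/\ nreg s' 18 = 1 + k, nreg s' 19 = xbase + (1 + k), nreg s' 20 = 2 * n + 1,
  (forall j, j \notin [:: 2; 3; 4; 18; 19; 20] -> nreg s' j = nreg s j) &
  [/\ [/\ nreg s' 2 = xbase, nreg s' 3 = 1 & nreg s' 4 = 0],
   (forall i, i <= k -> rreg s' (xbase + i) = rreg s i),
   (forall i, 1 <= i < xbase -> rreg s' i = rreg s i) & used s' = used s]].
apply: (tot_conseq (tot_until (K := 4) (n := 2 * n) (I := I) _ _ _)) => //.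
- have k0 : nreg s1 0 = n by rewrite kj.
  split; rewrite /s2 /= ?/upd /= ?k2 ?k3 ?k0 ?addnA //; try lia.
    by move=> j; rewrite !inE => hj; other_reg; rewrite kj // !inE; lia.
  split => //.
  - by move=> i; rewrite leqn0 => /eqP ->; rewrite addn0 kx eqxx.
  - by move=> i hi; rewrite kx; case: eqP => // ?; lia.
- move=> k s' kn [g1 g2 g3 g4 [[g5 g6 g7] g8 g9 g10]]; split.
    by rewrite /= g1 g3; lia.
  have src : rreg s' (1 + k) = rreg s (1 + k) by apply: g9; rewrite /xbase; lia.
  apply: tot_blockW => //; split => //=; rewrite ?/upd /= ?g1 ?g2 ?g6 //; try lia.
    by move=> j hj; have := hj; rewrite !inE => ?; other_reg; apply: g4.
  split=> // i hi; rewrite ?g1.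
    case: eqP => [E|ne]; first by rewrite src; congr (rreg s _); lia.
    by case: eqP => [?|_]; [rewrite /xbase in ne *; lia|apply: g8; lia].
  case: eqP => [?|_]; first by lia.
  by case: eqP => [?|_]; [lia|apply: g9].
- by move=> s' [g1 _ g3 _ _]; rewrite /= g1 g3; lia.
by move=> s' [g1 g2 g3 g4 [[g5 g6 g7] g8 g9 g10]]; apply: H.
Qed.

(** Doubling finds the least power of two that is at least [n]; [M] and its exponent [B] are updated
    alongside, so no logarithm is computed. *)
Definition double_M : cmd :=
  Seq (Block [:: NAdd 5 1 1; NAdd 6 5 0; NConst 7 (2 ^ b0); NConst 8 b0; NConst 18 1])
  (Until (TLeN 0 18) (Block [:: NAdd 18 18 18; NAdd 7 7 7; NAdd 8 8 3])).

Lemma tot_double_M (s : mst) a y K (Q : mst -> Prop) :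
  n <= 2 ^ y -> (forall i, i < y -> 2 ^ i < n) ->
  nreg s 0 = n -> nreg s 1 = a -> nreg s 3 = 1 -> 5 * y + 6 <= K ->
  (forall s', nreg s' 5 = a + a -> nreg s' 6 = a + a + n ->
     nreg s' 7 = 2 ^ (b0 + y) -> nreg s' 8 = b0 + y ->
     (forall j, j \notin [:: 5; 6; 7; 8; 18] -> nreg s' j = nreg s j) ->
     rreg s' = rreg s -> used s' = used s -> Q s') ->
  tot double_M s K Q.
Proof.
move=> ny ylow s0 s1 s3 KK H.
apply: (tot_conseq (K := 5 + (y * 5).+1) (Q := Q)) => //; last by lia.
apply: tot_seq; apply: tot_blockW => //.
pose I k (s' : mst) := [/\ nreg s' 18 = 2 ^ k, nreg s' 7 = 2 ^ (b0 + k), nreg s' 8 = b0 + k,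
  nreg s' 5 = a + a /\ nreg s' 6 = a + a + n &
  [/\ (forall j, j \notin [:: 5; 6; 7; 8; 18] -> nreg s' j = nreg s j),
   rreg s' = rreg s & used s' = used s]].
apply: (tot_conseq (tot_until (K := 3) (n := y) (I := I) _ _ _)) => //.
- split; rewrite /= ?/upd /= ?s0 ?s1 ?addn0 //.
  split => // j; rewrite !inE => hj; by other_reg.
- move=> k s' ky [g1 g2 g3 [g4 g5] [g6 g7 g8]]; split.
    by rewrite /= g1 g6 // s0 -ltnNge ylow.
  apply: tot_blockW => //; split; rewrite /= ?/upd /= ?g1 ?g2 ?g3 ?g4 ?g5 //.
  + by rewrite expnS mul2n addnn.
  + by rewrite addnS expnS mul2n addnn.
  + by rewrite g6 // s3 addn1 addnS.
  + by split => // j hj; have := hj; rewrite !inE => ?; other_reg; apply: g6.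
- by move=> s' [g1 g2 g3 g4 [g6 _ _]]; rewrite /= g1 g6 // s0.
by move=> s' [g1 g2 g3 [g4 g5] [g6 g7 g8]]; apply: H.
Qed.

Definition double_E : cmd :=
  Seq (Block [:: NAdd 19 2 0; NAdd 19 19 0; RLoad 1 19; RConst 2 1; NConst 10 1; NAdd 9 8 4])
  (Until (TLtR 2 1) (Block [:: RAdd 1 1 1; NAdd 10 10 10; NAdd 9 9 3])).

Lemma tot_double_E (s : mst) (eps : R) B L K (Q : mst -> Prop) :
  (1 < eps * (2 ^ L)%:R)%R -> (forall i, i < L -> ~~ (1 < eps * (2 ^ i)%:R)%R) ->
  nreg s 0 = n -> nreg s 2 = xbase -> nreg s 3 = 1 -> nreg s 4 = 0 -> nreg s 8 = B ->
  rreg s (xbase + 2 * n) = eps -> 5 * L + 7 <= K ->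
  (forall s', nreg s' 9 = B + L -> nreg s' 10 = 2 ^ L ->
     (forall j, j \notin [:: 9; 10; 19] -> nreg s' j = nreg s j) ->
     (forall j, j \notin [:: 1; 2] -> rreg s' j = rreg s j) -> used s' = used s -> Q s') ->
  tot double_E s K Q.
Proof.
move=> PL low s0 s2 s3 s4 s8 sx KK H.
apply: (tot_conseq (K := 6 + (L * 5).+1) (Q := Q)) => //; last by lia.
apply: tot_seq; apply: tot_blockW => //.
pose I k (s' : mst) := [/\ nreg s' 9 = B + k, nreg s' 10 = 2 ^ k,
   rreg s' 1 = (eps * (2 ^ k)%:R)%R, rreg s' 2 = 1%R &
  [/\ (forall j, j \notin [:: 9; 10; 19] -> nreg s' j = nreg s j),
   (forall j, j \notin [:: 1; 2] -> rreg s' j = rreg s j) & used s' = used s]].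
apply: (tot_conseq (tot_until (K := 3) (n := L) (I := I) _ _ _)) => //.
- split; rewrite /= ?/upd /= ?s0 ?s2 ?s8 ?s4 //.
  + by rewrite expn0 mulr1 -sx; congr (rreg s _); lia.
  + split => // j; rewrite !inE => hj; by other_reg.
- move=> k s' kL [g1 g2 g3 g4 [g5 g6 g7]]; split.
    by rewrite /= g3 g4; apply: low.
  apply: tot_blockW => //; split; rewrite /= ?/upd /= ?g1 ?g2 ?g3 ?g4 //.
  + by rewrite g5 // s3 addn1 addnS.
  + by rewrite expnS mul2n addnn.
  + by rewrite -mulrDr -natrD expnS mul2n addnn.
  + split => // j hj; have := hj; rewrite !inE => ?; other_reg.
      exact: g5.
    exact: g6.
- by move=> s' [g1 g2 g3 g4 _]; rewrite /= g3 g4; apply: PL.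
by move=> s' [g1 g2 g3 g4 [g5 g6 g7]]; apply: H.
Qed.

Definition set_counts : cmd :=
  Seq (cmul 20 7 7 18 19) (Seq (cmul 21 20 7 18 19) (Seq (cmul 12 21 9 18 19)
  (Seq (cmul 21 20 10 18 19) (cmul 11 21 10 18 19)))).

Lemma tot_set_counts (s : mst) M H E K (Q : mst -> Prop) :
  nreg s 7 = M -> nreg s 9 = H -> nreg s 10 = E ->
  8 * M + 4 * H + 8 * E + 20 <= K ->
  (forall s', nreg s' 12 = M ^ 3 * H -> nreg s' 11 = M * M * E * E ->
     (forall j, j \notin [:: 11; 12; 18; 19; 20; 21] -> nreg s' j = nreg s j) ->
     rreg s' = rreg s -> used s' = used s -> Q s') ->
  tot set_counts s K Q.
Proof.
move=> s7 s9 s10 KK HQ.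
apply: (tot_conseq (K := (4 * M + 4) + ((4 * M + 4) + ((4 * H + 4) + ((4 * E + 4) + (4 * E + 4))))) (Q := Q)) => //; last by lia.
apply: tot_seq; apply: (tot_mul _ _ _ _ s7 s7) => // s1 h20 hj hr hu.
have s17 : nreg s1 7 = M by rewrite hj.
apply: tot_seq; apply: (tot_mul _ _ _ _ h20 s17) => // s2 h21 hj2 hr2 hu2.
have s29 : nreg s2 9 = H by rewrite hj2 // hj.
apply: tot_seq; apply: (tot_mul _ _ _ _ h21 s29) => // s3 h12 hj3 hr3 hu3.
have s320 : nreg s3 20 = M * M by rewrite hj3 // hj2.
have s310 : nreg s3 10 = E by rewrite hj3 // hj2 // hj.
apply: tot_seq; apply: (tot_mul _ _ _ _ s320 s310) => // s4 h21' hj4 hr4 hu4.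
have s410 : nreg s4 10 = E by rewrite hj4.
apply: (tot_mul _ _ _ _ h21' s410) => // s5 h11 hj5 hr5 hu5.
apply: HQ; rewrite ?hr5 ?hr4 ?hr3 ?hr2 ?hu5 ?hu4 ?hu3 ?hu2 //.
- by rewrite hj5 // hj4 // h12 !expnS expn0 muln1 mulnA.
- by move=> j; rewrite !inE => hh; rewrite hj5 ?hj4 ?hj3 ?hj2 ?hj // !inE; lia.
Qed.

End Setup.

(** * Computing the acceptance thresholds *)

Section Thresholds.
Variable R : realType.

(** Index [j] stands for the candidate [j.+1], so the search over [iota 0 M] covers 1 to [M]. The
    candidate [M] always passes, since it makes the left side 0. *)
Definition kpred (lam : R) (M j : nat) : bool := (lam * (M%:R - j.+1%:R) < j.+1%:R)%R.
Definition kthr (lam : R) (M : nat) : nat := (find (kpred lam M) (iota 0 M)).+1.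

Lemma has_kpred lam M : 0 < M -> has (kpred lam M) (iota 0 M).
Proof.
move=> M0; apply/hasP; exists M.-1; first by rewrite mem_iota add0n leq0n prednK /=.
by rewrite /kpred prednK // subrr mulr0 ltr0n.
Qed.

Lemma kthr_le lam M : 0 < M -> kthr lam M <= M.
Proof. by move=> /has_kpred h; rewrite /kthr -[X in _ < X](size_iota 0) -has_find. Qed.

Lemma kthr_pred lam M : 0 < M -> kpred lam M (kthr lam M).-1.
Proof.
move=> M0; have h := has_kpred lam M0; have := nth_find 0 h.
by rewrite nth_iota // -[X in _ < X](size_iota 0) -has_find.
Qed.

Lemma kthr_min lam M j : j < (kthr lam M).-1 -> ~~ kpred lam M j.
Proof.
rewrite /kthr /= => jf; have := before_find 0 jf.
rewrite nth_iota ?add0n => [->//|].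
by apply: leq_trans jf _; rewrite -[X in _ <= X](size_iota 0) find_size.
Qed.

Lemma kthr_spec lam M : (0 <= lam)%R -> 0 < M -> kspec lam M (kthr lam M).
Proof.
move=> l0 M0; split => //; first by have := kthr_pred lam M0.
case E : (kthr lam M) => [|[|j]] //.
  by rewrite subrr mulr_ge0 // subrK ler0n.
have : j < (kthr lam M).-1 by rewrite E.
move=> /kthr_min; rewrite /kpred -leNgt -(natr1 j.+1).
set x := (j.+1%:R)%R; set y := (M%:R)%R => h; move: h; congr (_ <= _)%R; ring.
Qed.

Variables (bits : nat -> bool) (n : nat).
Local Notation mst := (mstate R).
Local Notation tot := (tot bits).
Local Notation xbase := (xbase n).
Variables (M kb : nat).
Hypothesis M0 : 0 < M.
Hypothesis kb64 : 64 <= kb.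

(** The loop keeps [lam * (M - k)] in register 8 and [k] in register 9. Afterwards both fields at
    the vertex are replaced by their quotients with [klam], the factors from which the reweights are
    multiplied up. *)
Definition thr_body : cmd :=
  Seq (Block [:: RLoad 3 20; RLoad 4 21])
  (Seq (If (TLtR 3 4) (Block [:: RAdd 5 4 7]) (Block [:: RAdd 5 3 7]))
  (Seq (Block [:: RSub 8 2 6; RMul 8 5 8; RConst 9 1; NConst 22 1])
  (Seq (Until (TLtR 8 9) (Block [:: RAdd 9 9 6; RSub 8 8 5; NAdd 22 22 3]))
  (Seq (Block [:: NStore 19 22; RSub 8 2 9; RDiv 8 9 8; RDiv 3 3 8; RDiv 4 4 8])
  (Seq (Block [:: RStore 20 3; RStore 21 4])
  (Block [:: NAdd 18 18 3; NAdd 19 19 3; NAdd 20 20 3; NAdd 21 21 3])))))).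

Lemma tot_thr_body (s : mst) v (x y : R) K (Q : mst -> Prop)
    (k := kthr (Num.max x y) M) (l := (k%:R / (M - k)%:R)%R) :
  v < n -> nreg s 18 = v -> nreg s 19 = kb + v -> nreg s 20 = xbase + v ->
  nreg s 21 = xbase + n + v -> nreg s 3 = 1 ->
  rreg s 2 = (M%:R)%R -> rreg s 6 = 1%R -> rreg s 7 = 0%R ->
  rreg s (xbase + v) = x -> rreg s (xbase + n + v) = y ->
  5 * M + 21 <= K ->
  (forall s', nreg s' 18 = v.+1 -> nreg s' 19 = kb + v.+1 -> nreg s' 20 = xbase + v.+1 ->
     nreg s' 21 = xbase + n + v.+1 -> nreg s' (kb + v) = k ->
     rreg s' (xbase + v) = (x / l)%R -> rreg s' (xbase + n + v) = (y / l)%R ->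
     (forall j, j \notin [:: 18; 19; 20; 21; 22; kb + v] -> nreg s' j = nreg s j) ->
     (forall j, j \notin [:: 3; 4; 5; 8; 9; xbase + v; xbase + n + v] -> rreg s' j = rreg s j) ->
     used s' = used s -> Q s') ->
  tot thr_body s K Q.
Proof.
move=> vn s18 s19 s20 s21 s3 x2 x6 x7 xv yv KK H; set lam := Num.max x y.
apply: (tot_conseq (K := 2 + (3 + (4 + (((k.-1) * 5).+1 + (5 + (2 + 4)))))) (Q := Q)) => //; last first.
  by have := kthr_le lam M0; rewrite -/k; lia.
apply: tot_seq; apply: tot_blockW => //; set s1 := sems _ _ s.
have a3 : rreg s1 3 = x by rewrite /s1 /= /upd /= s20.
have xb64 : 64 <= xbase by rewrite /xbase; lia.
have a4 : rreg s1 4 = y.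
  by rewrite /s1 /= /upd /= s21; case: eqP => [?|_]; first by lia.
have ax j : j \notin [:: 3; 4] -> rreg s1 j = rreg s j.
  by rewrite !inE => hj; rewrite /s1 /= /upd; other_reg.
have an : nreg s1 = nreg s by []. have au : used s1 = used s by [].
move: s1 a3 a4 ax an au => s1 a3 a4 ax an au.
apply: tot_seq.
apply: (tot_conseq (K := 3) (Q := fun s2 => [/\ rreg s2 5 = lam,
   (forall j, j != 5 -> rreg s2 j = rreg s1 j), nreg s2 = nreg s & used s2 = used s])) => //.
  apply: tot_if => /=; rewrite a3 a4 => h; apply: tot_blockW => //; split => //=.
  - by rewrite /upd /= a4 ax // x7 addr0 /lam; case: leP h.
  - by move=> j /negbTE j5; rewrite /upd j5.
  - by rewrite /upd /= a3 ax // x7 addr0 /lam; case: ltP h.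
  - by move=> j /negbTE j5; rewrite /upd j5.
move=> s2 [c5 cx cn cu].
have c3 : rreg s2 3 = x by rewrite cx.
have c4 : rreg s2 4 = y by rewrite cx.
have cx' j : j \notin [:: 3; 4; 5] -> rreg s2 j = rreg s j.
  by rewrite !inE => hj; rewrite cx ?ax // ?inE; lia.
apply: tot_seq; apply: tot_blockW => //; set s3' := sems _ _ s2.
apply: tot_seq.
pose I i (s' : mst) := [/\ rreg s' 9 = (i.+1%:R)%R, rreg s' 8 = (lam * (M%:R - i.+1%:R))%R,
  nreg s' 22 = i.+1, (forall j, j != 22 -> nreg s' j = nreg s j) &
  (forall j, j \notin [:: 8; 9] -> rreg s' j = rreg s2 j) /\ used s' = used s].
apply: (tot_conseq (tot_until (K := 3) (n := k.-1) (I := I) _ _ _)) => //.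
- split; rewrite /s3' /= ?/upd /= ?c5 ?cx' ?x2 ?x6 //.
  + by move=> j /negbTE ->; rewrite cn.
  + split; last by rewrite cu.
    by move=> j; rewrite !inE => hj; other_reg.
- move=> i s' ik [g1 g2 g3 g4 [g5 g6]]; split; first by rewrite /= g1 g2; apply: kthr_min.
  apply: tot_blockW => //; split; rewrite /= ?/upd /= ?g1 ?g2 ?g3 ?g5 ?g4 ?c5 ?cx' ?x6 ?s3 ?addn1 //.
  + by rewrite natr1.
  + by rewrite -(natr1 i.+1); ring.
  + by move=> j /negbTE j22; rewrite j22 g4 // j22.
  + split => // j; rewrite !inE => hj; other_reg.
    by rewrite g5 // !inE; lia.
- by move=> s' [g1 g2 _ _ _]; rewrite /= g1 g2; apply: kthr_pred.
move=> s4 [g1 g2 g3 g4 [g5 g6]]; rewrite /k prednK // -/k in g1 g3.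
apply: tot_seq; apply: tot_blockW => //; set s5 := sems _ _ s4.
have n4' j : j != 22 -> nreg s4 j = nreg s j by apply: g4.
have kM : k <= M by apply: kthr_le.
have d3 : rreg s5 3 = (x / l)%R.
  by rewrite /s5 /= /upd /= ?g1 !g5 // c3 cx' // x2 /l natrB.
have d4 : rreg s5 4 = (y / l)%R.
  by rewrite /s5 /= /upd /= ?g1 !g5 // c4 cx' // x2 /l natrB.
have dx j : j \notin [:: 3; 4; 5; 8; 9] -> rreg s5 j = rreg s j.
  rewrite !inE => hj; rewrite /s5 /= /upd; other_reg.
  by rewrite g5 ?cx' // !inE; lia.
have dk : nreg s5 (kb + v) = k by rewrite /s5 /= /upd /= g3 n4' // s19 eqxx.
have dn j : j \notin [:: 22; kb + v] -> nreg s5 j = nreg s j.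
  rewrite !inE => hj; rewrite /s5 /= /upd /= n4' // s19; case: eqP => [?|_]; first by lia.
  by rewrite n4' //; lia.
have du : used s5 = used s by [].
move: s5 d3 d4 dx dk dn du => s5 d3 d4 dx dk dn du.
have e20 : nreg s5 20 = xbase + v by rewrite dn // !inE; lia.
have e21 : nreg s5 21 = xbase + n + v by rewrite dn // !inE; lia.
apply: tot_seq; apply: tot_blockW => //; set s6 := sems _ _ s5.
have fx1 : rreg s6 (xbase + v) = (x / l)%R.
  rewrite /s6 /= /upd /= e20 e21; case: eqP => [?|_]; first by lia.
  by rewrite eqxx.
have fx2 : rreg s6 (xbase + n + v) = (y / l)%R.
  rewrite /s6 /= /upd /= e20 e21 eqxx; case: eqP => [?|_]; first by lia.
  by [].
have fx j : j \notin [:: 3; 4; 5; 8; 9; xbase + v; xbase + n + v] -> rreg s6 j = rreg s j.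
  rewrite !inE => hj; rewrite /s6 /= /upd /= e20 e21; other_reg.
  by rewrite dx // !inE; lia.
have fn : nreg s6 = nreg s5 by []. have fu : used s6 = used s by [].
move: s6 fx1 fx2 fx fn fu => s6 fx1 fx2 fx fn fu.
have h18 : nreg s5 18 = v by rewrite dn // !inE; lia.
have h19 : nreg s5 19 = kb + v by rewrite dn // !inE; lia.
have h3 : nreg s5 3 = 1 by rewrite dn // !inE; lia.
apply: tot_blockW => //; apply: H; rewrite /= ?/upd /= ?fn ?h18 ?h19 ?e20 ?e21 ?h3 ?addn1 ?addnS //.
- by other_reg.
- by move=> j; rewrite !inE => hj; other_reg; rewrite dn // !inE; lia.
Qed.

Definition thresholds : cmd :=
  Seq (Block [:: OfNat 2 7; RConst 6 1; RConst 7 0; NConst 18 0; NAdd 19 6 4; NAdd 20 2 4; NAdd 21 2 0])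
  (Until (TLeN 0 18) thr_body).

Lemma tot_thresholds (s : mst) (x y : 'I_n -> R) K (Q : mst -> Prop)
    (k := fun v : 'I_n => kthr (Num.max (x v) (y v)) M)
    (l := fun v : 'I_n => ((k v)%:R / (M - k v)%:R)%R) :
  nreg s 0 = n -> nreg s 2 = xbase -> nreg s 3 = 1 -> nreg s 4 = 0 -> nreg s 6 = kb -> nreg s 7 = M ->
  (forall v : 'I_n, rreg s (xbase + v) = x v) ->
  (forall v : 'I_n, rreg s (xbase + n + v) = y v) ->
  n * (5 * M + 23) + 8 <= K ->
  (forall s', (forall v : 'I_n, nreg s' (kb + v) = k v) ->
     (forall v : 'I_n, rreg s' (xbase + v) = (x v / l v)%R) ->
     (forall v : 'I_n, rreg s' (xbase + n + v) = (y v / l v)%R) ->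
     (forall j, j \notin [:: 18; 19; 20; 21; 22] -> ~~ (kb <= j < kb + n) -> nreg s' j = nreg s j) ->
     used s' = used s -> Q s') ->
  tot thresholds s K Q.
Proof.
move=> s0 s2 s3 s4 s6 s7 sx sy KK H.
have xb64 : 64 <= xbase by rewrite /xbase; lia.
apply: (tot_conseq (K := 7 + (n * (5 * M + 21).+2).+1) (Q := Q)) => //; last by lia.
apply: tot_seq; apply: tot_blockW => //; set s1 := sems _ _ s.
pose I i (s' : mst) := [/\ [/\ nreg s' 18 = i, nreg s' 19 = kb + i, nreg s' 20 = xbase + i &
     nreg s' 21 = xbase + n + i],
  [/\ rreg s' 2 = (M%:R)%R, rreg s' 6 = 1%R & rreg s' 7 = 0%R],
  (forall v : 'I_n, v < i -> [/\ nreg s' (kb + v) = k v, rreg s' (xbase + v) = (x v / l v)%R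
     & rreg s' (xbase + n + v) = (y v / l v)%R]),
  (forall v : 'I_n, i <= v -> rreg s' (xbase + v) = x v /\ rreg s' (xbase + n + v) = y v) &
  (forall j, j \notin [:: 18; 19; 20; 21; 22] -> ~~ (kb <= j < kb + n) -> nreg s' j = nreg s j)
  /\ used s' = used s].
apply: (tot_conseq (tot_until (K := 5 * M + 21) (n := n) (I := I) _ _ _)) => //.
- split; rewrite /s1 /= ?/upd /= ?s7 ?s6 ?s4 ?s2 ?s0 ?addn0 //.
  + move=> v _; rewrite -sx -sy; by split; other_reg.
  + by split => // j; rewrite !inE => hj _; other_reg.
- move=> i s' ni [[g1 g2 g3 g4] [g5 g6 g7] g8 g9 [g10 g11]].
  have gg j : j < 18 -> nreg s' j = nreg s j by move=> hj; apply: g10; rewrite ?inE; lia.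
  split; first by rewrite /= g1 gg // s0; lia.
  have [xi yi] := g9 (Ordinal ni) (leqnn _).
  apply: (tot_thr_body ni g1 g2 g3 g4 _ g5 g6 g7 xi yi) => //; first by rewrite gg.
  move=> s'' a1 a2 a3 a4 a5 a6 a7 a8 a9 a10; split.
  + by split.
  + by split; rewrite a9 // !inE; lia.
  + move=> v; rewrite ltnS leq_eqVlt => /orP[/eqP vi|vi].
      by rewrite vi a5 a6 a7 /k /l; have -> : v = Ordinal ni by apply: val_inj.
    have [b1 b2 b3] := g8 v vi; rewrite a8 ?a9 ?a9 //; first by rewrite !inE; lia.
      by rewrite !inE; lia.
    by rewrite !inE; have := ltn_ord v; lia.
  + move=> v vi; have [c1 c2] := g9 v (ltnW vi); have := ltn_ord v => vn.
    by split; rewrite a9 // !inE; lia.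
  + split; last by rewrite a10.
    by move=> j h1 h2; rewrite a8; [apply: g10|move: h1; rewrite !inE; lia].
- by move=> s' [[g1 _ _ _] _ _ _ [g10 _]]; rewrite /= g1 g10 ?s0 // ?inE; lia.
move=> s' [_ _ g8 _ [g10 g11]]; apply: H => // v; by have [] := g8 v (ltn_ord v).
Qed.
End Thresholds.

Definition seg (bits : nat -> bool) (o k : nat) : seq bool := mkseq (fun i => bits (o + i)) k.

Lemma size_seg bits o k : size (seg bits o k) = k. Proof. exact: size_mkseq. Qed.

Lemma seg_cat bits o k1 k2 : seg bits o (k1 + k2) = seg bits o k1 ++ seg bits (o + k1) k2.
Proof.
rewrite /seg /mkseq iotaD map_cat; congr (_ ++ _).
by rewrite add0n -[X in iota X _]addn0 iotaDl -map_comp; apply: eq_map => i /=; rewrite addnA.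
Qed.

Lemma segS bits o k : seg bits o k.+1 = rcons (seg bits o k) (bits (o + k)).
Proof. by rewrite /seg mkseqS. Qed.

Lemma bval_rcons s c : bval (rcons s c) = bval s + bval s + c.
Proof. by rewrite /bval -cats1 foldl_cat. Qed.

(** [walk] consumes coins from the front, whereas a loop invariant needs the latest step
    outermost. *)
Lemma walkSr (St : finType) B (stepf : St -> nat -> nat -> St) j X bits o :
  walk B stepf j.+1 X (seg bits o (j.+1 * (B + B)))
  = stepf (walk B stepf j X (seg bits o (j * (B + B))))
      (bval (seg bits (o + j * (B + B)) B)) (bval (seg bits (o + j * (B + B) + B) B)).
Proof.
elim: j X o => [|j IH] X o.
  by rewrite mul1n mul0n addn0 seg_cat /= take_size_cat ?drop_size_cat ?size_seg // take_oversize ?size_seg.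
have unfold i : walk B stepf i.+1 X (seg bits o (i.+1 * (B + B)))
  = walk B stepf i (stepf X (bval (seg bits o B)) (bval (seg bits (o + B) B)))
      (seg bits (o + (B + B)) (i * (B + B))).
  rewrite mulSn -addnA !seg_cat /=.
  rewrite [drop (B + B) _](_ : _ = seg bits (o + B + B) (i * (B + B))); last first.
    by rewrite catA drop_size_cat // size_cat !size_seg.
  by rewrite !(take_size_cat, drop_size_cat) ?size_seg // addnA.
rewrite unfold IH unfold.
by congr (stepf _ (bval (seg _ _ _)) (bval (seg _ _ _))); lia.
Qed.

Lemma samples_seg (St : finType) q (smp : seq bool -> St) m bits o :
  samples q smp m (seg bits o (m * q)) = [seq smp (seg bits (o + i * q) q) | i <- iota 0 m].
Proof.
elim: m o => //= m IH o; rewrite mulSn seg_cat take_size_cat ?drop_size_cat ?size_seg //.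
rewrite mul0n addn0; congr (_ :: _); rewrite IH (iotaDl 1 0) -map_comp.
by apply: eq_map => i /=; rewrite mulSn addnA.
Qed.

(** * One step of the dynamics and one reweighting on the machine *)

Section Sampler.
Variables (R : realType) (bits : nat -> bool).
Local Notation mst := (mstate R).
Local Notation tot := (tot bits).
Variables (n : nat) (e : rel 'I_n).
Hypothesis esym : forall u v, e u v = e v u.
Variables (k : 'I_n -> nat) (rm rl : 'I_n -> R) (B m t : nat).
Local Notation a := (abase n).
Local Notation xb := (xbase n).

Definition draw (d : nat) : cmd :=
  Seq (Block [:: NConst d 0; NConst 18 0])
  (Until (TLeN 8 18) (Block [:: Coin 19; NAdd d d d; NAdd d d 19; NAdd 18 18 3])).

Lemma tot_draw d (s : mst) K (Q : mst -> Prop) :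
  d \notin [:: 3; 8; 18; 19] -> nreg s 3 = 1 -> nreg s 8 = B -> 6 * B + 3 <= K ->
  (forall s', nreg s' d = bval (seg bits (used s) B) ->
     (forall j, j \notin [:: d; 18; 19] -> nreg s' j = nreg s j) ->
     rreg s' = rreg s -> used s' = used s + B -> Q s') ->
  tot (draw d) s K Q.
Proof.
rewrite !inE !negb_or => /and4P[/eqP d3 /eqP d8 /eqP d18 /eqP d19] s3 s8 KK H.
apply: (tot_conseq (K := 2 + (B * 6).+1) (Q := Q)) => //; last by lia.
apply: tot_seq; apply: tot_blockW => //.
pose I i (s' : mst) := [/\ nreg s' d = bval (seg bits (used s) i), nreg s' 18 = i,
   (forall j, j \notin [:: d; 18; 19] -> nreg s' j = nreg s j),
     rreg s' = rreg s & used s' = used s + i].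
apply: (tot_conseq (tot_until (K := 4) (n := B) (I := I) _ _ _)) => //.
- split; rewrite /= ?/upd /= ?eqxx ?addn0 //.
    by case: eqP => [?|_]; first by lia.
  by move=> j; rewrite !inE => hj; other_reg.
- move=> i s' iB [g1 g2 g3 g4 g5].
  have g8 : nreg s' 8 = B by rewrite g3 // !inE; lia.
  have gg3 : nreg s' 3 = 1 by rewrite g3 // !inE; lia.
  split; first by rewrite /= g8 g2; lia.
  apply: tot_blockW => //; split; rewrite /= ?/upd /= ?eqxx.
  + rewrite segS bval_rcons -g1 -g5.
    by other_reg.
  + by other_reg; rewrite g2 gg3 addn1.
  + by move=> j hj; have := hj; rewrite !inE => h; other_reg; apply: g3.
  + exact: g4.
  + by rewrite g5 addnS.
- by move=> s' [g1 g2 g3 _ _]; rewrite /= g2 g3 ?s8 // !inE; lia.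
by move=> s' [g1 g2 g3 g4 g5]; apply: H.
Qed.

(* The register layout of the sampling phase: [a] and [xb] are the bases of the
   copies of the adjacency matrix and of the real inputs, the current configuration
   occupies the [n] registers from [a + a] on and the thresholds the next [n]. *)
Record stat (s : mst) : Prop := Stat {
  st0 : nreg s 0 = n; st1 : nreg s 1 = a; st2 : nreg s 2 = xb; st3 : nreg s 3 = 1;
  st4 : nreg s 4 = 0; st5 : nreg s 5 = a + a; st6 : nreg s 6 = a + a + n;
  st8 : nreg s 8 = B; st11 : nreg s 11 = m; st12 : nreg s 12 = t;
  stadj : adj e s;
  stk : forall v : 'I_n, nreg s (a + a + n + v) = k v;
  strm : forall v : 'I_n, rreg s (xb + v) = rm v;
  strl : forall v : 'I_n, rreg s (xb + n + v) = rl v }.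

(** What one sampling step may not touch: the parameters below 13, and everything from 26 on except
    the current configuration. *)
Definition keep (s s' : mst) : Prop :=
  forall j, (j < 13) || (26 <= j) && ~~ (a + a <= j < a + a + n) -> nreg s' j = nreg s j.

Lemma a64 : 64 <= a. Proof. by rewrite /abase; lia. Qed.
Lemma xb64 : 64 <= xb. Proof. by rewrite /xbase; lia. Qed.

Lemma stat_keep (s s' : mst) : stat s -> keep s s' ->
  (forall j, xb <= j < xb + 2 * n -> rreg s' j = rreg s j) -> stat s'.
Proof.
move=> [h0 h1 h2 h3 h4 h5 h6 h8 h11 h12 ha hk hm hl] kp rp; have := a64 => a64.
split; rewrite ?kp //.
- move=> u v; rewrite kp ?ha //; have := ord_pair_lt u v; rewrite /abase; lia.
- by move=> v; rewrite kp ?hk //; lia.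
- by move=> v; rewrite rp ?hm //; have := ltn_ord v; lia.
- by move=> v; rewrite rp ?hl //; have := ltn_ord v; lia.
Qed.

Definition occ (s : mst) (S : {set 'I_n}) : Prop :=
  forall v : 'I_n, nreg s (a + a + v) = (v \in S).

(** Column [v] of the matrix is read by stepping [n] registers at a time, which avoids a
    multiplication and by symmetry lists the neighbours. Adjacency bit plus occupation bit equals 2
    exactly at an occupied neighbour. *)
Definition scan : cmd :=
  Seq (Block [:: NConst 18 0; NAdd 19 1 3; NAdd 19 19 16; NAdd 20 5 4; NConst 21 0])
  (Until (TLeN 0 18)
    (Seq (Block [:: NLoad 22 19; NLoad 23 20; NAdd 22 22 23; NConst 23 2])
    (Seq (If (TLeN 23 22) (Block [:: NConst 21 1]) (Block [::]))
    (Block [:: NAdd 19 19 0; NAdd 20 20 3; NAdd 18 18 3])))).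

Lemma tot_scan (s : mst) (v : 'I_n) (S : {set 'I_n}) K (Q : mst -> Prop) :
  stat s -> occ s S -> nreg s 16 = v -> 12 * n + 6 <= K ->
  (forall s', nreg s' 21 = ~~ [disjoint S & nbr e v] ->
     (forall j, j \notin [:: 18; 19; 20; 21; 22; 23] -> nreg s' j = nreg s j) ->
     rreg s' = rreg s -> used s' = used s -> Q s') ->
  tot scan s K Q.
Proof.
move=> st oc s16 KK H; have a64 := a64.
have [h0 h1 _ h3 h4 h5 _ _ _ _ ha _ _ _] := st.
apply: (tot_conseq (K := 5 + (n * (4 + (3 + 3)).+2).+1) (Q := Q)) => //; last by lia.
apply: tot_seq; apply: tot_blockW => //.
pose hit i := [exists u : 'I_n, [&& u < i, u \in S & e v u]].
pose I i (s' : mst) := [/\ nreg s' 18 = i, nreg s' 19 = a + 1 + i * n + v, nreg s' 20 = a + a + i,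
   nreg s' 21 = hit i & [/\
   (forall j, j \notin [:: 18; 19; 20; 21; 22; 23] -> nreg s' j = nreg s j),
     rreg s' = rreg s & used s' = used s]].
apply: (tot_conseq (tot_until (K := 4 + (3 + 3)) (n := n) (I := I) _ _ _)) => //.
- split; rewrite /= ?/upd /= ?h1 ?h3 ?s16 ?h4 ?h5 ?addn0 ?mul0n ?addn0 //.
    by rewrite /hit; case: existsP => // -[u]; rewrite ltn0.
  by split => // j; rewrite !inE => hj; other_reg.
- move=> i s' iN [g1 g2 g3 g4 [g5 g6 g7]]; split.
    by rewrite /= g1 g5 // h0; lia.
  pose u := Ordinal iN.
  have gadj : nreg s' (a + 1 + i * n + v) = e v u.
    by rewrite g5; [rewrite esym; exact: (ha u v)|rewrite !inE; lia].
  have gocc : nreg s' (a + a + i) = (u \in S) by rewrite g5 ?inE; [exact: (oc u)|lia].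
  apply: tot_seq; apply: tot_blockW => //; set s1 := sems _ _ s'.
  have k22 : nreg s1 22 = e v u + (u \in S).
    rewrite /s1 /= /upd /= g2 gadj g3; case: eqP => [?|_]; first by lia.
    by rewrite gocc.
  have k23 : nreg s1 23 = 2 by [].
  have kj j : j \notin [:: 22; 23] -> nreg s1 j = nreg s' j.
    by rewrite !inE => hj; rewrite /s1 /= /upd; other_reg.
  have kr : rreg s1 = rreg s' by []. have ku : used s1 = used s' by [].
  move: s1 k22 k23 kj kr ku => s1 k22 k23 kj kr ku.
  apply: tot_seq.
  apply: (tot_conseq (K := 3) (Q := fun s2 => [/\ nreg s2 21 = hit i.+1,
     (forall j, j \notin [:: 21; 22; 23] -> nreg s2 j = nreg s' j), rreg s2 = rreg s' & used s2 = used s'])) => //.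
    have hitS : hit i.+1 = hit i || (e v u && (u \in S)).
      apply/existsP/orP => [[w /and3P[]]|].
        rewrite ltnS leq_eqVlt => /orP[/eqP wi|wi] wS ew.
          by right; rewrite (_ : u = w) ?ew ?wS //; apply: val_inj.
        by left; apply/existsP; exists w; rewrite wi wS.
      case=> [/existsP[w /and3P[wi wS ew]]|/andP[eu uS]].
        by exists w; rewrite wS ew ltnW.
      by exists u; rewrite uS eu ltnSn.
    apply: tot_if => /=; rewrite k22 k23 => hh.
      apply: tot_blockW => //; split => //=.
      - by rewrite /upd /= hitS; move: hh; case: (e v u); case: (u \in S); rewrite ?orbT.
      - by move=> j; rewrite !inE => hj; rewrite /upd; case: eqP => [?|_]; [lia|rewrite kj // !inE; lia].
    apply: tot_blockW => //; split => //=.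
    - by rewrite kj // g4 hitS; move: hh; case: (e v u); case: (u \in S); rewrite ?orbF.
    - by move=> j; rewrite !inE => hj; rewrite kj // !inE; lia.
  move=> s2 [f1 f2 f3 f4]; apply: tot_blockW => //.
  have f0 : nreg s2 0 = n by rewrite f2 // g5.
  have ff3 : nreg s2 3 = 1 by rewrite f2 // g5.
  split; rewrite /= ?/upd /= ?f0 ?ff3 ?f1 ?f2 // ?g1 ?g2 ?g3 ?addn1 ?addnS //.
  + by rewrite mulSn; lia.
  + split; [|by rewrite f3|by rewrite f4] => j; rewrite !inE => hj.
    by other_reg; rewrite f2 ?g5 // !inE; lia.
- by move=> s' [g1 _ _ _ [g5 _ _]]; rewrite /= g1 g5 // h0.
move=> s' [_ _ _ g4 [g5 g6 g7]]; apply: H => //.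
rewrite g4; congr nat_of_bool; apply/existsP/negP => [[u /and3P[_ uS eu]] dj|dj].
  by move: (disjointFr dj uS); rewrite inE eu.
have /pred0Pn[u /= /andP[uS]] := introN idP dj.
by rewrite inE => eu; exists u; rewrite ltn_ord uS.
Qed.

(** The machine only tests [<=] on naturals, so [w] is incremented to decide [w < k v]. *)
Definition update : cmd :=
  Seq scan
  (Seq (Block [:: NAdd 19 6 16; NLoad 23 19; NAdd 17 17 3])
  (Seq (If (TLeN 17 23)
          (If (TLeN 3 21) (Block [:: NConst 22 0]) (Block [:: NConst 22 1]))
          (Block [:: NConst 22 0]))
  (Block [:: NAdd 19 5 16; NStore 19 22]))).

Lemma tot_update (s : mst) (v : 'I_n) w (S : {set 'I_n}) K (Q : mst -> Prop) :
  stat s -> occ s S -> nreg s 16 = v -> nreg s 17 = w -> 12 * n + 16 <= K ->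
  (forall s', occ s' (if (w < k v) && [disjoint S & nbr e v] then v |: S else S :\ v) ->
     keep s s' -> (forall j, j \in [:: 13; 14; 15] -> nreg s' j = nreg s j) ->
     rreg s' = rreg s -> used s' = used s -> Q s') ->
  tot update s K Q.
Proof.
move=> st oc s16 s17 KK H; have a64 := a64; have vn := ltn_ord v.
have [h0 h1 _ h3 h4 h5 h6 _ _ _ _ hk _ _] := st.
apply: (tot_conseq (K := (12 * n + 6) + (3 + (5 + 2))) (Q := Q)) => //; last by lia.
apply: tot_seq; apply: (tot_scan st oc s16) => // s1 g21 gj gr gu.
apply: tot_seq; apply: tot_blockW => //; set s2 := sems _ _ s1.
have gj' j : j < 18 -> nreg s1 j = nreg s j by move=> hj; apply: gj; rewrite !inE; lia.
have k23 : nreg s2 23 = k v.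
  rewrite /s2 /= /upd /= (gj' 6) // (gj' 16) // h6 s16; case: eqP => [?|_]; first by lia.
  by rewrite gj ?hk // !inE; lia.
have k17 : nreg s2 17 = w.+1 by rewrite /s2 /= /upd /= !gj' // h3 s17 addn1.
have k21 : nreg s2 21 = ~~ [disjoint S & nbr e v] by rewrite /s2 /= /upd /= g21.
have kj j : j \notin [:: 17; 18; 19; 20; 21; 22; 23] -> nreg s2 j = nreg s j.
  rewrite !inE => hj; rewrite /s2 /= /upd; other_reg.
  by apply: gj; rewrite !inE; lia.
have kr : rreg s2 = rreg s by []. have ku : used s2 = used s by [].
move: s2 k23 k17 k21 kj kr ku => s2 k23 k17 k21 kj kr ku.
apply: tot_seq.
pose b := (w < k v) && [disjoint S & nbr e v].
apply: (tot_conseq (K := 5) (Q := fun s3 => [/\ nreg s3 22 = b,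
   (forall j, j \notin [:: 17; 18; 19; 20; 21; 22; 23] -> nreg s3 j = nreg s j), rreg s3 = rreg s & used s3 = used s])) => //.
  have other x j : j \notin [:: 17; 18; 19; 20; 21; 22; 23] -> upd (nreg s2) 22 x j = nreg s j.
    by move=> hj; have := hj; rewrite !inE => h; rewrite /upd; case: eqP => [?|_]; [lia|apply: kj].
  apply: tot_if => /=; rewrite k17 k23 => hw.
    apply: tot_if => /=; rewrite k21 kj // h3 => hd; apply: tot_blockW => //; split => //=;
      try exact: other.
    - by rewrite /upd /= /b hw; move: hd; case: [disjoint _ & _].
    - by rewrite /upd /= /b hw; move: hd; case: [disjoint _ & _].
  apply: tot_blockW => //; split => //=; last exact: other.
  by rewrite /upd /= /b (negbTE hw).
move=> s3 [f22 fj fr fu].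
have f5 : nreg s3 5 = a + a by rewrite fj.
have f16 : nreg s3 16 = v by rewrite fj.
apply: tot_blockW => //; apply: H => //=.
- move=> x; rewrite /= /upd /= f5 f16 f22; have xn := ltn_ord x.
  case: eqP => [E|ne].
    have -> : x = v by apply: ord_inj; lia.
    by rewrite -/b; case: (b); rewrite ?setU11 ?setD11.
  have xv : (x == v) = false by apply/eqP => xv; apply: ne; rewrite xv.
  case: eqP => [?|_]; first by lia.
  rewrite fj ?oc; last by rewrite !inE; lia.
  by case: ifP => _; rewrite !inE xv.
- move=> j hj; rewrite /= /upd /= f5 f16; other_reg.
  by apply: fj; rewrite !inE; lia.
- move=> j; rewrite !inE => hj; rewrite /= /upd /= f5 f16; other_reg.
  by apply: fj; rewrite !inE; lia.
Qed.

(** Both numbers are drawn before the idle slots are sorted out, so each step uses the same number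
    of coins and the sample positions are predictable. *)
Definition gl_step : cmd :=
  Seq (draw 16) (Seq (draw 17) (If (TLeN 0 16) (Block [::]) update)).

Lemma tot_step (s : mst) (S : {set 'I_n}) K (Q : mst -> Prop) :
  stat s -> occ s S -> 12 * n + 12 * B + 24 <= K ->
  (forall s', occ s' (gstep e k S (bval (seg bits (used s) B)) (bval (seg bits (used s + B) B))) ->
     keep s s' -> (forall j, j \in [:: 13; 14; 15] -> nreg s' j = nreg s j) ->
     rreg s' = rreg s -> used s' = used s + (B + B) -> Q s') ->
  tot gl_step s K Q.
Proof.
move=> st oc KK H; have a64 := a64.
have [h0 _ _ h3 _ _ _ h8 _ _ _ _ _ _] := st.
apply: (tot_conseq (K := (6 * B + 3) + ((6 * B + 3) + (12 * n + 16).+2)) (Q := Q)) => //; last by lia.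
apply: tot_seq; apply: (tot_draw _ h3 h8) => // s1 g16 gj gr gu.
have g3 : nreg s1 3 = 1 by rewrite gj. have g8 : nreg s1 8 = B by rewrite gj.
apply: tot_seq; apply: (tot_draw _ g3 g8) => // s2 f17 fj fr fu.
have f16 : nreg s2 16 = bval (seg bits (used s) B) by rewrite fj.
have sj j : j \notin [:: 16; 17; 18; 19] -> nreg s2 j = nreg s j.
  by rewrite !inE => hj; rewrite fj ?gj // !inE; lia.
have kp : keep s s2 by move=> j hj; apply: sj; rewrite !inE; lia.
have kp3 j : j \in [:: 13; 14; 15] -> nreg s2 j = nreg s j.
  by rewrite !inE => hj; apply: sj; rewrite !inE; lia.
have oc2 : occ s2 S by move=> v; rewrite sj ?oc // !inE; lia.
have st2 : stat s2 by apply: (stat_keep st kp) => j _; rewrite fr gr.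
rewrite gu in f17.
apply: tot_if => /=; rewrite f16 sj // h0 => hn.
  apply: tot_blockW => //; apply: H => //=; rewrite ?fr ?gr ?fu ?gu ?addnA //.
  by rewrite /gstep insubF // ltnNge hn.
rewrite -ltnNge in hn; set v := Ordinal hn.
apply: (@tot_update s2 v _ S _ _ st2 oc2 _ f17) => // s3 o3 k3 k3' r3 u3.
apply: H; rewrite ?r3 ?u3 ?fr ?gr ?fu ?gu ?addnA //.
- by rewrite /gstep insubT.
- by move=> j hj; rewrite k3 // kp.
- by move=> j hj; rewrite k3' // kp3.
Qed.

Definition reset : cmd :=
  Seq (Block [:: NConst 18 0; NAdd 19 5 4])
  (Until (TLeN 0 18) (Block [:: NStore 19 4; NAdd 18 18 3; NAdd 19 19 3])).

Lemma tot_reset (s : mst) K (Q : mst -> Prop) : stat s -> 5 * n + 3 <= K ->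
  (forall s', occ s' set0 -> keep s s' ->
     (forall j, j \in [:: 13; 14; 15] -> nreg s' j = nreg s j) ->
     rreg s' = rreg s -> used s' = used s -> Q s') ->
  tot reset s K Q.
Proof.
move=> [h0 _ _ h3 h4 h5 _ _ _ _ _ _ _ _] KK H; have a64 := a64.
apply: (tot_conseq (K := 2 + (n * 5).+1) (Q := Q)) => //; last by lia.
apply: tot_seq; apply: tot_blockW => //.
pose I i (s' : mst) := [/\ nreg s' 18 = i, nreg s' 19 = a + a + i,
   (forall v : 'I_n, v < i -> nreg s' (a + a + v) = 0),
   (forall j, j \notin [:: 18; 19] -> ~~ (a + a <= j < a + a + n) -> nreg s' j = nreg s j) &
     rreg s' = rreg s /\ used s' = used s].
apply: (tot_conseq (tot_until (K := 3) (n := n) (I := I) _ _ _)) => //.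
- split; rewrite /= ?/upd /= ?h5 ?h4 ?addn0 //.
  by move=> j; rewrite !inE => hj _; other_reg.
- move=> i s' iN [g1 g2 g3 g4 [g5 g6]].
  have g0 : nreg s' 0 = n by rewrite g4 // ?inE; lia.
  have g0' : nreg s' 3 = 1 by rewrite g4 // ?inE; lia.
  have g4' : nreg s' 4 = 0 by rewrite g4 // ?inE; lia.
  split; first by rewrite /= g0 g1; lia.
  have f x y : (x == a + a + y) = false -> upd (nreg s') (a + a + y) 0 x = nreg s' x.
    by rewrite /upd => ->.
  apply: tot_blockW => //; split; rewrite /= ?g2 ?g4'.
  + rewrite /upd /=; other_reg; by rewrite g1 g0' addn1.
  + rewrite /upd /=; other_reg; by rewrite g2 g0' addn1 addnS.
  + move=> v vi; rewrite /upd /=; do 2 (case: eqP => [?|_]; first by lia).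
    by case: eqP => // ne; apply: g3; lia.
  + move=> j hj nj; have := hj; rewrite !inE => h; rewrite /upd /=.
    by other_reg; apply: g4.
  + by split.
- by move=> s' [g1 _ _ g4 _]; rewrite /= g1 g4 ?h0 // ?inE; lia.
move=> s' [_ _ g3 g4 [g5 g6]]; apply: H => //.
- by move=> v; rewrite inE g3.
- by move=> j hj; apply: g4; rewrite ?inE; lia.
- by move=> j; rewrite !inE => hj; apply: g4; rewrite ?inE; lia.
Qed.

Definition weights : cmd :=
  Seq (Block [:: RConst 5 1; RConst 6 1; NConst 18 0; NAdd 19 5 4; NAdd 20 2 4; NAdd 21 2 0])
  (Until (TLeN 0 18)
   (Seq (Block [:: NLoad 22 19])
   (Seq (If (TLeN 3 22) (Block [:: RLoad 7 20; RMul 5 5 7; RLoad 7 21; RMul 6 6 7]) (Block [::]))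
   (Block [:: NAdd 18 18 3; NAdd 19 19 3; NAdd 20 20 3; NAdd 21 21 3])))).

Lemma tot_weights (s : mst) (S : {set 'I_n}) K (Q : mst -> Prop) :
  stat s -> occ s S -> 13 * n + 7 <= K ->
  (forall s', rreg s' 5 = (\prod_(v in S) rm v)%R -> rreg s' 6 = (\prod_(v in S) rl v)%R ->
     keep s s' -> (forall j, j \in [:: 13; 14; 15] -> nreg s' j = nreg s j) ->
     (forall j, j \notin [:: 5; 6; 7] -> rreg s' j = rreg s j) -> used s' = used s -> Q s') ->
  tot weights s K Q.
Proof.
move=> st oc KK H; have a64 := a64; have xb64 := xb64.
have [h0 _ h2 h3 h4 h5 _ _ _ _ _ _ hm hl] := st.
apply: (tot_conseq (K := 6 + (n * (1 + (6 + 4)).+2).+1) (Q := Q)) => //; last by lia.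
apply: tot_seq; apply: tot_blockW => //.
pose W (r : 'I_n -> R) i := (\prod_(v : 'I_n | (v < i)%N && (v \in S)) r v)%R.
have WS r (u : 'I_n) : W r u.+1 = (W r u * (if u \in S then r u else 1))%R.
  rewrite /W; case: ifPn => uS; last first.
    rewrite mulr1; apply: eq_bigl => v; rewrite ltnS leq_eqVlt; case: eqP => //= vu.
    by rewrite (_ : v = u) ?(negbTE uS) ?andbF //; apply: val_inj.
  rewrite (bigD1 u) /=; last by rewrite ltnSn uS.
  rewrite mulrC; congr (_ * _)%R; apply: eq_bigl => v; rewrite ltnS leq_eqVlt -val_eqE /=.
  by case: eqP => //= vu; rewrite ?andbT // vu ltnn andbF.
pose I i (s' : mst) := [/\ [/\ nreg s' 18 = i, nreg s' 19 = a + a + i, nreg s' 20 = xb + i &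
     nreg s' 21 = xb + n + i], rreg s' 5 = W rm i, rreg s' 6 = W rl i,
   (forall j, j \notin [:: 18; 19; 20; 21; 22] -> nreg s' j = nreg s j) &
   (forall j, j \notin [:: 5; 6; 7] -> rreg s' j = rreg s j) /\ used s' = used s].
apply: (tot_conseq (tot_until (K := 1 + (6 + 4)) (n := n) (I := I) _ _ _)) => //.
- have W0 r : W r 0 = 1%R by rewrite /W big1 // => v /andP[].
  split; rewrite /= ?/upd /= ?W0 ?h5 ?h4 ?h2 ?h0 ?addn0 //.
  + by move=> j; rewrite !inE => hj; other_reg.
  + by split => // j; rewrite !inE => hj; other_reg.
- move=> i s' iN [[g1 g2 g3 g4] g5 g6 g7 [g8 g9]]; pose u := Ordinal iN.
  split; first by rewrite /= g1 g7 // h0; lia.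
  apply: tot_seq; apply: tot_blockW => //; set s1 := sems _ _ s'.
  have k22 : nreg s1 22 = (u \in S).
    by rewrite /s1 /= /upd /= g2 g7; [exact: (oc u)|rewrite !inE; lia].
  have kj j : j != 22 -> nreg s1 j = nreg s' j.
    by move=> hj; rewrite /s1 /= /upd; case: eqP => [?|_]; first by lia.
  have kr : rreg s1 = rreg s' by []. have ku : used s1 = used s' by [].
  move: s1 k22 kj kr ku => s1 k22 kj kr ku.
  apply: tot_seq.
  apply: (tot_conseq (K := 6) (Q := fun s2 => [/\ rreg s2 5 = W rm i.+1, rreg s2 6 = W rl i.+1,
     nreg s2 = nreg s1, used s2 = used s &
     (forall j, j \notin [:: 5; 6; 7] -> rreg s2 j = rreg s j)])) => //.
    have lm : rreg s1 (xb + i) = rm u by rewrite kr g8 ?inE; [exact: (hm u)|lia].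
    have ll : rreg s1 (xb + n + i) = rl u by rewrite kr g8 ?inE; [exact: (hl u)|lia].
    apply: tot_if => /=; rewrite k22 kj // g7 // h3 => hu.
      have uS : u \in S by move: hu; case: (u \in S).
      apply: tot_blockW => //; split; rewrite /= ?/upd /= ?kj ?g3 ?g4 ?lm ?kr ?g5 ?g6 //.
      + by rewrite (WS rm u) uS.
      + rewrite (WS rl u) uS; other_reg.
        by rewrite -kr ll.
      + by rewrite ku.
      + by move=> j hj; have := hj; rewrite !inE => h; other_reg; apply: g8.
    have uS : (u \in S) = false by move: hu; case: (u \in S).
    apply: tot_blockW => //; split => //=; rewrite ?kr ?g5 ?g6 ?ku //.
    - by rewrite (WS rm u) uS mulr1.
    - by rewrite (WS rl u) uS mulr1.
  move=> s2 [f5 f6 fn fu fr]; apply: tot_blockW => //.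
  split; rewrite /= ?/upd /= ?fn ?kj ?g1 ?g2 ?g3 ?g4 ?g7 // ?h3 ?addn1 ?addnS //.
  by move=> j hj; have := hj; rewrite !inE => h; other_reg; rewrite kj ?g7 //; lia.
- by move=> s' [[g1 _ _ _] _ _ g7 _]; rewrite /= g1 g7 // h0.
move=> s' [_ g5 g6 g7 [g8 g9]].
have Wn r : W r n = (\prod_(v in S) r v)%R by apply: eq_bigl => v; rewrite ltn_ord.
apply: H => //; rewrite ?g5 ?g6 ?Wn //.
- by move=> j hj; apply: g7; rewrite !inE; lia.
- by move=> j; rewrite !inE => hj; apply: g7; rewrite !inE; lia.
Qed.

End Sampler.

(** * The sampling loop and the final sum *)

Section Main.
Variables (R : realType) (bits : nat -> bool).
Local Notation mst := (mstate R).
Local Notation tot := (tot bits).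
Variables (n : nat) (e : rel 'I_n).
Hypothesis esym : forall u v, e u v = e v u.
Variables (k : 'I_n -> nat) (rm rl : 'I_n -> R) (B m t : nat).
Local Notation a := (abase n).
Local Notation xb := (xbase n).
Local Notation stat := (stat e k rm rl B m t).
Local Notation occ := (@occ R n).
Local Notation keep := (@keep R n).
Local Notation q := (t * (B + B)).
Local Notation smp := (walk B (gstep e k) t set0).

Definition walk_loop : cmd :=
  Seq (Block [:: NConst 15 0])
  (Until (TLeN 12 15) (Seq gl_step (Block [:: NAdd 15 15 3]))).

Lemma tot_walk_loop (s : mst) K (Q : mst -> Prop) :
  stat s -> occ s set0 -> t * (12 * n + 12 * B + 27) + 2 <= K ->
  (forall s', occ s' (smp (seg bits (used s) q)) -> keep s s' ->
     (forall j, j \in [:: 13; 14] -> nreg s' j = nreg s j) ->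
     rreg s' = rreg s -> used s' = used s + q -> Q s') ->
  tot walk_loop s K Q.
Proof.
move=> st oc KK H.
apply: (tot_conseq (K := 1 + (t * ((12 * n + 12 * B + 24) + 1).+2).+1) (Q := Q)) => //; last by lia.
have a64 := a64 n.
apply: tot_seq; apply: tot_blockW => //.
pose I i (s' : mst) := [/\ nreg s' 15 = i,
   occ s' (walk B (gstep e k) i set0 (seg bits (used s) (i * (B + B)))), keep s s',
   (forall j, j \in [:: 13; 14] -> nreg s' j = nreg s j) &
     rreg s' = rreg s /\ used s' = used s + i * (B + B)].
apply: (tot_conseq (tot_until (K := (12 * n + 12 * B + 24) + 1) (n := t) (I := I) _ _ _)) => //.
- split; rewrite /= ?/upd /= //.
  + by move=> v; rewrite /= /upd; case: eqP => [?|_]; [lia|apply: oc].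
  + by move=> j hj; rewrite /= /upd; case: eqP => [?|_]; first by lia.
  + by move=> j; rewrite !inE => hj; case: eqP => [?|_]; first by lia.
  + by rewrite mul0n addn0.
- move=> i s' it [g1 g2 g3 g4 [g5 g6]].
  have st' : stat s' by apply: (stat_keep st g3) => j _; rewrite g5.
  split; first by rewrite /= g1 (st12 st'); lia.
  apply: tot_seq; apply: (tot_step esym st' g2) => // s1 f1 f2 f3 f4 f5.
  have f15 : nreg s1 15 = i by rewrite f3.
  have ff3 : nreg s1 3 = 1 by rewrite f2 // (st3 st').
  apply: tot_blockW => //; split.
  + by rewrite /= /upd /= f15 ff3 addn1.
  + by move=> v; rewrite walkSr -g6 -(f1 v) /= /upd; case: eqP => [?|_]; first by lia.
  + by move=> j hj; rewrite /= /upd; case: eqP => [?|_]; [lia|rewrite f2 // g3].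
  + move=> j; rewrite !inE => hj; rewrite /= /upd; case: eqP => [?|_]; first by lia.
    by rewrite f3 ?g4 // !inE; lia.
  + by rewrite /= f4 f5 g5 g6 mulSn; split => //; lia.
- by move=> s' [g1 _ g3 _ _]; rewrite /= g1 g3 // (st12 st).
by move=> s' [g1 g2 g3 g4 [g5 g6]]; apply: H.
Qed.

(** The two reweights are stored as well as added to the totals: the estimate divides by totals that
    are complete only after the last sample, so a second pass is needed. *)
Definition one_sample : cmd :=
  Seq reset (Seq walk_loop (Seq weights
  (Seq (Block [:: RStore 13 5; NAdd 13 13 3])
  (Block [:: RStore 13 6; NAdd 13 13 3; RAdd 3 3 5; RAdd 4 4 6; NAdd 14 14 3])))).

Definition sbase := xb + 2 * n + 1.
Definition rprod (r : 'I_n -> R) (S : {set 'I_n}) : R := (\prod_(v in S) r v)%R.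

Definition Tsample := t * (12 * n + 12 * B + 27) + 18 * n + 19.

Lemma tot_one_sample (s : mst) p (Q : mst -> Prop) (S := smp (seg bits (used s) q)) :
  stat s -> nreg s 13 = p -> sbase <= p ->
  (forall s', stat s' -> nreg s' 13 = p + 2 -> nreg s' 14 = nreg s 14 + 1 ->
     rreg s' p = rprod rm S -> rreg s' (p + 1) = rprod rl S ->
     rreg s' 3 = (rreg s 3 + rprod rm S)%R -> rreg s' 4 = (rreg s 4 + rprod rl S)%R ->
     (forall j, sbase <= j -> j != p -> j != p + 1 -> rreg s' j = rreg s j) ->
     used s' = used s + q -> Q s') ->
  tot one_sample s Tsample Q.
Proof.
move=> st s13 hp H; have a64 := a64 n; have xb64 := xb64 n.
have sbaseE : sbase = xb + 2 * n + 1 by [].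
apply: (tot_conseq (K := (5 * n + 3) + ((t * (12 * n + 12 * B + 27) + 2) + ((13 * n + 7) + (2 + 5)))) (Q := Q)) => //; last first.
  by rewrite /Tsample; lia.
apply: tot_seq; apply: (tot_reset _ st) => // s1 o1 k1 k1' r1 u1.
have st1 : stat s1 by apply: (stat_keep st k1) => j _; rewrite r1.
apply: tot_seq; apply: (tot_walk_loop st1 o1) => // s2 o2 k2 k2' r2 u2.
rewrite u1 -/S in o2.
have st2 : stat s2 by apply: (stat_keep st1 k2) => j _; rewrite r2.
apply: tot_seq; apply: (tot_weights _ st2 o2) => // s3 x5 x6 k3 k3' r3 u3.
have st3' : stat s3.
  by apply: (stat_keep st2 k3) => j hj; rewrite r3 // !inE; lia.
have c13 : nreg s3 13 = p by rewrite k3' // k2' // k1'.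
have c14 : nreg s3 14 = nreg s 14 by rewrite k3' // k2' // k1'.
have c3 : nreg s3 3 = 1 by exact: st3 st3'.
have rr j : j \notin [:: 5; 6; 7] -> rreg s3 j = rreg s j by move=> hj; rewrite r3 // r2 r1.
apply: tot_seq; apply: tot_blockW => //; set s4 := sems _ _ s3.
have d13 : nreg s4 13 = p.+1 by rewrite /s4 /= /upd /= c13 c3 addn1.
have dn j : j != 13 -> nreg s4 j = nreg s3 j by move=> /negbTE hj; rewrite /s4 /= /upd hj.
have dx j : rreg s4 j = if j == p then rprod rm S else rreg s3 j.
  by rewrite /s4 /= /upd /= c13 x5.
have du : used s4 = used s3 by [].
move: s4 d13 dn dx du => s4 d13 dn dx du.
have ny i : i < 64 -> (i == p) = false /\ (i == p.+1) = false by move=> hi; split; apply/eqP; lia.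
apply: tot_blockW => //; set s5 := sems _ _ s4.
have ex j : rreg s5 j = if j == 4 then (rreg s 4 + rprod rl S)%R else
   if j == 3 then (rreg s 3 + rprod rm S)%R else if j == p.+1 then rprod rl S else
   if j == p then rprod rm S else rreg s3 j.
  have [q3 q3'] := ny 3 isT; have [q4 q4'] := ny 4 isT; have [q5 q5'] := ny 5 isT; have [q6 q6'] := ny 6 isT.
  by rewrite /s5 /= /upd /= d13 q3' q4' q5' q6' !dx q3 q4 q5 q6 x5 x6 (rr 4) // (rr 3).
have e13 : nreg s5 13 = p + 2 by rewrite /s5 /= /upd /= d13 dn // c3; lia.
have e14 : nreg s5 14 = nreg s 14 + 1 by rewrite /s5 /= /upd /= !dn // c14 c3.
have en j : j \notin [:: 13; 14] -> nreg s5 j = nreg s3 j.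
  by rewrite !inE => hj; rewrite /s5 /= /upd; other_reg; apply: dn; lia.
have eu : used s5 = used s3 by [].
move: s5 ex e13 e14 en eu => s5 ex e13 e14 en eu.
apply: H => //.
- apply: (stat_keep st3'); first by move=> j hj; apply: en; rewrite !inE; lia.
  by move=> j hj; rewrite ex; other_reg.
- by rewrite ex; do 3 (case: eqP => [?|_]; first by lia); rewrite eqxx.
- by rewrite ex; do 2 (case: eqP => [?|_]; first by lia); rewrite addn1 eqxx.
- move=> j hj /eqP j1 /eqP j2; rewrite ex; other_reg.
  by rewrite rr // !inE; lia.
- by rewrite eu u3 u2 u1.
Qed.

Definition sample_loop : cmd :=
  Seq (Block [:: NAdd 13 2 0; NAdd 13 13 0; NAdd 13 13 3; NConst 14 0; RConst 3 0; RConst 4 0])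
  (Until (TLeN 11 14) one_sample).

Definition nth_sample (o i : nat) : {set 'I_n} := smp (seg bits (o + i * q) q).

Lemma tot_sample_loop (s : mst) K (Q : mst -> Prop) (x := nth_sample (used s)) :
  stat s -> m * Tsample.+2 + 7 <= K ->
  (forall s', stat s' ->
     rreg s' 3 = (\sum_(i <- iota 0 m) rprod rm (x i))%R ->
     rreg s' 4 = (\sum_(i <- iota 0 m) rprod rl (x i))%R ->
     (forall i, i < m -> rreg s' (sbase + 2 * i) = rprod rm (x i) /\ rreg s' (sbase + 2 * i + 1) = rprod rl (x i)) ->
     Q s') ->
  tot sample_loop s K Q.
Proof.
move=> st KK H; have a64 := a64 n; have xb64 := xb64 n.
apply: (tot_conseq (K := 6 + (m * Tsample.+2).+1) (Q := Q)) => //; last by lia.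
apply: tot_seq; apply: tot_blockW => //.
pose I i (s' : mst) := [/\ stat s', nreg s' 13 = sbase + 2 * i /\ nreg s' 14 = i,
   used s' = used s + i * q,
   rreg s' 3 = (\sum_(j <- iota 0 i) rprod rm (x j))%R /\ rreg s' 4 = (\sum_(j <- iota 0 i) rprod rl (x j))%R &
   (forall j, j < i -> rreg s' (sbase + 2 * j) = rprod rm (x j) /\ rreg s' (sbase + 2 * j + 1) = rprod rl (x j))].
have iotaS i (F : nat -> R) : (\sum_(j <- iota 0 i.+1) F j = \sum_(j <- iota 0 i) F j + F i)%R.
  by rewrite -addn1 iotaD big_cat /= big_seq1.
apply: (tot_conseq (tot_until (K := Tsample) (n := m) (I := I) _ _ _)) => //.
- set s1 := sems _ _ s; split.
  + apply: (stat_keep st).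
      by move=> j hj; rewrite /s1 /= /upd; other_reg.
    by move=> j hj; rewrite /s1 /= /upd; other_reg.
  + split => //; rewrite /s1 /= /upd /= (st0 st) (st2 st) (st3 st) /sbase; lia.
  + by rewrite mul0n addn0.
  + by split; rewrite big_nil.
  + by [].
- move=> i s' im [g1 [g2 g3] g4 [g5 g6] g7].
  split; first by rewrite /= g3 (st11 g1); lia.
  apply: (tot_one_sample g1 g2); first by lia.
  have xE : smp (seg bits (used s') q) = x i by rewrite g4.
  rewrite xE => s1 h1 h2 h3 h4 h5 h6 h7 h8 h9; split => //.
  + by rewrite h2 h3 g3; split; lia.
  + by rewrite h9 g4 mulSn; lia.
  + by rewrite h6 h7 g5 g6 !iotaS.
  + move=> j; rewrite ltnS leq_eqVlt => /orP[/eqP ->|ji]; first by split.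
    have [c1 c2] := g7 j ji; by split; rewrite h8 //; lia.
- by move=> s' [g1 [_ g3] _ _ _]; rewrite /= g3 (st11 g1).
by move=> s' [g1 [g2 g3] g4 [g5 g6] g7]; apply: H.
Qed.

Definition final_pass : cmd :=
  Seq (Block [:: NAdd 13 2 0; NAdd 13 13 0; NAdd 13 13 3; NConst 14 0; RConst 0 0; RConst 8 0])
  (Seq (Until (TLeN 11 14)
    (Seq (Block [:: RLoad 5 13; NAdd 13 13 3; RLoad 6 13; NAdd 13 13 3])
    (Seq (Block [:: RDiv 5 5 3; RDiv 6 6 4; RSub 5 5 6])
    (Seq (If (TLtR 5 8) (Block [:: RSub 5 8 5]) (Block [::]))
    (Block [:: RAdd 0 0 5; NAdd 14 14 3])))))
  (Block [:: RConst 5 2; RDiv 0 0 5])).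

Lemma tot_final_pass (s : mst) (f g : nat -> R) (A B' : R) K (Q : mst -> Prop) :
  stat s -> rreg s 3 = A -> rreg s 4 = B' ->
  (forall i, i < m -> rreg s (sbase + 2 * i) = f i /\ rreg s (sbase + 2 * i + 1) = g i) ->
  14 * m + 9 <= K ->
  (forall s', rreg s' 0 = (2^-1 * \sum_(i <- iota 0 m) `|f i / A - g i / B'|)%R -> Q s') ->
  tot final_pass s K Q.
Proof.
move=> st sA sB sf KK H; have xb64 := xb64 n.
have sbase64 : 64 <= sbase by rewrite /sbase; lia.
have h0 := st0 st; have h2 := st2 st; have h3 := st3 st; have h11 := st11 st.
apply: (tot_conseq (K := 6 + ((m * (4 + (3 + (3 + 2))).+2).+1 + 2)) (Q := Q)) => //; last by lia.
apply: tot_seq; apply: tot_blockW => //; set s1 := sems _ _ s.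
apply: tot_seq.
pose I i (s' : mst) := [/\ nreg s' 13 = sbase + 2 * i /\ nreg s' 14 = i,
   rreg s' 0 = (\sum_(j <- iota 0 i) `|f j / A - g j / B'|)%R, rreg s' 8 = 0%R,
   (forall j, j \notin [:: 13; 14] -> nreg s' j = nreg s j) &
   (forall j, j \notin [:: 0; 5; 6; 8] -> rreg s' j = rreg s j)].
have iotaS i (F : nat -> R) : (\sum_(j <- iota 0 i.+1) F j = \sum_(j <- iota 0 i) F j + F i)%R.
  by rewrite -addn1 iotaD big_cat /= big_seq1.
apply: (tot_conseq (tot_until (K := 4 + (3 + (3 + 2))) (n := m) (I := I) _ _ _)) => //.
- split; rewrite /s1 /= ?/upd /= ?big_nil // ?h2 ?h0 ?h3 /sbase.
  + by split => //; lia.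
  + by move=> j; rewrite !inE => hj; other_reg.
  + by move=> j; rewrite !inE => hj; other_reg.
- move=> i s' im [[g1 g2] g3 g4 g5 g6].
  split; first by rewrite /= g2 g5 // h11; lia.
  have [fi gi] := sf i im.
  have xf : rreg s' (sbase + 2 * i) = f i by rewrite g6 // !inE; lia.
  have xg : rreg s' (sbase + 2 * i + 1) = g i by rewrite g6 // !inE; lia.
  have g53 : nreg s' 3 = 1 by rewrite g5.
  apply: tot_seq; apply: tot_blockW => //; set s2 := sems _ _ s'.
  have a5 : rreg s2 5 = f i by rewrite /s2 /= /upd /= g1.
  have a6 : rreg s2 6 = g i.
    by rewrite /s2 /= /upd /= g1 g53; case: eqP => [?|_]; first by lia.
  have ax j : j \notin [:: 5; 6] -> rreg s2 j = rreg s' j.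
    by rewrite !inE => hj; rewrite /s2 /= /upd; other_reg.
  have an j : j != 13 -> nreg s2 j = nreg s' j.
    by move=> hj; rewrite /s2 /= /upd; other_reg.
  have a13 : nreg s2 13 = sbase + 2 * i.+1 by rewrite /s2 /= /upd /= g1 g53; lia.
  move: s2 a5 a6 ax an a13 => s2 a5 a6 ax an a13.
  apply: tot_seq; apply: tot_blockW => //; set s3 := sems _ _ s2.
  have b5 : rreg s3 5 = (f i / A - g i / B')%R.
    by rewrite /s3 /= /upd /= a5 a6 !ax // !g6 // sA sB.
  have bx j : j \notin [:: 5; 6] -> rreg s3 j = rreg s' j.
    by move=> hj; rewrite -ax //; move: hj; rewrite !inE => hj; rewrite /s3 /= /upd; other_reg.
  have bn : nreg s3 = nreg s2 by [].
  move: s3 b5 bx bn => s3 b5 bx bn.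
  apply: tot_seq.
  apply: (tot_conseq (K := 3) (Q := fun s4 => [/\ rreg s4 5 = `|f i / A - g i / B'|%R,
    (forall j, j \notin [:: 5; 6] -> rreg s4 j = rreg s' j) & nreg s4 = nreg s2])) => //.
    apply: tot_if => /=; rewrite b5 bx // g4 => h; apply: tot_blockW => //; split => //=.
    - by rewrite /upd /= b5 bx // g4 sub0r ltr0_norm.
    - by move=> j hj; have := hj; rewrite !inE => hh; rewrite /upd; case: eqP => [?|_]; [lia|apply: bx].
    - by rewrite b5 ger0_norm // leNgt.
  move=> s4 [c5 cx cn]; apply: tot_blockW => //.
  split; rewrite /= ?/upd /= ?cn ?a13 ?an ?g2 ?g53 ?addn1 //.
  + by rewrite (cx 0) // g3 c5 iotaS.
  + by rewrite cx.
  + by move=> j hj; have := hj; rewrite !inE => hh; case: eqP => [?|_]; [lia|rewrite an ?g5 //; lia].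
  + move=> j hj; have := hj; rewrite !inE => hh; case: eqP => [?|_]; first by lia.
    by rewrite cx ?g6 // !inE; lia.
- by move=> s' [[_ g2] _ _ g5 _]; rewrite /= g2 g5 // h11.
move=> s' [_ g3 _ _ _]; apply: tot_blockW => //; apply: H.
by rewrite /= /upd /= g3 mulrC.
Qed.

End Main.

Definition main_cmd (b0 : nat) : cmd :=
  Seq copy_graph (Seq copy_reals (Seq (double_M b0) (Seq double_E
  (Seq set_counts (Seq thresholds (Seq sample_loop final_pass)))))).

Lemma main_wf b0 : wf (main_cmd b0).
Proof. by []. Qed.

(** * The whole program on the encoded input *)

Section Run.
Variables (R : realType) (bits : nat -> bool).
Local Notation mst := (mstate R).
Variables (n : nat) (e : rel 'I_n) (lamm laml : 'I_n -> R) (eps : R).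
Hypothesis esym : forall u v, e u v = e v u.
Hypothesis eirr : forall v, e v v = false.
Hypothesis n4 : 4 <= n.
Variables (b0 y L : nat).
Hypothesis ny : n <= 2 ^ y.
Hypothesis ylow : forall i, i < y -> 2 ^ i < n.
Hypothesis PL : (1 < eps * (2 ^ L)%:R)%R.
Hypothesis Llow : forall i, i < L -> ~~ (1 < eps * (2 ^ i)%:R)%R.

Local Notation B := (b0 + y).
Local Notation M := (2 ^ B).
Local Notation E := (2 ^ L).
Definition thr (v : 'I_n) : nat := kthr (Num.max (lamm v) (laml v)) M.
Local Notation t := (M ^ 3 * (B + L)).
Local Notation m := (M * M * E * E).
Local Notation q := (t * (B + B)).

Definition Ttotal := (11 * abase n + 30) + ((12 * n + 11) + ((5 * y + 6) + ((5 * L + 7)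
  + ((8 * M + 4 * (B + L) + 8 * E + 20) + ((n * (5 * M + 23) + 8)
  + ((m * (Tsample n B t).+2 + 7) + (14 * m + 9))))))).

Lemma init_nat0 : nreg (init_state e lamm laml eps) 0 = n. Proof. by []. Qed.

Lemma init_adj (u v : 'I_n) : nreg (init_state e lamm laml eps) (1 + u * n + v) = e u v.
Proof.
rewrite -addnA add1n /=; congr nat_of_bool; apply/existsP/idP => [[u' /existsP[v' /andP[/eqP E euv]]]|euv].
  have n0 : 0 < n by apply: leq_trans n4.
  have h (x z : 'I_n) : (x * n + z) %/ n = x by rewrite divnMDl // divn_small ?addn0.
  have uu : u = u' by apply: ord_inj; rewrite -(h u v) -(h u' v') -E.
  have vv : v = v' by apply: ord_inj; move: E; rewrite uu => /eqP; rewrite eqn_add2l => /eqP.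
  by rewrite uu vv.
by exists u; apply/existsP; exists v; rewrite eqxx.
Qed.

Lemma init_high i : n * n < i -> nreg (init_state e lamm laml eps) i = 0.
Proof.
move=> hi /=; case: eqP => [?|_]; first by lia.
case: existsP => // -[u /existsP[v /andP[/eqP E _]]].
by have := ord_pair_lt u v; rewrite -E; lia.
Qed.

Lemma init_lamm (v : 'I_n) : rreg (init_state e lamm laml eps) v = lamm v.
Proof.
by rewrite /=; case: pickP => [w /eqP wv|/(_ v)]; [congr lamm; apply: val_inj|rewrite eqxx].
Qed.

Lemma init_laml (v : 'I_n) : rreg (init_state e lamm laml eps) (n + v) = laml v.
Proof.
rewrite /=; case: pickP => [w /eqP wv|_]; first by have := ltn_ord w; rewrite wv; lia.
case: pickP => [w /eqP wv|/(_ v)]; last by rewrite eqxx.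
by congr laml; apply: ord_inj; move: wv => /=; lia.
Qed.

Lemma init_eps : rreg (init_state e lamm laml eps) (2 * n) = eps.
Proof.
rewrite /=; case: pickP => [w /eqP wv|_]; first by have := ltn_ord w; rewrite wv; lia.
case: pickP => [w /eqP wv|_]; first by have := ltn_ord w; move: wv => /=; lia.
by rewrite mul2n addnn eqxx.
Qed.

Lemma tot_main :
  tot bits (main_cmd b0) (init_state e lamm laml eps) Ttotal (fun s' =>
    rreg s' 0 = estimate lamm laml (klam R B thr)
      (samples q (walk B (gstep e thr) t set0) m (seg bits 0 (m * q)))).
Proof.
have a64 := a64 n; have xb64 := xb64 n.
rewrite /Ttotal; set s0 := init_state _ _ _ _.
apply: tot_seq; apply: (tot_copy_graph _ esym eirr n4 init_nat0 init_adj init_high) => // s1 a0 a1 aadj ar au.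
apply: tot_seq; apply: (tot_copy_reals _ a0) => // s2 b2 b3 b4 bj bx bu.
have b0' : nreg s2 0 = n by rewrite bj. have b1 : nreg s2 1 = abase n by rewrite bj.
apply: tot_seq; apply: (tot_double_M _ ny ylow b0' b1 b3) => // s3 c5 c6 c7 c8 cj cr cu.
have c0 : nreg s3 0 = n by rewrite cj. have c2 : nreg s3 2 = xbase n by rewrite cj.
have c3 : nreg s3 3 = 1 by rewrite cj. have c4 : nreg s3 4 = 0 by rewrite cj.
have ce : rreg s3 (xbase n + 2 * n) = eps by rewrite cr bx // ar init_eps.
apply: tot_seq; apply: (tot_double_E _ PL Llow c0 c2 c3 c4 c8 ce) => // s4 d9 d10 dj dr du.
have d7 : nreg s4 7 = M by rewrite dj.
apply: tot_seq; apply: (tot_set_counts _ d7 d9 d10) => // s5 e12 e11 ej er eu.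
have s5j j : j \notin [:: 2; 3; 4; 5; 6; 7; 8; 9; 10; 11; 12; 18; 19; 20; 21] -> nreg s5 j = nreg s1 j.
  by rewrite !inE => hj; rewrite ej ?dj ?cj ?bj // !inE; lia.
have s5x j : 2 < j -> rreg s5 j = rreg s2 j by move=> hj; rewrite er dr ?cr // !inE; lia.
have f0 : nreg s5 0 = n by rewrite s5j.
have f2 : nreg s5 2 = xbase n by rewrite ej // dj.
have f3 : nreg s5 3 = 1 by rewrite ej // dj.
have f4 : nreg s5 4 = 0 by rewrite ej // dj.
have f5 : nreg s5 5 = abase n + abase n by rewrite ej // dj.
have f6 : nreg s5 6 = abase n + abase n + n by rewrite ej // dj.
have f7 : nreg s5 7 = M by rewrite ej.
have f8 : nreg s5 8 = B by rewrite ej // dj.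
have fm (v : 'I_n) : rreg s5 (xbase n + v) = lamm v.
  by have vn := ltn_ord v; rewrite s5x ?bx ?ar ?init_lamm //; lia.
have fl (v : 'I_n) : rreg s5 (xbase n + n + v) = laml v.
  by have vn := ltn_ord v; rewrite -addnA s5x ?bx ?ar ?init_laml //; lia.
have M0 : 0 < M by rewrite expn_gt0.
have kb64 : 64 <= abase n + abase n + n by lia.
apply: tot_seq; apply: (tot_thresholds _ M0 kb64 f0 f2 f3 f4 f6 f7 fm fl) => // s6 gk gm gl gj gu.
have lowj j : j < 18 -> nreg s6 j = nreg s5 j by move=> hj; apply: gj; rewrite ?inE; lia.
pose rm v := (lamm v / klam R B thr v)%R; pose rl v := (laml v / klam R B thr v)%R.
have st6 : stat e thr rm rl B m t s6.
  split; rewrite ?lowj //.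
  - by rewrite s5j.
  - move=> u v; have uv := ord_pair_lt u v.
    have h : 64 <= abase n + 1 + u * n + v < abase n + abase n by move: uv; rewrite /abase; lia.
    by rewrite gj ?s5j // ?inE; lia.
apply: tot_seq; apply: (tot_sample_loop esym st6) => // s7 st7 h3 h4 hx.
apply: (tot_final_pass _ st7 h3 h4 hx) => // s8 ->.
have u6 : used s6 = 0 by rewrite gu eu du cu bu au.
rewrite /estimate /= samples_seg !big_map u6; congr (_ * _)%R.
Qed.
End Run.

Local Open Scope ring_scope.

(** * Running time *)

(** The dominant part is [m] samples of [t] steps at a cost of order [n + B], with [B <= b0 + n].
    Preparation, storage and coins are each at most a constant times [m * t * n]. *)
Lemma Ttotal_bound (n b0 y L : nat) (B := (b0 + y)%N) (M := (2 ^ B)%N) (E := (2 ^ L)%N)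
    (m := (M * M * E * E)%N) (t := (M ^ 3 * (B + L))%N) :
  (4 <= n)%N -> (0 < b0)%N -> (y <= n)%N -> (n <= M)%N ->
  (Ttotal n b0 y L + m * (t * (B + B)) <= (2000 + 20 * b0) * (m * t * n))%N.
Proof.
move=> n4 b00 yn nM.
have yM : (y <= M)%N by apply: leq_trans yn nM.
have LE : (L <= E)%N by rewrite ltnW // ltn_expl.
have E1 : (1 <= E)%N by rewrite expn_gt0.
have M1 : (1 <= M)%N by rewrite expn_gt0.
have H1 : (1 <= B + L)%N by rewrite /B; lia.
have M3 : (1 <= M ^ 3)%N by rewrite expn_gt0 M1.
have t1 : (1 <= t)%N by rewrite muln_gt0 M3.
have Ht : (B + L <= t)%N by rewrite leq_pmull.
have MM : (M * M <= m)%N by rewrite /m -mulnA leq_pmulr // muln_gt0 E1.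
have Em : (E <= m)%N by rewrite /m leq_pmull // muln_gt0 E1 muln_gt0 M1.
have Mm : (M <= m)%N by apply: leq_trans MM; rewrite leq_pmulr.
have nnm : (n * n <= m)%N by apply: leq_trans MM; apply: leq_mul.
have nMm : (n * M <= m)%N by apply: leq_trans MM; apply: leq_mul.
have m1 : (1 <= m)%N by apply: leq_trans Mm.
have mmt : (m <= m * t)%N by rewrite leq_pmulr.
have tmt : (t <= m * t)%N by rewrite leq_pmull.
have mtP : (4 * (m * t) <= m * t * n)%N by rewrite mulnC leq_mul2l n4 orbT.
have mnP : (m * n <= m * t * n)%N by rewrite leq_mul2r mmt orbT.
have mtB : (m * t * B <= b0 * (m * t) + m * t * n)%N.
  by rewrite [(b0 * _)%N]mulnC -mulnDr leq_mul2l leq_add2l yn orbT.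
have b0P : (b0 * (m * t) <= b0 * (m * t * n))%N by rewrite leq_mul2l; apply/orP; right; lia.
rewrite /Ttotal /Tsample /abase -/B -/M -/E -/m -/t.
have -> : (m * (t * (12 * n + 12 * B + 27) + 18 * n + 19).+2
  = 12 * (m * t * n) + 12 * (m * t * B) + 27 * (m * t) + 18 * (m * n) + 21 * m)%N by ring.
have -> : (m * (t * (B + B)) = 2 * (m * t * B))%N by ring.
have -> : (n * (5 * M + 23) = 5 * (n * M) + 23 * n)%N by ring.
have -> : ((2000 + 20 * b0) * (m * t * n) = 2000 * (m * t * n) + 20 * (b0 * (m * t * n)))%N by ring.
move: Ht E1 LE Em; rewrite -/E.
move: (b0 * (m * t))%N (b0 * (m * t * n))%N mtB b0P => b1 b2 mtB b0P.
move: (m * t * n)%N (m * t * B)%N mtP mnP mtB b0P => P PB mtP mnP mtB b0P.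
move: (m * t)%N (m * n)%N (n * M)%N (n * n)%N mmt tmt mtP mnP nMm nnm => mt mn nM' nn mmt tmt mtP mnP nMm nnm.
clearbody t m E M B; lia.
Qed.

Lemma ln2_ge_half (R : realType) : 2^-1 <= ln (2 : R).
Proof.
rewrite -ler_expR lnK ?posrE //.
have h : 2^-1 <= (expR (2^-1 : R))^-1.
  by rewrite -expRN; apply: le_trans (expR_ge1Dx _); lra.
by rewrite -(lef_pV2 (x := 2)) ?posrE ?expR_gt0.
Qed.

Lemma addn_le_ln (R : realType) (B L : nat) (z : R) :
  (2 ^ B * 2 ^ L)%:R <= z -> (B + L)%:R <= 2 * ln z.
Proof.
move=> le_z.
have z0 : 0 < z by apply: lt_le_trans le_z; rewrite ltr0n muln_gt0 !expn_gt0.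
rewrite -expnD natrX in le_z.
have h : (B + L)%:R * ln 2 <= ln z.
  by rewrite mulr_natl -lnXn // ler_ln // posrE exprn_gt0.
have := ln2_ge_half R; have : 0 <= (B + L)%:R :> R by [].
nra.
Qed.

(** Here [M <= A * n] and [E <= 2 / eps], so [M ^ 5 * E ^ 2 * n] is of order [n ^ 6 / eps ^ 2], and
    [B + L] is logarithmic in [M * E]. The power of [n] is then raised to 7. *)
Lemma work_bound (R : realType) (n b0 y L : nat) (eps : R) (A := (2 ^ b0.+1)%:R : R)
    (B := (b0 + y)%N) (M := (2 ^ B)%N) (E := (2 ^ L)%N) :
  (0 < n)%N -> 0 < eps -> eps < 1 -> (2 ^ y <= 2 * n)%N -> eps * E%:R <= 2 ->
  (M * M * E * E * (M ^ 3 * (B + L)) * n)%:R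
    <= 8 * A ^+ 5 * (1 + ln (2 * A)) * (n%:R ^+ 7 / eps ^+ 2) * (1 + ln (n%:R / eps)).
Proof.
move=> n0 e0 e1 yn En.
have A1 : 1 <= A by rewrite ler1n expn_gt0.
have n1 : 1 <= n%:R :> R by rewrite ler1n.
have MA : M%:R <= A * n%:R.
  by rewrite -natrM ler_nat /M /B expnD expnS -mulnA mulnCA leq_mul2l yn orbT.
have EA : E%:R <= 2 / eps by rewrite ler_pdivlMr // mulrC.
have a0 : 0 <= ln (2 * A) by apply: ln_ge0; lra.
have ne1 : 1 <= n%:R / eps by rewrite ler_pdivlMr // mul1r (le_trans (ltW e1)).
have l0 : 0 <= ln (n%:R / eps) by apply: ln_ge0.
have HL : (B + L)%:R <= 2 * ((1 + ln (2 * A)) * (1 + ln (n%:R / eps))).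
  have /(addn_le_ln) : (M * E)%:R <= (2 * A) * (n%:R / eps).
    rewrite natrM; apply: le_trans (ler_pM _ _ MA EA) _ => //.
    by rewrite le_eqVlt; apply/orP; left; apply/eqP; ring.
  rewrite lnM ?posrE; [|lra|lra].
  nra.
have M5 : M%:R ^+ 5 <= (A * n%:R) ^+ 5 by rewrite lerXn2r ?nnegrE // mulr_ge0 // (le_trans ler01).
have E2 : E%:R ^+ 2 <= (2 / eps) ^+ 2.
  by rewrite lerXn2r ?nnegrE // divr_ge0 // ltW.
have n67 : n%:R ^+ 6 <= n%:R ^+ 7 :> R by rewrite ler_weXn2l.
set G := (1 + ln (2 * A)) * _ in HL.
have G0 : 0 <= G by rewrite mulr_ge0 // addr_ge0.
have prodE (a b c : nat) : (a * a * b * b * (a ^ 3 * c) * n)%:R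
    = a%:R ^+ 5 * b%:R ^+ 2 * c%:R * n%:R :> R.
  have -> : (a * a * b * b * (a ^ 3 * c) * n = a ^ 5 * b ^ 2 * c * n)%N by ring.
  by rewrite 3!natrM 2!natrX.
rewrite prodE.
apply: (@le_trans _ _ ((A * n%:R) ^+ 5 * (2 / eps) ^+ 2 * (2 * G) * n%:R)).
  rewrite ler_wpM2r // ler_pM // ?mulr_ge0 ?exprn_ge0 //.
  by rewrite ler_pM ?exprn_ge0.
have -> : (A * n%:R) ^+ 5 * (2 / eps) ^+ 2 * (2 * G) * n%:R
  = (8 * A ^+ 5 * G / eps ^+ 2) * n%:R ^+ 6 by rewrite expr_div_n; ring.
have -> : 8 * A ^+ 5 * (1 + ln (2 * A)) * (n%:R ^+ 7 / eps ^+ 2) * (1 + ln (n%:R / eps))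
  = (8 * A ^+ 5 * G / eps ^+ 2) * n%:R ^+ 7 by rewrite /G; ring.
rewrite ler_wpM2l // divr_ge0 ?exprn_ge0 ?(ltW e0) //.
by rewrite mulr_ge0 // mulr_ge0 // exprn_ge0; lra.
Qed.

Lemma max_degree_lt (n : nat) (e : rel 'I_n) :
  simple_graph e -> (0 < n)%N -> (max_degree e < n)%N.
Proof.
move=> [_ eirr] n0; suff h : (max_degree e <= n.-1)%N by rewrite (leq_ltn_trans h) // prednK.
apply/bigmax_leqP => v _.
have -> : n.-1 = #|[set~ v]| by rewrite cardsC1 card_ord.
by apply: subset_leq_card; apply/subsetP => u; rewrite !inE; apply: contraTneq => ->; rewrite eirr.
Qed.

Lemma max_degree0 (e : rel 'I_0) : max_degree e = 0%N.
Proof. by rewrite /max_degree big_ord0. Qed.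

Lemma ex_dyadic_scale (R : realType) (eps : R) : 0 < eps -> eps < 1 ->
  exists L, [/\ 1 < eps * (2 ^ L)%:R, forall i, (i < L)%N -> ~~ (1 < eps * (2 ^ i)%:R)
              & eps * (2 ^ L)%:R <= 2].
Proof.
move=> e0 e1.
have ex : exists L, 1 < eps * (2 ^ L)%:R.
  exists (Num.bound eps^-1).
  rewrite mulrC -ltr_pdivrMr // mul1r.
  apply: lt_le_trans (archi_boundP _) _; first by rewrite invr_ge0 ltW.
  by rewrite ler_nat ltnW // ltn_expl.
have [L PL minL] := ex_minnP ex; exists L; split=> //.
  by move=> i iL; apply/negP => /minL; rewrite leqNgt iL.
case: L PL minL => [|L] PL minL; first by rewrite mulr1; lra.
have : ~~ (1 < eps * (2 ^ L)%:R) by apply/negP => /minL; rewrite ltnn.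
by rewrite -leNgt expnS natrM; lra.
Qed.

(** What the analysis takes from the threshold: at distance [1 / (4 * n)] the partition functions
    still agree up to a constant. *)
Lemma theta_le (R : realType) (n : nat) (eps : R) : (0 < n)%N -> 0 < eps -> eps < 1 ->
  10 ^- 10 * Num.sqrt (Num.sqrt eps) / (n%:R ^+ 2 * Num.sqrt n%:R) <= (4 * n%:R)^-1 :> R.
Proof.
move=> n0 e0 e1.
have n1 : 1 <= n%:R :> R by rewrite ler1n.
have s1 : Num.sqrt (Num.sqrt eps) <= 1.
  rewrite -[leRHS]sqrtr1 ler_wsqrtr // -[leRHS]sqrtr1 ler_wsqrtr //; exact: ltW.
have sn : 1 <= Num.sqrt (n%:R : R) by rewrite -[leLHS]sqrtr1 ler_wsqrtr.
have t10 : 10 ^- 10 <= 4^-1 :> R.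
  rewrite lef_pV2 ?posrE ?exprn_gt0 //.
  apply: (@le_trans _ _ 10); first by lra.
  by rewrite -[leLHS]expr1 ler_weXn2l //; lra.
have nn : n%:R <= n%:R ^+ 2 * Num.sqrt (n%:R : R).
  by rewrite -[leLHS]mulr1 ler_pM // expr2 ler_peMr //; lra.
rewrite [leRHS]invfM ler_pM //.
- by rewrite mulr_ge0 ?sqrtr_ge0 // invr_ge0 exprn_ge0.
- by rewrite invr_ge0 mulr_ge0 ?sqrtr_ge0 // exprn_ge0.
- by rewrite -[leRHS]mulr1 ler_pM ?sqrtr_ge0 // invr_ge0 exprn_ge0.
- by rewrite lef_pV2 ?posrE //; lra.
Qed.

Lemma take_bits (T q : nat) (b : nat -> bool) : (q <= T)%N ->
  take q (mkseq b T) = seg b 0 q.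
Proof.
move=> qT; apply: (@eq_from_nth _ false); rewrite size_take_min size_mkseq (minn_idPl qT).
  by rewrite size_mkseq.
by move=> i iq; rewrite nth_take // !nth_mkseq // (leq_trans iq).
Qed.

Definition time_const (R : realType) (b0 : nat) (A := (2 ^ b0.+1)%:R : R) : R :=
  (2000 + 20 * b0)%:R * (8 * A ^+ 5 * (1 + ln (2 * A))).

Lemma run_time_bound (R : realType) (n b0 y L : nat) (eps x : R)
    (B := (b0 + y)%N) (M := (2 ^ B)%N) (E := (2 ^ L)%N) :
  (4 <= n)%N -> (0 < b0)%N -> (y <= n)%N -> (n <= 2 ^ y)%N -> 0 < eps -> eps < 1 ->
  (2 ^ y <= 2 * n)%N -> eps * E%:R <= 2 -> 0 <= x ->
  (M * M * E * E * (M ^ 3 * (B + L) * (B + B)) + Ttotal n b0 y L)%:R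
    <= time_const R b0 * (n%:R ^+ 7 / eps ^+ 2 + x) * (1 + ln (n%:R / eps)).
Proof.
move=> n4 b00 yn ny e0 e1 y2n PL2 x0.
have n0 : (0 < n)%N by apply: leq_trans n4.
have nM : (n <= M)%N by rewrite (leq_trans ny) // leq_exp2l // leq_addl.
have le1 := Ttotal_bound L n4 b00 yn nM.
have le2 := @work_bound R n b0 y L eps n0 e0 e1 y2n PL2.
rewrite addnC /time_const; set A : R := (2 ^ b0.+1)%:R.
move: le1; rewrite -/B -/M -/E => le1.
move: le2; rewrite -/A -/B -/M -/E => le2.
move: le1 le2; set K := (2000 + _)%N; set W := (_ * n)%N; set T := (_ + _ * (_ * _))%N => le1 le2.
clearbody K W T.
have n1 : 1 <= n%:R / eps by rewrite ler_pdivlMr // mul1r (le_trans (ltW e1)) // ler1n.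
have l0 : 0 <= 1 + ln (n%:R / eps) by rewrite addr_ge0 // ln_ge0.
have A1 : 1 <= A by rewrite ler1n expn_gt0.
have a0 : 0 <= 1 + ln (2 * A) by rewrite addr_ge0 // ln_ge0 //; lra.
have c0 : 0 <= 8 * A ^+ 5 * (1 + ln (2 * A)).
  by rewrite mulr_ge0 // mulr_ge0 // exprn_ge0 // (le_trans ler01).
apply: (@le_trans _ _ (K%:R * W%:R)); first by rewrite -natrM ler_nat.
rewrite -2!mulrA ler_wpM2l //; apply: le_trans le2 _.
by rewrite -mulrA ler_wpM2l // ler_wpM2r // lerDl.
Qed.

From mathcomp Require Import all_classical all_reals all_analysis.
Import Order.TTheory GRing.Theory Num.Theory.

Theorem theorem5p3 (R : realType) (eta : R) (Heta0 : 0 < eta) (Heta1 : eta < 1) :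
  exists (prog : seq instr) (C : R) (k : nat),
  forall (n : nat) (e : rel 'I_n) (lamm laml : 'I_n -> R) (eps : R),
    simple_graph e -> (3 <= max_degree e)%N ->
    0 < eps -> eps < 1 ->
    (forall v, 0 <= lamm v) -> (forall v, 0 <= laml v) ->
    uniqueness e eta lamm -> uniqueness e eta laml ->
    dpar_lt lamm laml
      (10 ^- 10 * Num.sqrt (Num.sqrt eps) / (n%:R ^+ 2 * Num.sqrt n%:R)) ->
    exists T : nat,
      T%:R <= C * (n%:R ^+ 7 / eps ^+ 2
                   + n%:R ^+ 6 * Num.sqrt n%:R / (eps ^+ 2 * Num.sqrt (Num.sqrt eps)))
                * (1 + ln (n%:R / eps)) ^+ k /\
      (forall b : {ffun 'I_T -> bool},
         output_within prog T (bits_of b) (init_state e lamm laml eps) != None) /\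
      (2 * 2 ^ T <= 3 * #|[set b : {ffun 'I_T -> bool} |
         if output_within prog T (bits_of b) (init_state e lamm laml eps) is Some d
         then (((1 - eps) * dTV e lamm laml <= d) && (d <= (1 + eps) * dTV e lamm laml))%R
         else false]|)%N.
Proof.
have eta01 : 0 < eta < 1 by rewrite Heta0.
have [b0 [b00 estP]] := estimator_exists eta01.
exists (program (main_cmd b0)), (time_const R b0), 1%N.
move=> n e lamm laml eps eG D3 e0 e1 lamm0 laml0 um ul dpar.
have n0 : (0 < n)%N by case: n e lamm laml eG D3 {um ul lamm0 laml0 dpar} => // e _ _ _; rewrite max_degree0.
have n4 : (4 <= n)%N by apply: leq_ltn_trans D3 (max_degree_lt eG n0).
pose y := up_log 2 n.
have ny : (n <= 2 ^ y)%N by apply: up_logP.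
have ylow i : (i < y)%N -> (2 ^ i < n)%N.
  by move=> iy; rewrite ltnNge; apply/negP => /(up_log_min (ltnSn 1)); rewrite leqNgt iy.
have y0 : (0 < y)%N by rewrite lt0n; apply: contraTneq ny => ->; rewrite -ltnNge (leq_trans _ n4).
have y2n : (2 ^ y <= 2 * n)%N by rewrite -(prednK y0) expnS leq_mul2l ltnW // ylow // prednK.
have yn : (y <= n)%N by rewrite -(prednK y0) (leq_trans (ltn_expl _ (ltnSn 1))) // ltnW // ylow // prednK.
have [L [PL Llow PL2]] := ex_dyadic_scale e0 e1.
have [esym eirr] := eG.
pose thr0 := thr lamm laml b0 y.
pose B := (b0 + y)%N; pose t := ((2 ^ B) ^ 3 * (B + L))%N.
pose m := (2 ^ B * 2 ^ B * 2 ^ L * 2 ^ L)%N; pose q := (t * (B + B))%N.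
pose est s := estimate lamm laml (klam R B thr0) (samples q (walk B (gstep e thr0) t finset.set0) m s).
pose good (x : R) := ((1 - eps) * dTV e lamm laml <= x) && (x <= (1 + eps) * dTV e lamm laml).
(* [T] is both the number of coins and the fuel; as a sum it covers the [m * q] coins read and the
   [Ttotal] steps. *)
pose T := (m * q + Ttotal n b0 y L)%N; exists T.
have out (b : nat -> bool) : output_within (program (main_cmd b0)) T b (init_state e lamm laml eps)
    = Some (est (seg b 0 (m * q))).
  have KT : (Ttotal n b0 y L <= T)%N by apply: leq_addl.
  have := program_output (main_wf b0) (erefl 0%N : pc (init_state e lamm laml eps) = 0%N)
    (tot_main b lamm laml esym eirr n4 b0 ny ylow PL Llow) KT.
  by move=> [s' -> ->].
split; last split.
- rewrite expr1; apply: (run_time_bound n4 b00 yn ny e0 e1 y2n PL2).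
  by rewrite !mulr_ge0 ?exprn_ge0 ?sqrtr_ge0 // invr_ge0 mulr_ge0 ?sqrtr_ge0 // exprn_ge0 // ltW.
- by move=> b; rewrite out.
rewrite -(ler_nat R) !natrM -sum1_card natr_sum big_mkcond /=.
have -> : \sum_(b : {ffun 'I_T -> bool}) (if b \in [set b | match output_within (program (main_cmd b0)) T (bits_of b) (init_state e lamm laml eps) with
    | Some d => good d | None => false end] then 1 else 0)
  = \sum_(b : {ffun 'I_T -> bool}) (good (est (take (m * q) (mkseq (bits_of b) T))))%:R :> R.
  apply: eq_bigr => b _; rewrite inE out take_bits ?leq_addr //.
  by case: (good _).
rewrite (sum_ffun_avg T (fun s => (good (est (take (m * q) s)))%:R)).
(* Only the first [m * q] coins matter, so the fraction of good sequences of length [T] is the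
   success probability of the estimate. *)
rewrite (avg_take (m * q) _ (fun s => (good (est s))%:R)).
have dp v : `|lamm v - laml v| <= (4 * n%:R)^-1 by apply: le_trans (ltW (dpar v)) (theta_le n0 e0 e1).
have kP v : kspec (Num.max (lamm v) (laml v)) (2 ^ B) (thr0 v).
  by apply: kthr_spec; rewrite ?expn_gt0 // le_max lamm0.
have := estP n e lamm laml eps y L thr0 eG D3 e0 e1 lamm0 laml0 um ul dp ny (ltW PL) kP t m q erefl erefl erefl.
rewrite -/(est _) => h.
have p0 : 0 < (2 ^ T)%:R :> R by rewrite ltr0n expn_gt0.
apply: (@le_trans _ _ (3 * ((2 ^ T)%:R * (2 / 3)))); first by rewrite le_eqVlt; apply/orP; left; apply/eqP; field.
by rewrite ler_pM2l // ler_pM2l.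
Qed.
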